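(* Let $d>1$, $L>0$, let $A\subset B_L\subset\mathbb{R}^d$ be measurable, and let $r$ be the radius of the ball $A^*$. Let $\sigma_1,\sigma_2,\dots$ be the (state-dependent) random sequence of reflections, with $A_n=A^{\sigma_1\cdots\sigma_n}$ and $X_n=m(A_n\setminus A^* )$, for which, conditionally on the current state $A_n$, $$\mathbb{P}(\sigma_{n+1}(0)\in B\mid A_n)=\frac{\int_B g_n(x)\pi_n(x)\,dx}{\int_{\mathbb{R}^d}g_n(x)\pi_n(x)\,dx},$$ with the weights $g_n$ and $\pi_n$ defined in the context. Then $$\mathbb{E}[X_n]=O\left(n^{-\left(2-\frac1d\right)}(\log n)^{1-\frac1d}\right)\quad\text{as } n\to\infty .$$
   Context: $m$ is Lebesgue measure (on $\mathbb{R}^d$ or, for subsets of $\mathbb{R}^d\times\mathbb{R}^d$, on $\mathbb{R}^{2d}$); $B_s$ is the ball of radius $s$ centered at the origin, $B_s^c$ its complement; $\omega_d$ is the surface area of $B_1$. For measurable $A$ of finite measure, $A^*$ is the open ball centered at the origin with $m(A^* )=m(A)$. Polarization: let $\Omega$ be the set of reflections of $\mathbb{R}^d$ across affine hyperplanes that do not map the origin to itself (determined by $\sigma(0)\ne0$). For $\sigma\in\Omega$, let $X_0^\sigma$ be the hyperplane fixed by $\sigma$, $X_+^\sigma$ the open half-space of its complement containing $0$ and $X_-^\sigma$ the other one. The polarization of $f$ is $f^\sigma(x)=\max(f(x),f(\sigma(x)))$ on $X_+^\sigma$, $\min(f(x),f(\sigma(x)))$ on $X_-^\sigma$, and $f(x)$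 on $X_0^\sigma$; $A^\sigma$ is the set with $\mathbf{1}_{A^\sigma}=(\mathbf{1}_A)^\sigma$. $A^{\sigma_1\cdots\sigma_n}$ is the result of polarizing successively with respect to $\sigma_1,\dots,\sigma_n$. $\sigma_{x,y}$ denotes the unique reflection mapping $x$ to $y$ (for $x\neq y$), and $u(x,y)=\sigma_{x,y}(0)$. Weights: $\pi_n(x)=X_n-m(A_n^{\sigma_{0,x}}\setminus A^* )$. Set $$\delta_n=c_d\frac{\log n}{n},\quad c_d=\frac{8(2L)^d(2d-1)}{d^2},\quad \lambda_n=(2^{d+1}\omega_dL)^{1/d}\,\delta_n^{1-1/d},$$ $$F_n=\{(x,y)\in(A_n\setminus A^* )\times(A^*\setminus A_n):|x|\le r+\delta_n,\ |y|>r-\delta_n\}\cap u^{-1}(B_{\lambda_n}^c),$$ $$G_n=\{(x,y)\in(A_n\setminus A^* )\times(A^*\setminus A_n):|x|\le r+\delta_n,\ |y|>r-\delta_n\}\cap u^{-1}(B_{\lambda_n}),$$ and - $g_n(x)=|x|^{-(d-1)}\mathbf{1}_{B_{\lambda_n}^c}(x)$ if $m(F_n)>m(G_n)$ and $m(F_n\cup G_n)\ge\frac12X_n^2$; - $g_n(x)=|x|^{-(d-1)}\mathbf{1}_{B_{\lambda_n}}(x)$ if $m(F_n)\le m(G_n)$ and $m(F_n\cup G_n)\ge\frac12X_n^2$; - $g_n(x)=|x|^{-(d-1)}\pi_n(x)^{-1}$ otherwise, meaning that in this case $\sigma_{n+1}(0)$ has the law $(2L\omega_d)^{-1}|x|^{-(d-1)}\mathbf{1}_{B_{2L}}(x)\,dx$.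 For $n\in\{0,1\}$ (where $\log n/n$ is not positive), and whenever $X_n=0$, use the law of the last case. *)

(* Defs.v *)
(* Uses MathComp and MathComp-Analysis. *)
From HB Require Import structures.
From mathcomp Require Import all_boot all_order all_algebra.
From mathcomp Require Import all_classical all_reals all_analysis.
Set Implicit Arguments.
Unset Strict Implicit.
Unset Printing Implicit Defensive.
Import Order.TTheory GRing.Theory Num.Theory.
Import numFieldNormedType.Exports.
Local Open Scope classical_set_scope.
Local Open Scope ring_scope.

(* R^d is 'rV[R]_d. Its Borel sigma-algebra is generated by the coordinates. *)

Definition measure_rV_display : measure_display -> measure_display.
Proof. exact. Qed.

Section measurable_rV.
Context {dT : measure_display} {T : sigmaRingType dT} (n : nat).

Let coors : 'I_n -> 'rV[T]_n -> T := fun i x => x ord0 i.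

Let rV_set0 : g_sigma_preimage coors set0.
Proof. exact: sigma_algebra0. Qed.

Let rV_setC A : g_sigma_preimage coors A -> g_sigma_preimage coors (~` A).
Proof. exact: sigma_algebraC. Qed.

Let rV_bigcup (F : _^nat) : (forall i, g_sigma_preimage coors (F i)) ->
  g_sigma_preimage coors (\bigcup_i (F i)).
Proof. exact: sigma_algebra_bigcup. Qed.

HB.instance Definition _ := @isMeasurable.Build (measure_rV_display dT)
  'rV[T]_n (g_sigma_preimage coors) rV_set0 rV_setC rV_bigcup.

End measurable_rV.

Lemma measurable_coord {dT} {T : measurableType dT} n (i : 'I_n) :
  measurable_fun [set: 'rV[T]_n] (fun x => x ord0 i).
Proof.
move=> _ Y mY; rewrite setTI; apply: sub_sigma_algebra => /=.
rewrite -bigcup_seq/=; exists i => /=; first by rewrite mem_index_enum.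
by exists Y => //; rewrite setTI.
Qed.

Lemma measurable_fun_rV {d1 d2} {T1 : measurableType d1}
    {T2 : measurableType d2} n (f : T1 -> 'rV[T2]_n) :
  (forall i, measurable_fun [set: T1] (fun x => f x ord0 i)) ->
  measurable_fun [set: T1] f.
Proof.
move=> mf _ A mA; rewrite setTI.
have sub : measurable `<=` [set B | measurable (f @^-1` B)].
  apply: smallest_sub.
    split=> [|B /= mB|F /= mF]; first by rewrite /= preimage_set0.
    - by rewrite setTD preimage_setC; exact: measurableC.
    - by rewrite preimage_bigcup; exact: bigcup_measurable.
  rewrite -bigcup_seq => B [i /= _ [C mC <-]] /=.
  by have := mf i measurableT _ mC; rewrite !setTI.
exact: sub.
Qed.

Section lebesgue_rV.
Context {R : realType}.
Local Open Scope ereal_scope.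

Definition cons_rV n (p : R * 'rV[R]_n) : 'rV[R]_n.+1 :=
  row_mx (p.1)%:M p.2 : 'rV[R]_(1 + n).

Lemma cons_rV0 n (p : R * 'rV[R]_n) : cons_rV p ord0 ord0 = p.1.
Proof.
rewrite /cons_rV mxE; case: splitP => //= i _.
by rewrite mxE !ord1 eqxx mulr1n.
Qed.

Lemma cons_rV_lift n (p : R * 'rV[R]_n) j :
  cons_rV p ord0 (lift ord0 j) = p.2 ord0 j.
Proof.
rewrite /cons_rV mxE; case: splitP => /= [i|i] [ji].
  by case: i ji => -[].
by congr (p.2 _ _); apply/val_inj; exact/esym.
Qed.

Lemma cons_rV_surj n (x : 'rV[R]_n.+1) :
  cons_rV (x ord0 ord0, \row_j x ord0 (lift ord0 j)) = x.
Proof.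
apply/rowP => i; case: (unliftP ord0 i) => [j ->|->].
- by rewrite cons_rV_lift mxE.
- by rewrite cons_rV0.
Qed.

Lemma measurable_cons_rV n :
  measurable_fun [set: measurableTypeR R * 'rV[R]_n] (@cons_rV n).
Proof.
apply: measurable_fun_rV => i; case: (unliftP ord0 i) => [j ->|->].
- rewrite (funext (fun p => cons_rV_lift p j)).
  exact: (measurableT_comp (measurable_coord j)).
- rewrite (funext (@cons_rV0 n)).
  exact: (@measurable_fst _ _ (measurableTypeR R)).
Qed.

Section cons_measure.
Context n (m : {sigma_finite_measure set 'rV[R]_n -> \bar R}).

Definition cons_measure : set 'rV[R]_n.+1 -> \bar R :=
  pushforward (@lebesgue_measure R \x m) (@cons_rV n).

Let cons_measure0 : cons_measure set0 = 0.
Proof. by rewrite /cons_measure /pushforward preimage_set0 measure0. Qed.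

Let cons_measure_ge0 A : 0 <= cons_measure A.
Proof. by rewrite /cons_measure /pushforward measure_ge0. Qed.

Let cons_measure_sigma_additive : semi_sigma_additive cons_measure.
Proof.
have mX A : measurable A -> measurable (@cons_rV n @^-1` A).
  by move=> mA; rewrite -[X in measurable X]setTI; exact: measurable_cons_rV.
move=> F mF tF mUF; rewrite /cons_measure /pushforward preimage_bigcup.
apply: measure_semi_sigma_additive.
- by move=> k; exact: mX.
- apply/trivIsetP => /= i j _ _ ij; rewrite -preimage_setI.
  by move/trivIsetP : tF => /(_ _ _ _ _ ij) ->//; rewrite preimage_set0.
- by rewrite -preimage_bigcup; exact: mX.
Qed.

HB.instance Definition _ := isMeasure.Build _ _ _ cons_measure
  cons_measure0 cons_measure_ge0 cons_measure_sigma_additive.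

Let cons_measure_sigma_finite : sigma_finite setT cons_measure.
Proof.
have /sigma_finiteP[F [TF ndF Foo]] := sigma_finiteT (@lebesgue_measure R).
have /sigma_finiteP[G [TG ndG Goo]] := sigma_finiteT m.
exists (fun k => [set x : 'rV[R]_n.+1 | F k (x ord0 ord0) /\
     G k (\row_j x ord0 (lift ord0 j))]).
  apply/esym/seteqP; split => // x _.
  have [i _ Fi] : (\bigcup_i F i) (x ord0 ord0) by rewrite -TF.
  have [j _ Gj] : (\bigcup_i G i) (\row_j x ord0 (lift ord0 j)) by rewrite -TG.
  exists (maxn i j) => //; split => /=.
    by move: Fi; apply/subsetPset/ndF/leq_maxl.
  by move: Gj; apply/subsetPset/ndG/leq_maxr.
move=> k; have [mF Fk] := Foo k; have [mG Gk] := Goo k.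
split.
  apply: measurableI.
    rewrite -[X in measurable X]setTI.
    exact: (measurable_coord ord0 measurableT mF).
  rewrite -[X in measurable X]setTI.
  have mr : measurable_fun [set: 'rV[R]_n.+1]
      (fun x => \row_j x ord0 (lift ord0 j)).
    apply: measurable_fun_rV => j.
    rewrite (funext (fun x : 'rV[R]_n.+1 =>
      mxE _ (fun _ k => x ord0 (lift ord0 k)) ord0 j)).
    exact: measurable_coord.
  exact: mr.
rewrite /cons_measure /pushforward.
rewrite (_ : _ @^-1` _ = F k `*` G k).
  by rewrite product_measure1E// lte_mul_pinfty// ge0_fin_numE.
apply/seteqP; split => -[a b] /= [];
  rewrite cons_rV0 (_ : \row_j _ = b)//; apply/rowP => j;
  by rewrite mxE cons_rV_lift.
Qed.

HB.instance Definition _ := Measure_isSigmaFinite.Build _ _ _ cons_measure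
  cons_measure_sigma_finite.

End cons_measure.

Fixpoint lebesgue_rV d : {sigma_finite_measure set 'rV[R]_d -> \bar R} :=
  if d is d'.+1 return {sigma_finite_measure set 'rV[R]_d -> \bar R}
  then cons_measure (lebesgue_rV d')
  else \d_(0%R : 'rV[R]_0).

End lebesgue_rV.

Lemma lebesgue_rV_box {R : realType} d (B : 'I_d -> set R) :
  (forall i, measurable (B i)) ->
  lebesgue_rV d [set x : 'rV[R]_d | forall i, B i (x ord0 i)] =
  (\prod_(i < d) (lebesgue_measure (B i) : \bar R))%E.
Proof.
elim: d B => [|d IH] B mB /=.
  rewrite big_ord0 diracE mem_set//=; by case.
have mB' : measurable [set x : 'rV[R]_d | forall i, B (lift ord0 i) (x ord0 i)].
  rewrite (_ : [set _ | _] =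
      \bigcap_(i in [set: 'I_d]) [set x : 'rV[R]_d | B (lift ord0 i) (x ord0 i)]).
    apply: fin_bigcap_measurable => // i _; rewrite -[X in measurable X]setTI.
    exact: (measurable_coord i measurableT (mB _)).
  by apply/seteqP; split => x /= Bx => [i _|i]; exact: Bx.
rewrite /cons_measure /pushforward big_ord_recl -IH; last by move=> i; exact: mB.
rewrite -product_measure1E//; last exact: mB.
congr ((_ \x _)%E _); apply/seteqP; split => -[a b] /=.
  move=> h; split; first by have := h ord0; rewrite cons_rV0.
  by move=> i; have := h (lift ord0 i); rewrite cons_rV_lift.
move=> [ha hb] i; case: (unliftP ord0 i) => [j ->|->].
  by rewrite cons_rV_lift; exact: hb.
by rewrite cons_rV0.
Qed.

(* The outer extension m^* agrees with the completion of m on Lebesgue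
   measurable sets, so it measures Borel and non-Borel sets alike. *)
Definition lebesgue_measurable {R : realType} d (E : set 'rV[R]_d) :=
  exists B N, [/\ measurable B, (@lebesgue_rV R d).-negligible N
                 & E = B `|` N].

Definition leb {R : realType} d (E : set 'rV[R]_d) : \bar R :=
  ((@lebesgue_rV R d)^* E)%mu.

Definition vol {R : realType} d (E : set 'rV[R]_d) : R := fine (leb E).

Definition vol2 {R : realType} d (E : set ('rV[R]_d * 'rV[R]_d)) : R :=
  fine (((@lebesgue_rV R d \x @lebesgue_rV R d)%E)^* E)%mu.

Section geometry.
Context {R : realType} {d : nat}.
Implicit Types (x y v : 'rV[R]_d) (s : 'rV[R]_d -> 'rV[R]_d)
  (E : set 'rV[R]_d).

(* The norm `|x| of the library is the sup norm on 'rV[R]_d. *)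
Definition dot x y : R := \sum_(i < d) x ord0 i * y ord0 i.
Definition enorm x : R := Num.sqrt (dot x x).

Definition oball (s : R) : set 'rV[R]_d := [set x | enorm x < s].

(* Reflection across the affine hyperplane {x | dot v x = c}, v != 0. *)
Definition hrefl v (c : R) x := x - (2 * (dot v x - c) / dot v v) *: v.

Definition Omega : set ('rV[R]_d -> 'rV[R]_d) :=
  [set s | (exists v c, v != 0 /\ s = hrefl v c) /\ s 0 != 0].

Definition sigma_between x y :=
  hrefl (y - x) ((dot y y - dot x x) / 2).

Definition u (p : 'rV[R]_d * 'rV[R]_d) : 'rV[R]_d := sigma_between p.1 p.2 0.

Definition mirror s : set 'rV[R]_d := [set x | s x = x].

(* x is on the same side of the mirror as 0 iff the segment [0, x] avoids the
   mirror. *)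
Definition pos_side s : set 'rV[R]_d :=
  [set x | forall t : R, 0 <= t <= 1 -> ~ mirror s (t *: x)].

Definition neg_side s : set 'rV[R]_d := ~` (mirror s `|` pos_side s).

Definition polarize_fun s (f : 'rV[R]_d -> R) x : R :=
  if x \in pos_side s then Num.max (f x) (f (s x))
  else if x \in neg_side s then Num.min (f x) (f (s x))
  else f x.

Definition polarize s E : set 'rV[R]_d :=
  [set x | polarize_fun s \1_E x = 1].

(* A_n = A^{sigma_1 ... sigma_n}; the index 0 of sigma is not used. *)
Fixpoint polarize_seq T (sigma : nat -> T -> 'rV[R]_d -> 'rV[R]_d) E n (w : T)
    : set 'rV[R]_d :=
  if n is n'.+1 then polarize (sigma n w) (polarize_seq sigma E n' w) else E.

(* Surface measure on the unit sphere, through polar coordinates: d times the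
   volume of the cone over S. *)
Definition sphere_measure (S : set 'rV[R]_d) : R :=
  d%:R * vol [set z | exists t x, [/\ 0 < t <= 1, S x & z = t *: x]].

Definition omega : R := sphere_measure [set x | enorm x = 1].

End geometry.

(* The sigma-algebra of the random set A_n: the events {A_n \in S}, for a family
   of sets S, that belong to the sigma-algebra of sigma_1(0), ..., sigma_n(0). *)
Definition state_events {R : realType} {d : nat} T
    (sigma : nat -> T -> 'rV[R]_d -> 'rV[R]_d) (A : set 'rV[R]_d) n
    : set (set T) :=
  g_sigma_preimage (fun (k : 'I_n) w => sigma k.+1 w 0) `&`
  [set D | exists S : set (set 'rV[R]_d), D = polarize_seq sigma A n @^-1` S].

(* The one-step law, for the step from E = A_n to A_{n+1}; r is the radius of
   A^*, so that A^* = oball r. Here excess, gain and weight are X_n, pi_n and the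
   first two cases of g_n. *)
Section law.
Context {R : realType} {d : nat} (L r : R) (n : nat) (E : set 'rV[R]_d).

Let Astar : set 'rV[R]_d := oball r.

Definition excess : R := vol (E `\` Astar).

Definition gain (x : 'rV[R]_d) : R :=
  excess - vol (polarize (sigma_between 0 x) E `\` Astar).

Definition c_d : R := 8 * (2 * L) ^+ d * (2 * d%:R - 1) / d%:R ^+ 2.

Definition delta : R := c_d * (ln n%:R / n%:R).

Definition lambda : R :=
  (2 ^+ d.+1 * @omega R d * L) `^ d%:R^-1 * delta `^ (1 - d%:R^-1).

Definition near_pairs : set ('rV[R]_d * 'rV[R]_d) :=
  [set p | [/\ (E `\` Astar) p.1, (Astar `\` E) p.2,
     enorm p.1 <= r + delta & enorm p.2 > r - delta]].

Definition F_set := near_pairs `&` u @^-1` (~` oball lambda).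
Definition G_set := near_pairs `&` u @^-1` (oball lambda).

Definition weight (x : 'rV[R]_d) : R :=
  enorm x ^- d.-1 *
  (if vol2 F_set > vol2 G_set then \1_(~` oball lambda) x
   else \1_(oball lambda) x).

Definition weighted_case : bool :=
  [&& (1 < n)%N, excess != 0 & excess ^+ 2 / 2 <= vol2 (F_set `|` G_set)].

(* In the remaining case g_n * pi_n is |x|^-(d-1), cut off to oball (2 * L). *)
Definition step_law (B : set 'rV[R]_d) : R :=
  if weighted_case then
    (\int[@lebesgue_rV R d]_(x in B) (weight x * gain x)) /
    (\int[@lebesgue_rV R d]_x (weight x * gain x))
  else
    (2 * L * @omega R d)^-1 *
    \int[@lebesgue_rV R d]_(x in B) (enorm x ^- d.-1 * \1_(oball (2 * L)) x).

End law.

(* Main.v *)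
(* Let B be the state A_n up to a null set, and for s > 0 let outer B s and
   inner B s be the volumes of B outside oball s and of oball s outside B.
   Polarizing B by the reflection taking 0 to z lowers outer B s by exactly the
   volume of moved s B z, the points of B outside oball s that are sent into
   oball s outside B. In the coordinates z = t (1, v) the kernel |z|^-(d-1)
   carries Lebesgue measure in t, and for fixed v and x the map z |-> u(x, x + z)
   is a translation of t; hence the integral of |z|^-(d-1) h(z) m(moved s B z) is at
   least that of h(u(x, y)) |x - y|^-(d-1) over all pairs with x in B outside
   oball s and y in oball s outside B.
   In the weighted case X = outer B r therefore decreases on average by at least
   c X^2 / lambda_n; in the other case X <= 2 (outer B (r + h) + inner B (r - h))
   for h < delta_n, and each of these two volumes decreases on average by at
   least c h times itself. Bounding X by s / 2 + X^2 / (2 s) and summing over n in [N, 2N) with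
   h of order log N / N gives, for e_n = E X_n and every s > 0,
     e_2N <= s / 2 + (C Lambda_N / (N s)) e_N + (C / log N) e_N,
   where Lambda_N is of order (log N / N)^(1 - 1/d), and strong induction
   concludes. *)

Require Import Defs.
From HB Require Import structures.
From mathcomp Require Import all_boot all_order all_algebra.
From mathcomp Require Import all_classical all_reals all_analysis.
From mathcomp Require Import measurable_realfun ring lra zify.
Set Implicit Arguments.
Unset Strict Implicit.
Unset Printing Implicit Defensive.
Import Order.TTheory GRing.Theory Num.Theory.
Import numFieldNormedType.Exports.
Local Open Scope classical_set_scope.
Local Open Scope ring_scope.

(** * Lebesgue measure on R^d *)

(** Working over a window [N, 2N) allows h to be fixed, so that the losses of [outer] at the radii r
    + h and r - h telescope. Their total is at most 2 e_N although [outer (r - h)] is not small: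
    [outer s - inner s] does not depend on the state, so at each radius the two volumes fall by the
    same amount, and [inner (r - h) <= X]. For the same reason it is enough to follow [outer]. The
    factor log N in h is what makes 1 / (N h) a small coefficient of e_N; its price is the power of
    log N in the rate. The value of lambda_n makes lambda_n^d proportional to delta_n^(d-1); the
    decrease c X^2 / lambda_n then has the same order whether F or G dominates. The technical
    obstacle is that the law of the next reflection is given only on rectangles, formed by an event
    of the state and a Borel set, while the loss depends jointly on state and reflection. The
    passage goes through a discretised reflection and requires the moved volume to be continuous in
    the reflection. *)

Section line.
Context {R : realType}.
Local Open Scope ereal_scope.
Local Notation leb1 := (@lebesgue_measure R).

Lemma measurable_affine (a b : R) :
  measurable_fun [set: measurableTypeR R] (fun s : measurableTypeR R => a * s + b : measurableTypeR R)%R.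
Proof. by apply: measurable_funD => //; exact: measurable_funM. Qed.

(** Both sides are measures in [A], so by uniqueness of Lebesgue measure half-open intervals
    suffice; for a < 0 their preimages are closed at the other end, which leaves the length
    unchanged. *)
Lemma lebesgue_measure_affine (a b : R) (A : set (measurableTypeR R)) :
  a != 0%R -> measurable A ->
  `|a|%:E * leb1 ((fun s => a * s + b)%R @^-1` A) = leb1 A.
Proof.
move=> a0 mA.
have na0 : (0 <= `|a|)%R by [].
pose mu : {measure set (measurableTypeR R) -> \bar R} :=
  mscale (NngNum na0) (pushforward leb1 (fun s : measurableTypeR R => a * s + b : measurableTypeR R)%R).
pose mu' := mu (measurable_affine a b).
suff : leb1 A = mu' A by move=> /esym.
apply: lebesgue_measure_unique => //= _ [[x y]] /= xy <-.
rewrite /mu' /mu /mscale/= /pushforward.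
have [a_gt0|a_lt0|a_eq0] := ltgtP 0%R a; last by rewrite -a_eq0 eqxx in a0.
- rewrite (_ : _ @^-1` _ = `](x - b) / a, (y - b) / a]%classic)%R; last first.
    apply/seteqP; split => s /=; rewrite !in_itv/= ltr_pdivrMr// ler_pdivlMr//;
    rewrite ltrBlDr lerBrDr; by rewrite (mulrC s).
  rewrite !lebesgue_measure_itv/= !lte_fin ltr_pM2r ?invr_gt0// ltrD2r.
  case: ifPn => _; last by rewrite mule0.
  rewrite -!EFinD -EFinM; congr EFin.
  rewrite gtr0_norm//; by field.
- rewrite (_ : _ @^-1` _ = `[(y - b) / a, (x - b) / a[%classic)%R; last first.
    apply/seteqP; split => s /=; rewrite !in_itv/= ltr_ndivlMr// ler_ndivrMr//;
    rewrite ltrBlDr lerBrDr (mulrC s); by move/andP => [-> ->].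
  rewrite !lebesgue_measure_itv/= !lte_fin ltr_nM2r ?invr_lt0// ltrD2r.
  case: ifPn => _; last by rewrite mule0.
  rewrite -!EFinD -EFinM; congr EFin.
  rewrite ltr0_norm//; by field.
Qed.

Lemma ge0_integral_affine (a b : R) (f : measurableTypeR R -> \bar R) :
  a != 0%R -> measurable_fun setT f -> (forall x, 0 <= f x) ->
  `|a|%:E * \int[leb1]_s f (a * s + b)%R = \int[leb1]_s f s.
Proof.
move=> a0 mf f0.
have na0 : (0 <= `|a|)%R by [].
have := @ge0_integral_pushforward _ _ _ _ R _ (measurable_affine a b) leb1 setT f measurableT.
rewrite preimage_setT => <-//.
pose nu : {measure set (measurableTypeR R) -> \bar R} :=
  pushforward leb1 (fun s : measurableTypeR R => a * s + b : measurableTypeR R)%R.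
transitivity (\int[mscale (NngNum na0) (nu (measurable_affine a b))]_y f y).
  by rewrite ge0_integral_mscale.
apply: eq_measure_integral => B mB _.
exact: lebesgue_measure_affine.
Qed.

Lemma measurable_fun_invr : measurable_fun [set: R] (fun x : R => x^-1)%R.
Proof.
have -> : [set: R] = [set 0%R] `|` [set x : R | x != 0%R].
  by apply/seteqP; split => // x _ /=; have [->|] := eqVneq x 0%R; [left|right].
have o : open [set x : R | x != 0%R].
  by rewrite (_ : [set _ | _] = ~` [set 0%R]);
    [exact/closed_openC/closed_eq|apply/seteqP; split => x /eqP].
apply/measurable_funU => //; first exact: open_measurable.
split; first exact: measurable_fun_set1.
apply: open_continuous_measurable_fun => // x /set_mem /=.
exact: inv_continuous.
Qed.

End line.

Section measurable_rV_ops.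
Context {R : realType} {dT : measure_display} {T : measurableType dT} {d : nat}.
Implicit Types (f g : T -> 'rV[R]_d) (a : T -> R).

Lemma measurable_rV_coord f i : measurable_fun setT f ->
  measurable_fun setT (fun t => f t ord0 i).
Proof. by move=> mf; apply: (measurableT_comp (measurable_coord i)). Qed.

Lemma measurable_rV_add f g : measurable_fun setT f -> measurable_fun setT g ->
  measurable_fun setT (fun t => f t + g t).
Proof.
move=> mf mg; apply: measurable_fun_rV => i; under eq_fun do rewrite mxE.
by apply: measurable_funD; exact: measurable_rV_coord.
Qed.

Lemma measurable_rV_scale a f : measurable_fun setT a -> measurable_fun setT f ->
  measurable_fun setT (fun t => a t *: f t).
Proof.
move=> mf mg; apply: measurable_fun_rV => i; under eq_fun do rewrite mxE.
by apply: measurable_funM => //; exact: measurable_rV_coord.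
Qed.

Lemma measurable_dot f g : measurable_fun setT f -> measurable_fun setT g ->
  measurable_fun setT (fun t => dot (f t) (g t)).
Proof.
move=> mf mg; apply: measurable_sum => i.
by apply: measurable_funM => //; exact: measurable_rV_coord.
Qed.

Lemma measurable_enorm f : measurable_fun setT f ->
  measurable_fun setT (fun t => enorm (f t)).
Proof.
move=> mf; have ms : measurable_fun [set: R] (@Num.sqrt R).
  by apply: continuous_measurable_fun; exact: sqrt_continuous.
by apply: (measurableT_comp ms); exact: measurable_dot.
Qed.

Lemma measurable_funV a : measurable_fun setT a ->
  measurable_fun setT (fun t => (a t)^-1).
Proof. by move=> ma; exact: (measurableT_comp measurable_fun_invr). Qed.

Lemma measurable_rV_cons a f : measurable_fun setT a -> measurable_fun setT f ->
  measurable_fun setT (fun t => cons_rV (a t, f t)).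
Proof.
move=> ma mf; apply: (measurableT_comp (@measurable_cons_rV R d)).
exact: (@measurable_fun_pair _ _ _ _ (measurableTypeR R)).
Qed.

End measurable_rV_ops.

Section lebesgue_rV_integral.
Context {R : realType}.
Local Open Scope ereal_scope.
Local Notation leb1 := (@lebesgue_measure R).

Lemma ge0_integral_rVS n (f : 'rV[R]_n.+1 -> \bar R) :
  measurable_fun setT f -> (forall x, 0 <= f x) ->
  \int[lebesgue_rV n.+1]_x f x =
  \int[leb1]_s \int[lebesgue_rV n]_y f (cons_rV (s, y)).
Proof.
move=> mf f0.
have := @ge0_integral_pushforward _ _ _ _ R _ (@measurable_cons_rV R n)
  (leb1 \x lebesgue_rV n) setT f measurableT mf (fun y _ => f0 y).
rewrite preimage_setT => -> /=.
rewrite fubini_tonelli1//.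
by apply: (measurableT_comp mf); exact: measurable_cons_rV.
Qed.

(** Induction on the dimension: the tail is rescaled at a fixed first coordinate, then the first
    coordinate itself, each coordinate contributing one factor |a|. *)
Lemma ge0_integral_rV_affine n (a : R) (t : 'rV[R]_n) (f : 'rV[R]_n -> \bar R) :
  (a != 0)%R -> measurable_fun setT f -> (forall x, 0 <= f x) ->
  (`|a| ^+ n)%:E * \int[lebesgue_rV n]_x f (a *: x + t)%R =
  \int[lebesgue_rV n]_x f x.
Proof.
move=> a0; elim: n t f => [|n IH] t f mf f0.
  rewrite expr0 mul1e; apply: eq_integral => x _; congr f.
  by apply/rowP => -[].
have mc s t' : measurable_fun setT (fun y : 'rV[R]_n => f (cons_rV (s, a *: y + t'))%R).
  apply: (measurableT_comp mf); apply: measurable_rV_cons => //.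
  by apply: measurable_rV_add => //; exact: measurable_rV_scale.
pose t0 := t ord0 ord0; pose t' := (\row_j t ord0 (lift ord0 j))%R.
have tE s y : (a *: cons_rV (s, y) + t = cons_rV (a * s + t0, a *: y + t'))%R.
  apply/rowP => i; rewrite [LHS]mxE [X in (X + _)%R]mxE.
  case: (unliftP ord0 i) => [j ->|->].
    by rewrite !cons_rV_lift/= !mxE.
  by rewrite !cons_rV0.
rewrite ge0_integral_rVS//; last first.
  apply: (measurableT_comp mf).
  by apply: measurable_rV_add => //; exact: measurable_rV_scale.
rewrite [RHS]ge0_integral_rVS//.
under eq_integral do under eq_integral do rewrite tE.
have mF2 : measurable_fun setT (fun p : measurableTypeR R * 'rV[R]_n =>
    f (cons_rV (a * p.1 + t0, a *: p.2 + t'))%R).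
  apply: (measurableT_comp mf); apply: measurable_rV_cons.
    apply: measurable_funD => //; apply: measurable_funM => //.
  apply: measurable_rV_add => //; apply: measurable_rV_scale => //.
rewrite exprS EFinM -muleA -ge0_integralZl_EFin//; last 2 first.
- by move=> s _; exact: integral_ge0.
- exact: (measurable_fun_fubini_tonelli_F (m2 := lebesgue_rV n) _ mF2).
under eq_integral => s _.
  rewrite (IH t' (fun y => f (cons_rV (a * s + t0, y))%R))//; last first.
    by apply: (measurableT_comp mf); exact: measurable_rV_cons.
  over.
apply: (@ge0_integral_affine _ a t0 (fun s => \int[lebesgue_rV n]_y f (cons_rV (s, y)))) => //.
  exact: (measurable_fun_fubini_tonelli_F (m2 := lebesgue_rV n) _ (measurableT_comp mf (@measurable_cons_rV R n)) (fun p => f0 _)).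
by move=> s; exact: integral_ge0.
Qed.

End lebesgue_rV_integral.

(** * Reflections and the Riesz kernel *)

Section dot_theory.
Context {R : realType} {d : nat}.
Implicit Types (x y z : 'rV[R]_d) (a : R).

Lemma dotC x y : dot x y = dot y x.
Proof. by apply: eq_bigr => i _; rewrite mulrC. Qed.

Lemma dotDl x y z : dot (x + y) z = dot x z + dot y z.
Proof. by rewrite -big_split; apply: eq_bigr => i _; rewrite mxE mulrDl. Qed.

Lemma dotDr x y z : dot x (y + z) = dot x y + dot x z.
Proof. by rewrite !(dotC x) dotDl. Qed.

Lemma dotZl a x y : dot (a *: x) y = a * dot x y.
Proof. by rewrite mulr_sumr; apply: eq_bigr => i _; rewrite mxE mulrA. Qed.

Lemma dotZr a x y : dot x (a *: y) = a * dot x y.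
Proof. by rewrite !(dotC x) dotZl. Qed.

Lemma dotNl x y : dot (- x) y = - dot x y.
Proof. by rewrite -scaleN1r dotZl mulN1r. Qed.

Lemma dotNr x y : dot x (- y) = - dot x y.
Proof. by rewrite -scaleN1r dotZr mulN1r. Qed.

Lemma dot0l x : dot 0 x = 0.
Proof. by rewrite -(scale0r 0) dotZl mul0r. Qed.

Lemma dot0r x : dot x 0 = 0. Proof. by rewrite dotC dot0l. Qed.

Definition dotE := (dotDl, dotDr, dotZl, dotZr, dotNl, dotNr, dot0l, dot0r).

Lemma dot_ge0 x : 0 <= dot x x.
Proof. by apply: sumr_ge0 => i _; rewrite -expr2 sqr_ge0. Qed.

Lemma dot_eq0 x : (dot x x == 0) = (x == 0).
Proof.
apply/idP/eqP => [|->]; last by rewrite dot0l.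
rewrite psumr_eq0; last by move=> i _; rewrite -expr2 sqr_ge0.
move=> /allP h; apply/rowP => i; rewrite mxE; apply/eqP.
by have := h i (mem_index_enum _); rewrite mulf_eq0 orbb.
Qed.

Lemma coord_sqr_le_dot x i : x ord0 i ^+ 2 <= dot x x.
Proof.
rewrite /dot (bigD1 i)//= -expr2 lerDl.
by apply: sumr_ge0 => j _; rewrite -expr2 sqr_ge0.
Qed.

Lemma enorm_ge0 x : 0 <= enorm x. Proof. exact: sqrtr_ge0. Qed.

Lemma sqr_enorm x : enorm x ^+ 2 = dot x x.
Proof. by rewrite sqr_sqrtr// dot_ge0. Qed.

Lemma enorm_eq0 x : (enorm x == 0) = (x == 0).
Proof. by rewrite -dot_eq0 -sqr_enorm sqrf_eq0. Qed.

Lemma enorm_gt0 x : (0 < enorm x) = (x != 0).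
Proof. by rewrite lt_def enorm_eq0 enorm_ge0 andbT. Qed.

Lemma enormZ a x : enorm (a *: x) = `|a| * enorm x.
Proof.
by rewrite /enorm dotZl dotZr mulrA -expr2 sqrtrM ?sqr_ge0// sqrtr_sqr.
Qed.

Lemma enorm_lt x a : 0 <= a -> (enorm x < a) = (dot x x < a ^+ 2).
Proof. by move=> a0; rewrite -sqr_enorm ltr_pXn2r// nnegrE enorm_ge0. Qed.

Lemma enorm_le x a : 0 <= a -> (enorm x <= a) = (dot x x <= a ^+ 2).
Proof. by move=> a0; rewrite -sqr_enorm ler_pXn2r// nnegrE enorm_ge0. Qed.

Lemma ler_enorm x y : (enorm x <= enorm y) = (dot x x <= dot y y).
Proof. by rewrite enorm_le ?enorm_ge0// sqr_enorm. Qed.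

Lemma ltr_enorm x y : (enorm x < enorm y) = (dot x x < dot y y).
Proof. by rewrite enorm_lt ?enorm_ge0// sqr_enorm. Qed.

(* The parallelogram law stands in for the triangle inequality throughout. *)
Lemma dotB_le x y : dot (x - y) (x - y) <= 2 * (dot x x + dot y y).
Proof.
have := dot_ge0 (x + y); rewrite !dotE (dotC y x); lra.
Qed.

End dot_theory.

Section reflection_invariance.
Context {R : realType}.
Local Open Scope ereal_scope.
Local Notation leb1 := (@lebesgue_measure R).

Lemma dot_cons n (a b : R) (y z : 'rV[R]_n) :
  dot (cons_rV (a, y)) (cons_rV (b, z)) = (a * b + dot y z)%R.
Proof.
rewrite /dot big_ord_recl !cons_rV0; congr (_ + _)%R.
by apply: eq_bigr => i _; rewrite !cons_rV_lift.
Qed.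

Lemma cons_rV_add n (a b : R) (y z : 'rV[R]_n) :
  (cons_rV (a, y) + cons_rV (b, z) = cons_rV (a + b, y + z))%R.
Proof.
apply/rowP => i; rewrite [LHS]mxE.
case: (unliftP ord0 i) => [j ->|->]; last by rewrite !cons_rV0.
by rewrite !cons_rV_lift/= mxE.
Qed.

Lemma cons_rV_scale n (a b : R) (y : 'rV[R]_n) :
  (a *: cons_rV (b, y) = cons_rV (a * b, a *: y))%R.
Proof.
apply/rowP => i; rewrite [LHS]mxE.
case: (unliftP ord0 i) => [j ->|->]; last by rewrite !cons_rV0.
by rewrite !cons_rV_lift/= mxE.
Qed.

Lemma cons_rVP n (v : 'rV[R]_n.+1) : exists p, v = cons_rV p.
Proof. by eexists; exact/esym/cons_rV_surj. Qed.

Lemma measurable_hrefl n (v : 'rV[R]_n) (c : R) : measurable_fun setT (hrefl v c).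
Proof.
rewrite (_ : hrefl v c = fun x => x + (- (2 * (dot v x - c) / dot v v)) *: v)%R; last first.
  by apply/funext => x; rewrite scaleNr.
apply: measurable_rV_add => //; apply: measurable_rV_scale => //.
apply: measurableT_comp => //; apply: measurable_funM => //.
apply: measurable_funM => //; apply: measurable_funB => //.
exact: measurable_dot.
Qed.

(** Slicing by lines of direction (v0, v), indexed by their point (0, z): for each s the first
    coordinate is scaled by v0 and the tail translated by s v, which gives the Jacobian |v0|. *)
Lemma ge0_integral_rV_shear n (v0 : R) (v : 'rV[R]_n) (f : 'rV[R]_n.+1 -> \bar R) :
  (v0 != 0)%R -> measurable_fun setT f -> (forall x, 0 <= f x) ->
  \int[lebesgue_rV n.+1]_x f x =
  `|v0|%:E * \int[lebesgue_rV n]_z \int[leb1]_s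
    f (s *: cons_rV (v0, v) + cons_rV (0, z))%R.
Proof.
move=> v00 mf f0.
under [X in _ * X]eq_integral do under eq_integral do
  rewrite cons_rV_scale cons_rV_add addr0.
have mF : measurable_fun setT (fun p : measurableTypeR R * 'rV[R]_n =>
    f (cons_rV (p.1 * v0, p.1 *: v + p.2))%R).
  apply: (measurableT_comp mf); apply: measurable_rV_cons.
    by apply: measurable_funM.
  by apply: measurable_rV_add => //; exact: measurable_rV_scale.
rewrite -(fubini_tonelli (m1 := leb1) (m2 := lebesgue_rV n) _ mF)//=.
rewrite ge0_integral_rVS//.
have mc := measurableT_comp mf (@measurable_cons_rV R n).
have mG := measurable_fun_fubini_tonelli_F (m2 := lebesgue_rV n) _ mc (fun p => f0 _).
have G0 s : 0 <= \int[lebesgue_rV n]_y f (cons_rV (s, y)) by exact: integral_ge0.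
apply: (eq_trans (esym (ge0_integral_affine 0 v00 mG G0))).
apply: (congr1 (mule _)); apply: eq_integral => s _; rewrite addr0 (mulrC v0).
have mf' : measurable_fun setT (fun y => f (cons_rV (s * v0, y))%R).
  by apply: (measurableT_comp mf); exact: measurable_rV_cons.
apply: (eq_trans (esym (ge0_integral_rV_affine (s *: v) (oner_neq0 _) mf' (fun=> f0 _)))).
rewrite normr1 expr1n mul1e; apply: eq_integral => y _.
by rewrite scale1r addrC.
Qed.

(** If the normal has first coordinate 0, the reflection acts on the tail alone and induction
    applies. Otherwise it preserves every line parallel to the normal and acts there as s -> k - s,
    so the shear coordinates reduce the claim to one dimension. *)
Lemma ge0_integral_hrefl n (v : 'rV[R]_n) (c : R) (f : 'rV[R]_n -> \bar R) :
  (v != 0)%R -> measurable_fun setT f -> (forall x, 0 <= f x) ->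
  \int[lebesgue_rV n]_x f (hrefl v c x) = \int[lebesgue_rV n]_x f x.
Proof.
elim: n v f => [|n IH] v f v0 mf f0.
  by case/eqP: v0; apply/rowP => -[].
have mfh : measurable_fun setT (f \o hrefl v c).
  by apply: (measurableT_comp mf); exact: measurable_hrefl.
have [[a w] vE] := cons_rVP v; rewrite {}vE in v0 mfh *.
have [a0|a0] := eqVneq a 0%R.
  rewrite a0 in v0 mfh *.
  apply: (eq_trans (ge0_integral_rVS mfh (fun=> f0 _))).
  apply: (eq_trans _ (esym (ge0_integral_rVS mf f0))).
  apply: eq_integral => s _.
  have w0 : (w != 0)%R.
    by apply: contra v0 => /eqP ->; rewrite -dot_eq0 dot_cons dot0l mulr0 addr0.
  have mf' : measurable_fun setT (fun y => f (cons_rV (s, y))%R).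
    by apply: (measurableT_comp mf); exact: measurable_rV_cons.
  apply: (eq_trans _ (IH w _ w0 mf' (fun=> f0 _))).
  apply: eq_integral => y _; congr f.
  rewrite /hrefl !dot_cons !mul0r !add0r -scaleNr cons_rV_scale cons_rV_add.
  by rewrite mulr0 addr0 scaleNr.
apply: (eq_trans (ge0_integral_rV_shear w a0 mfh (fun=> f0 _))).
apply: (eq_trans _ (esym (ge0_integral_rV_shear w a0 mf f0))).
apply: (congr1 (mule _)); apply: eq_integral => z _.
set u := cons_rV (a, w); set b := cons_rV (0%R, z).
pose k := (- (2 * (dot u b - c) / dot u u))%R.
have mf' : measurable_fun setT (fun s : measurableTypeR R => f (s *: u + b)%R).
  apply: (measurableT_comp mf); apply: measurable_rV_add => //.
  exact: measurable_rV_scale.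
have n10 : (-1 != 0 :> R)%R by rewrite oppr_eq0 oner_neq0.
apply: (eq_trans _ (ge0_integral_affine k n10 mf' (fun=> f0 _))).
rewrite normrN1 mul1e; apply: eq_integral => s _ /=; congr f.
rewrite /hrefl -scaleNr addrAC -scalerDl; congr (_ *: _ + _)%R.
rewrite !dotE /k; field.
by rewrite dot_eq0.
Qed.

Lemma lebesgue_rV_hrefl n (v : 'rV[R]_n) (c : R) (E : set 'rV[R]_n) :
  (v != 0)%R -> measurable E ->
  lebesgue_rV n (hrefl v c @^-1` E) = lebesgue_rV n E.
Proof.
move=> v0 mE.
have mhE : measurable (hrefl v c @^-1` E).
  by rewrite -[X in measurable X]setTI; exact: measurable_hrefl.
have mf : measurable_fun setT (fun x => (\1_E x)%:E : \bar R).
  exact/measurable_EFinP/measurable_indic.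
have f0 x : 0 <= (\1_E x)%:E :> \bar R by rewrite lee_fin.
have := ge0_integral_hrefl c v0 mf f0.
rewrite [X in _ = X](integral_indic _ measurableT)// setIT => <-.
by rewrite -[in LHS](setIT (_ @^-1` _)) -(integral_indic _ measurableT).
Qed.

End reflection_invariance.

(** * Polar coordinates for the Riesz kernel, and the substitution z = u (x, y) *)

Section polar.
Context {R : realType}.
Local Open Scope ereal_scope.
Local Notation leb1 := (@lebesgue_measure R).

Lemma eq_integral_off0 (f g : measurableTypeR R -> \bar R) :
  measurable_fun setT f -> measurable_fun setT g ->
  (forall s, 0 <= f s) -> (forall s, 0 <= g s) ->
  (forall s, s != 0%R -> f s = g s) ->
  \int[leb1]_s f s = \int[leb1]_s g s.
Proof.
move=> mf mg f0 g0 fg; apply: ge0_ae_eq_integral => //.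
exists [set 0%R]; split => //; first exact: lebesgue_measure_set1.
move=> s /= /not_implyP[_ fgs]; apply: contrapT => /eqP s0.
by apply: fgs; exact: fg.
Qed.

(** With d = n + 1 this is |z|^-(d-1). For n > 0 its value at the origin is 0, as 0^-1 = 0. *)
Definition riesz n (z : 'rV[R]_n.+1) : R := (enorm z ^- n)%R.

Lemma riesz_ge0 n (z : 'rV[R]_n.+1) : (0 <= riesz z)%R.
Proof. by rewrite invr_ge0 exprn_ge0// enorm_ge0. Qed.

Lemma measurable_riesz d (T : measurableType d) n (f : T -> 'rV[R]_n.+1) :
  measurable_fun setT f -> measurable_fun setT (fun x => riesz (f x)).
Proof.
move=> mf; apply: measurable_funV; apply: measurable_funX.
exact: measurable_enorm.
Qed.

Lemma rieszZ n (a : R) (z : 'rV[R]_n.+1) :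
  riesz (a *: z)%R = (`|a| ^- n * riesz z)%R.
Proof. by rewrite /riesz enormZ exprMn invfM. Qed.

Let dir n (v : 'rV[R]_n) : 'rV[R]_n.+1 := cons_rV (1%R, v).

Let mdir n : measurable_fun setT (@dir n).
Proof. exact: measurable_rV_cons. Qed.

(* Parametrise R^(n+1) by z = s (1, v): the Jacobian |s|^n cancels the factor
   |s|^-n of the Riesz kernel, so that the radial variable s carries Lebesgue
   measure on R. *)
Lemma ge0_integral_riesz n (f : 'rV[R]_n.+1 -> \bar R) :
  measurable_fun setT f -> (forall x, 0 <= f x) ->
  \int[lebesgue_rV n.+1]_z (f z * (riesz z)%:E) =
  \int[lebesgue_rV n]_v ((riesz (dir v))%:E * \int[leb1]_s f (s *: dir v)%R).
Proof.
move=> mf f0.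
have mk : measurable_fun setT (fun z : 'rV[R]_n.+1 => (riesz z)%:E).
  by apply/measurable_EFinP; exact: measurable_riesz.
have mfk : measurable_fun setT (fun z => f z * (riesz z)%:E).
  exact: emeasurable_funM.
have fk0 z : 0 <= f z * (riesz z)%:E.
  by apply: mule_ge0 => //; rewrite lee_fin riesz_ge0.
have mF : measurable_fun setT (fun p : measurableTypeR R * 'rV[R]_n =>
    f (p.1 *: dir p.2)%R * (riesz (dir p.2))%:E).
  apply: emeasurable_funM.
    apply: (measurableT_comp mf); apply: measurable_rV_scale => //.
    exact: (measurableT_comp (@mdir n)).
  apply/measurable_EFinP; apply: measurable_riesz.
  exact: (measurableT_comp (@mdir n)).
have F0 p : 0 <= f (p.1 *: dir p.2)%R * (riesz (dir p.2))%:E.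
  by apply: mule_ge0 => //; rewrite lee_fin riesz_ge0.
apply: (eq_trans (ge0_integral_rVS mfk fk0)).
transitivity (\int[leb1]_s \int[lebesgue_rV n]_v
    (f (s *: dir v)%R * (riesz (dir v))%:E)).
  have mL := measurable_fun_fubini_tonelli_F (m2 := lebesgue_rV n) _
    (measurableT_comp mfk (@measurable_cons_rV R n)) (fun p => fk0 _).
  have mR := measurable_fun_fubini_tonelli_F (m2 := lebesgue_rV n) _ mF F0.
  (* At s = 0 the substitution y = s v degenerates; a single value of s does not affect the
     integral. *)
  apply: (eq_integral_off0 mL mR) => [s|s|s s0].
    by apply: integral_ge0 => y _; exact: fk0.
    by apply: integral_ge0 => y _; exact: F0 (s, y).
  have mfs : measurable_fun setT
      (fun y => f (cons_rV (s, y)) * (riesz (cons_rV (s, y)))%:E).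
    by apply: (measurableT_comp mfk); exact: measurable_rV_cons.
  apply: (eq_trans (esym (ge0_integral_rV_affine 0 s0 mfs (fun=> fk0 _)))).
  rewrite -ge0_integralZl_EFin//; last first.
    apply: (measurableT_comp (g := fun y : 'rV[R]_n => (s *: y + 0)%R) mfs).
    by apply: measurable_rV_add => //; exact: measurable_rV_scale.
  apply: eq_integral => v _.
  have -> : cons_rV (s, (s *: v + 0)%R) = (s *: dir v)%R.
    by rewrite cons_rV_scale mulr1 addr0.
  rewrite muleCA; congr (_ * _); rewrite rieszZ -EFinM; congr EFin.
  by rewrite mulVKf// expf_neq0// normr_eq0.
apply: (eq_trans (fubini_tonelli (m1 := leb1) (m2 := lebesgue_rV n) _ mF F0)).
apply: eq_integral => v _ /=.
rewrite -ge0_integralZl_EFin//; last 2 first.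
- by apply: (measurableT_comp mf); exact: measurable_rV_scale.
- exact: riesz_ge0.
by apply: eq_integral => s _; rewrite muleC.
Qed.

(** The map z -> u (x, x + z) in closed form; see [u_spread]. *)
Definition spread n (x z : 'rV[R]_n) : 'rV[R]_n :=
  ((1 + 2 * dot x z / dot z z) *: z)%R.

Lemma measurable_spread n (x : 'rV[R]_n) : measurable_fun setT (spread x).
Proof.
apply: measurable_rV_scale => //; apply: measurable_funD => //.
apply: measurable_funM; first by apply: measurable_funM => //; exact: measurable_dot.
by apply: measurable_funV; exact: measurable_dot.
Qed.

Lemma ge0_integral_spread n (x : 'rV[R]_n.+1) (f : 'rV[R]_n.+1 -> \bar R) :
  measurable_fun setT f -> (forall x, 0 <= f x) ->
  \int[lebesgue_rV n.+1]_z (f (spread x z) * (riesz z)%:E) =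
  \int[lebesgue_rV n.+1]_z (f z * (riesz z)%:E).
Proof.
move=> mf f0.
have mfs := measurableT_comp mf (measurable_spread x).
apply: (eq_trans (ge0_integral_riesz mfs (fun=> f0 _))).
apply: (eq_trans _ (esym (ge0_integral_riesz mf f0))).
apply: eq_integral => v _; apply: (congr1 (mule _)).
have d0 : dot (dir v) (dir v) != 0%R.
  by rewrite dot_cons mulr1 gt_eqF// ltr_wpDr// dot_ge0.
pose t := (2 * dot x (dir v) / dot (dir v) (dir v))%R.
have mfv : measurable_fun setT (fun s : measurableTypeR R => f (s *: dir v)%R).
  by apply: (measurableT_comp mf); exact: measurable_rV_scale.
have := ge0_integral_affine t (oner_neq0 _) mfv (fun=> f0 _).
(* [spread x] fixes 0, unlike the translation by t, so the integrands are compared off s = 0. *)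
rewrite normr1 mul1e => E; apply: (eq_trans _ E); apply: eq_integral_off0 => //.
- by apply: (measurableT_comp mfs); exact: measurable_rV_scale.
- exact: (measurableT_comp mfv (measurable_affine 1 t)).
- by move=> s; exact: f0.
- move=> s s0 /=; congr f; rewrite /spread scalerA; congr (_ *: _)%R.
  by rewrite mul1r /t !dotE; field; rewrite d0.
Qed.

Lemma u_spread n (x y : 'rV[R]_n) : u (x, y) = spread x (y - x)%R.
Proof.
rewrite /u /sigma_between /hrefl /spread /= dot0r !sub0r -scaleNr.
have [->|yx] := eqVneq y x; first by rewrite (subrr x) !scaler0.
have : dot (y - x) (y - x) != 0%R by rewrite dot_eq0 subr_eq0.
have : (dot y y = dot (y - x) (y - x) + 2 * dot x (y - x) + dot x x)%R.
  by rewrite !dotE (dotC y x); ring.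
move: (dot (y - x) (y - x)) (dot x (y - x)) => D e -> D0.
by congr (_ *: _)%R; field.
Qed.

Lemma measurable_u n : measurable_fun setT (@u R n).
Proof.
rewrite (_ : u = fun p => spread p.1 (p.2 - p.1)%R); last first.
  by apply/funext => -[x y]; exact: u_spread.
have m2 : measurable_fun setT (fun p : 'rV[R]_n * 'rV[R]_n => (p.2 - p.1)%R).
  rewrite (_ : (fun _ => _) = fun p : 'rV[R]_n * 'rV[R]_n => (p.2 + (-1) *: p.1)%R).
    by apply: measurable_rV_add => //; exact: measurable_rV_scale.
  by apply/funext => p; rewrite scaleN1r.
apply: measurable_rV_scale => //; apply: measurable_funD => //.
apply: measurable_funM; first by apply: measurable_funM => //; exact: measurable_dot.
by apply: measurable_funV; exact: measurable_dot.
Qed.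

Lemma ge0_integral_u n (x : 'rV[R]_n.+1) (f : 'rV[R]_n.+1 -> \bar R) :
  measurable_fun setT f -> (forall x, 0 <= f x) ->
  \int[lebesgue_rV n.+1]_y (f (u (x, y)) * (riesz (y - x)%R)%:E) =
  \int[lebesgue_rV n.+1]_z (f z * (riesz z)%:E).
Proof.
move=> mf f0; rewrite -(ge0_integral_spread x mf f0).
have m1 : measurable_fun setT (fun z => f (spread x z) * (riesz z)%:E).
  apply: emeasurable_funM; first exact: (measurableT_comp mf (measurable_spread x)).
  by apply/measurable_EFinP; exact: measurable_riesz.
have p1 z : 0 <= f (spread x z) * (riesz z)%:E.
  by apply: mule_ge0 => //; rewrite lee_fin riesz_ge0.
have := ge0_integral_rV_affine (- x)%R (oner_neq0 _) m1 p1.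
rewrite normr1 expr1n mul1e => E; apply: (eq_trans _ E).
apply: eq_integral => y _.
by rewrite u_spread scale1r.
Qed.

End polar.

(** * Balls and the mass of the Riesz kernel on them *)

Section balls.
Context {R : realType}.
Local Open Scope ereal_scope.
Local Notation leb1 := (@lebesgue_measure R).

Lemma measurable_oball n (s : R) : measurable (oball s : set 'rV[R]_n).
Proof.
rewrite (_ : oball s = (@enorm R n) @^-1` `]-oo, s[%classic); last first.
  by apply/seteqP; split => x; rewrite /oball/= in_itv.
rewrite -[X in measurable X]setTI.
exact: (measurable_enorm (@measurable_id _ _ _)).
Qed.

Lemma lebesgue_rV_scale n (a : R) (E : set 'rV[R]_n) : (a != 0)%R -> measurable E ->
  (`|a| ^+ n)%:E * lebesgue_rV n ((fun x => a *: x)%R @^-1` E) = lebesgue_rV n E.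
Proof.
move=> a0 mE.
have ma : measurable ((fun x : 'rV[R]_n => a *: x)%R @^-1` E).
  by rewrite -[X in measurable X]setTI; exact: (measurable_rV_scale (a := fun=> a)).
have mf : measurable_fun setT (fun x => (\1_E x)%:E : \bar R).
  exact/measurable_EFinP/measurable_indic.
have := ge0_integral_rV_affine 0 a0 mf (fun x => ltac:(by rewrite lee_fin)).
rewrite [X in _ = X](integral_indic _ measurableT)// setIT => <-.
rewrite -[in LHS](setIT (_ @^-1` _)) -(integral_indic _ measurableT)//.
by congr (_ * _); apply: eq_integral => x _; rewrite addr0.
Qed.

Lemma oballZ n (s : R) : (0 < s)%R ->
  (fun x => s *: x)%R @^-1` oball s = oball 1 :> set 'rV[R]_n.
Proof.
move=> s0; apply/seteqP; split => x; rewrite /oball/= enormZ gtr0_norm//.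
  by rewrite -ltr_pdivlMl// mulVf// gt_eqF.
by rewrite -ltr_pdivlMl// mulVf// gt_eqF.
Qed.

Lemma lebesgue_rV_ltoo n (s : R) (E : set 'rV[R]_n) : measurable E -> E `<=` oball s ->
  lebesgue_rV n E < +oo.
Proof.
move=> mE Es.
pose b := [set x : 'rV[R]_n | forall i, `]- (`|s| + 1), (`|s| + 1)[%classic (x ord0 i)]%R.
have mb : measurable b.
  rewrite (_ : b = \bigcap_(i in [set: 'I_n])
      ((fun x : 'rV[R]_n => x ord0 i) @^-1` `]- (`|s| + 1), (`|s| + 1)[%classic))%R.
    apply: fin_bigcap_measurable => // i _; rewrite -[X in measurable X]setTI.
    by apply: measurable_coord => //; exact: measurable_itv.
  by apply/seteqP; split => x /= Bx => [i _|i]; exact: Bx.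
have Eb : E `<=` b.
  move=> x /Es /= xs i /=; rewrite in_itv/= -ltr_norml.
  rewrite -sqrtr_sqr (le_lt_trans (ler_wsqrtr (coord_sqr_le_dot x i)))//.
  by rewrite (lt_le_trans xs)// (le_trans (ler_norm s))// lerDl.
apply: (@le_lt_trans _ _ (lebesgue_rV n b)).
  by apply: le_measure => //; rewrite inE.
rewrite (lebesgue_rV_box (B := fun=> `]- (`|s| + 1), (`|s| + 1)[%classic%R)); last first.
  by move=> i; exact: measurable_itv.
suff /andP[] : 0 <= \prod_(i < n)
  leb1 (`]- (`|s| + 1), (`|s| + 1)[%classic%R : set R) < +oo by [].
apply: (big_ind (fun x : \bar R => 0 <= x < +oo)) => [|x y|i _].
- by rewrite lee_fin ler01/= ltry.
- move=> /andP[x0 xo] /andP[y0 yo]; rewrite mule_ge0//=.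
  by rewrite lte_mul_pinfty// ge0_fin_numE.
- rewrite measure_ge0/= lebesgue_measure_itv/=.
  by case: ifPn => _; rewrite -?EFinD ltry.
Qed.

Lemma lebesgue_rV_oball_ltoo n (s : R) : lebesgue_rV n (oball s : set 'rV[R]_n) < +oo.
Proof. by apply: (@lebesgue_rV_ltoo _ s) => //; exact: measurable_oball. Qed.

Definition ball_vol n : R := fine (lebesgue_rV n (oball 1 : set 'rV[R]_n)).

Lemma lebesgue_rV_oball n (s : R) : (0 < n)%N -> (0 <= s)%R ->
  lebesgue_rV n (oball s : set 'rV[R]_n) = (s ^+ n * ball_vol n)%:E.
Proof.
move=> n0; rewrite le_eqVlt => /predU1P[<-|s0].
  rewrite expr0n gtn_eqF// mul0r (_ : oball 0%R = set0) ?measure0//.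
  by apply/seteqP; split => x //; rewrite /oball/= ltNge enorm_ge0.
rewrite -(lebesgue_rV_scale (a := s))//; [|by rewrite gt_eqF|exact: measurable_oball].
rewrite oballZ// gtr0_norm// EFinM; congr (_ * _); rewrite fineK//.
by rewrite ge0_fin_numE// lebesgue_rV_oball_ltoo.
Qed.

(* A small cube in the unit ball that avoids the origin. *)
Definition corner n : set 'rV[R]_n :=
  [set x | forall i, `](n.+1%:R^-1 / 2), n.+1%:R^-1[%classic (x ord0 i)]%R.

Arguments corner : clear implicits.

Lemma corner_sub n : corner n `<=` oball 1.
Proof.
move=> x xc; rewrite /oball/= enorm_lt// expr1n /dot.
apply: (@le_lt_trans _ _ (\sum_(i < n) n.+1%:R^-1)%R); last first.
  by rewrite sumr_const card_ord -[X in (X < _)%R]mulr_natl ltr_pdivrMr// mul1r ltr_nat.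
apply: ler_sum => i _; have /= := xc i; rewrite in_itv/= => /andP[h1 h2].
have h0 : (0 <= x ord0 i)%R by rewrite (le_trans _ (ltW h1))// divr_ge0// invr_ge0.
rewrite -[leRHS]mulr1 ler_pM//; first exact: ltW.
by rewrite (le_trans (ltW h2))// invf_le1// ler1n.
Qed.

Lemma lebesgue_rV_corner n : measurable (corner n) /\
  lebesgue_rV n (corner n) = ((n.+1%:R^-1 / 2) ^+ n)%:E.
Proof.
split.
  rewrite (_ : corner n = \bigcap_(i in [set: 'I_n])
      ((fun x : 'rV[R]_n => x ord0 i) @^-1` `](n.+1%:R^-1 / 2), n.+1%:R^-1[%classic))%R.
    apply: fin_bigcap_measurable => // i _; rewrite -[X in measurable X]setTI.
    by apply: measurable_coord => //; exact: measurable_itv.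
  by apply/seteqP; split => x /= Bx => [i _|i]; exact: Bx.
have h : (n.+1%:R^-1 / 2 < n.+1%:R^-1 :> R)%R.
  by rewrite ltr_pdivrMr// ltr_pMr ?invr_gt0// ltr1n.
rewrite (lebesgue_rV_box (B := fun=> `](n.+1%:R^-1 / 2), n.+1%:R^-1[%classic%R)); last first.
  by move=> i; exact: measurable_itv.
under eq_bigr => i _.
  rewrite lebesgue_measure_itv/= lte_fin h -EFinD.
  rewrite (_ : (_ - _)%R = n.+1%:R^-1 / 2)%R; last by move: (n.+1%:R^-1)%R => x; lra.
  over.
by rewrite -(big_morph EFin (@EFinM R) erefl) big_const iter_mulr_1 card_ord.
Qed.

Lemma corner_gt0 n : 0 < lebesgue_rV n (corner n).
Proof.
by have [_ ->] := lebesgue_rV_corner n; rewrite lte_fin exprn_gt0// divr_gt0 ?invr_gt0.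
Qed.

Lemma ball_vol_gt0 n : (0 < ball_vol n)%R.
Proof.
rewrite fine_gt0// lebesgue_rV_oball_ltoo andbT.
apply: (lt_le_trans (corner_gt0 n)).
have [mc _] := lebesgue_rV_corner n.
by apply: le_measure; rewrite ?inE//; [exact: measurable_oball|exact: corner_sub].
Qed.

(** Positivity of [vol] requires finiteness too, since [fine] sends +oo to 0: the cone over the
    sphere contains [corner] and lies in [oball 2]. *)
Lemma omega_gt0 n : (0 < @omega R n.+1)%R.
Proof.
rewrite /omega /sphere_measure mulr_gt0 ?ltr0n//.
set S := [set _ | _].
have [mc _] := lebesgue_rV_corner n.+1.
have cS : corner n.+1 `<=` S.
  move=> z zc; have z0 : z != 0%R.
    apply/eqP => z0; have /= := zc ord0; rewrite z0 mxE in_itv/= ltNge.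
    by rewrite divr_ge0 ?invr_ge0.
  have := corner_sub zc; rewrite /oball/= => z1.
  exists (enorm z), ((enorm z)^-1 *: z)%R; split.
  - by rewrite enorm_gt0 z0 ltW.
  - by rewrite /= enormZ ger0_norm ?invr_ge0 ?enorm_ge0// mulVf// enorm_eq0.
  - by rewrite scalerA divff ?scale1r// enorm_eq0.
have SB : S `<=` oball 2.
  move=> z [t [x [/andP[t0 t1] x1 ->]]]; rewrite /oball/= enormZ x1 mulr1.
  by rewrite gtr0_norm// (le_lt_trans t1)// ltr1n.
rewrite /vol fine_gt0//; apply/andP; split.
  rewrite (lt_le_trans (corner_gt0 n.+1))// -measurable_mu_extE//.
  exact: le_mu_ext.
apply: (@le_lt_trans _ _ (leb (oball 2 : set 'rV[R]_n.+1))); first exact: le_mu_ext.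
rewrite /leb measurable_mu_extE ?lebesgue_rV_oball_ltoo//; exact: measurable_oball.
Qed.

(** On the line of direction e = (1, v) the ball cuts a length 2 s / |e| and the shell 1 <= |z| < 2
    at least 1 / |e|. So the mass of the ball is at most 2 s times that of the shell, where the
    kernel is at most 1. *)
Lemma integral_riesz_oball n (s : R) : (0 <= s)%R ->
  \int[lebesgue_rV n.+1]_z ((\1_(oball s) z)%:E * (riesz z)%:E) <=
  (2 * 2 ^+ n.+1 * ball_vol n.+1 * s)%:E.
Proof.
move=> s0.
have mI (E : set 'rV[R]_n.+1) : measurable E -> measurable_fun setT (fun x => (\1_E x)%:E : \bar R).
  by move=> mE; exact/measurable_EFinP/measurable_indic.
have I0 (E : set 'rV[R]_n.+1) x : 0 <= (\1_E x)%:E :> \bar R by rewrite lee_fin.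
have mB := @measurable_oball n.+1.
rewrite (ge0_integral_riesz (mI _ (mB s)) (I0 _)).
pose sh : set 'rV[R]_n.+1 := oball 2 `\` oball 1.
have msh : measurable sh by exact: measurableD.
have mk : measurable_fun setT (fun v : 'rV[R]_n => riesz (cons_rV (1%R, v))).
  by apply: measurable_riesz; exact: measurable_rV_cons.
have mG (E : set 'rV[R]_n.+1) : measurable E -> measurable_fun setT
    (fun v : 'rV[R]_n => \int[leb1]_t (\1_E (t *: cons_rV (1%R, v)))%:E).
  move=> mE.
  apply: (measurable_fun_fubini_tonelli_F (m2 := leb1) (fun p : 'rV[R]_n * measurableTypeR R =>
    (\1_E (p.2 *: cons_rV (1%R, p.1)))%:E)) => [|p]; last exact: I0.
  apply: (measurableT_comp (mI _ mE)); apply: measurable_rV_scale => //.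
  exact: measurable_rV_cons.
apply: (@le_trans _ _ ((2 * s)%:E * \int[lebesgue_rV n]_v ((riesz (cons_rV (1%R, v)))%:E *
    \int[leb1]_t (\1_sh (t *: cons_rV (1%R, v)))%:E))).
  rewrite -ge0_integralZl_EFin//; last 3 first.
  - move=> v _; apply: mule_ge0; first by rewrite lee_fin riesz_ge0.
    exact: integral_ge0.
  - by apply: emeasurable_funM; [exact/measurable_EFinP|exact: mG].
  - exact: mulr_ge0.
  apply: ge0_le_integral => //.
  - move=> v _; apply: mule_ge0; first by rewrite lee_fin riesz_ge0.
    exact: integral_ge0.
  - by apply: emeasurable_funM; [exact/measurable_EFinP|exact: mG].
  - apply: emeasurable_funM => //.
    by apply: emeasurable_funM; [exact/measurable_EFinP|exact: mG].
  move=> v _; rewrite muleCA lee_wpmul2l ?lee_fin ?riesz_ge0//.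
  set e := cons_rV (1%R, v); set l := enorm e.
  have l0 : (0 < l)%R.
    by rewrite enorm_gt0 -dot_eq0 dot_cons mulr1 gt_eqF// ltr_wpDr// dot_ge0.
  apply: (@le_trans _ _ (2 * s / l)%:E).
    rewrite (_ : (fun t => _) = (fun t => (\1_(`]- (s / l), (s / l)[%classic%R : set R) t)%:E)); last first.
      apply/funext => t; congr (_ %:E); rewrite !indicE; congr (_ %:R); congr nat_of_bool.
      apply/idP/idP; rewrite !inE /oball/= enormZ -/l in_itv/= -ltr_norml;
        by rewrite -ltr_pdivlMr.
    rewrite integral_indic ?setIT//= lebesgue_measure_itv/=.
    case: ifPn => _; rewrite -?EFinD lee_fin; last first.
      by apply: divr_ge0; [exact: mulr_ge0|exact: ltW].
    by rewrite opprK -mulrA mulr_natl.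
  rewrite EFinM lee_wpmul2l ?lee_fin ?mulr_ge0//.
  (* Only the half of the shell with t > 0 is counted. *)
  apply: (@le_trans _ _ (\int[leb1]_t (\1_(`[l^-1, (2 / l)%R[%classic : set R) t)%:E)).
    rewrite integral_indic ?setIT//=.
    rewrite lebesgue_measure_itv/= lte_fin ltr_pMl ?invr_gt0// ltr1n -EFinD lee_fin.
    by lra.
  apply: ge0_le_integral => //.
  - exact/measurable_EFinP/measurable_indic.
  - have mt : measurable_fun setT (fun t : measurableTypeR R => (t *: e)%R).
      by apply: measurable_rV_scale.
    exact: (measurableT_comp (mI _ msh) mt).
  - move=> t _; rewrite lee_fin !indicE ler_nat.
    case: (boolP (t \in _)) => //; rewrite inE/= in_itv/= => /andP[t1 t2].
    have t0 : (0 < t)%R by rewrite (lt_le_trans _ t1)// invr_gt0.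
    rewrite mem_set//; split; rewrite /oball/= enormZ gtr0_norm// -/l.
      by rewrite -ltr_pdivlMr.
    by apply/negP; rewrite -leNgt -ler_pdivrMr// mul1r.
rewrite -(ge0_integral_riesz (mI _ msh) (I0 _)).
rewrite (_ : 2 * 2 ^+ n.+1 * ball_vol n.+1 * s = 2 * s * (2 ^+ n.+1 * ball_vol n.+1))%R; last by ring.
rewrite [leRHS]EFinM lee_wpmul2l ?lee_fin ?mulr_ge0//.
rewrite -(lebesgue_rV_oball (n := n.+1) _ (ler0n R 2))//.
rewrite -[in leRHS](setIT (oball 2)) -(integral_indic _ measurableT)//.
apply: ge0_le_integral => //.
- by move=> z _; rewrite mule_ge0// lee_fin riesz_ge0.
- apply: emeasurable_funM; first exact: (mI _ msh).
  by apply/measurable_EFinP; exact: measurable_riesz.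
- exact: (mI _ (mB 2%R)).
move=> z _; rewrite -EFinM lee_fin indicE; case: (boolP (z \in sh)) => zs; last by rewrite mul0r.
move: zs; rewrite inE => -[z2 z1]; rewrite mul1r indicE mem_set//=.
move: z1; rewrite /oball/= => /negP; rewrite -leNgt => z1.
by rewrite /riesz invf_le1 ?exprn_ege1// (lt_le_trans ltr01)// exprn_ege1.
Qed.

End balls.

(** * Reflections exchanging the origin and a given point *)

Section reflections.
Context {R : realType} {d : nat}.
Implicit Types (x y z : 'rV[R]_d) (E : set 'rV[R]_d).

(** At z = 0 this is the identity, so that [reflE] to [refl_fixP] hold for every z. *)
Definition refl z y : 'rV[R]_d := sigma_between 0 z y.

Lemma reflE z y : refl z y = y + (1 - 2 * dot z y / dot z z) *: z.
Proof.
rewrite /refl /sigma_between /hrefl subr0 dot0l subr0 -scaleNr.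
have [->|z0] := eqVneq z 0; first by rewrite !scaler0.
congr (_ + _); congr (_ *: _); field; by rewrite dot_eq0.
Qed.

Lemma dot_refl z y : dot z (refl z y) = dot z z - dot z y.
Proof.
have [->|z0] := eqVneq z 0; first by rewrite !dot0l subr0.
by rewrite reflE !dotE; field; rewrite dot_eq0.
Qed.

Lemma sqr_refl z y :
  dot (refl z y) (refl z y) = dot y y - 2 * dot z y + dot z z.
Proof.
have [->|z0] := eqVneq z 0; first by rewrite reflE scaler0 addr0 !dot0l; lra.
by rewrite reflE !dotE (dotC y z); field; rewrite dot_eq0.
Qed.

Lemma reflK z : involutive (refl z).
Proof.
move=> y; rewrite [LHS]reflE dot_refl reflE -addrA -scalerDl.
have [->|z0] := eqVneq z 0; first by rewrite scaler0 addr0.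
set k := (X in X *: z); suff -> : k = 0 by rewrite scale0r addr0.
by rewrite /k; field; rewrite dot_eq0.
Qed.

Lemma refl_fix z y : 2 * dot z y = dot z z -> refl z y = y.
Proof.
move=> e; rewrite reflE e; have [->|z0] := eqVneq z 0; first by rewrite scaler0 addr0.
by rewrite divff ?dot_eq0// subrr scale0r addr0.
Qed.

Lemma refl_fixP z y : (refl z y == y) = (2 * dot z y == dot z z).
Proof.
apply/eqP/eqP => [e|]; last exact: refl_fix.
by have := dot_refl z y; rewrite e; lra.
Qed.

(** The hypothesis excludes mirrors through the origin: if |x| = |y| then u (x, y) = 0 and [refl] is
    the identity. *)
Lemma refl_u x y : enorm x != enorm y -> refl (u (x, y)) x = y.
Proof.
move=> xy; rewrite u_spread reflE /spread.
have yx0 : dot (y - x) (y - x) != 0.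
  by rewrite dot_eq0 subr_eq0; apply: contra xy => /eqP ->.
have yy : dot y y = dot (y - x) (y - x) + 2 * dot x (y - x) + dot x x.
  by rewrite !dotE (dotC y x); ring.
have xy' : dot (y - x) (y - x) + 2 * dot x (y - x) != 0.
  by apply: contra xy => /eqP e; rewrite /enorm yy e add0r.
rewrite !(dotZl, dotZr) scalerA (dotC (y - x) x).
set a := (X in X *: _); suff -> : a = 1 by rewrite scale1r addrC subrK.
rewrite /a; move: (dot (y - x) (y - x)) (dot x (y - x)) yx0 xy' => D p D0 Dp0.
by field; rewrite D0.
Qed.

(** A reflection that moves the origin is determined by the image of the origin, so the random
    reflections can be replaced by the random points sigma_k(0). *)
Lemma refl_Omega s : Omega s -> s = refl (s 0).
Proof.
case=> -[v [c [v0 ->]]].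
have d0 : dot v v != 0 by rewrite dot_eq0.
set k := 2 * c / dot v v.
have -> : hrefl v c 0 = k *: v.
  by rewrite /hrefl dot0r !sub0r mulrN mulNr scaleNr opprK.
move=> kv0; apply/funext => y; rewrite reflE /hrefl -(scaleNr _ v).
have k0 : k != 0 by apply: contra kv0 => /eqP ->; rewrite scale0r.
rewrite !(dotZl, dotZr) scalerA; congr (_ + _); congr (_ *: _).
have -> : c = k * dot v v / 2 by rewrite /k; field.
by field; rewrite k0 d0.
Qed.

(** By [polarizeE] this is polarization with respect to [refl z], the sides of the mirror being told
    apart by the sign of 2 z.y - z.z. For z = 0 only the third case occurs and the set is
    unchanged. *)
Definition pol z E : set 'rV[R]_d := [set y |
  [\/ 2 * dot z y < dot z z /\ (E y \/ E (refl z y)),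
      dot z z < 2 * dot z y /\ E y /\ E (refl z y)
    | 2 * dot z y = dot z z /\ E y]].

Lemma mirror_refl z y : mirror (refl z) y <-> 2 * dot z y = dot z z.
Proof.
by split => [e|e]; [apply/eqP; rewrite -refl_fixP; apply/eqP|exact: refl_fix].
Qed.

(** For z other than 0, the segment from 0 to y meets the mirror exactly when 0 < z.z <= 2 z.y,
    namely at t = z.z / (2 z.y). For z = 0 every point is on the mirror. *)
Lemma pos_side_refl z y : pos_side (refl z) y <-> 2 * dot z y < dot z z.
Proof.
have z0 := dot_ge0 z; split => [h|h t /andP[t0 t1]].
  rewrite ltNge; apply/negP => zy.
  have [e|dz0] := eqVneq (dot z z) 0.
    apply: (h 0); first by rewrite lexx ler01.
    by apply/mirror_refl; rewrite scale0r dot0r mulr0 e.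
  have p0 : 0 < 2 * dot z y by rewrite (lt_le_trans _ zy)// lt_def dz0.
  apply: (h (dot z z / (2 * dot z y))).
    apply/andP; split; first by apply: divr_ge0 => //; exact: ltW.
    by rewrite ler_pdivrMr// mul1r.
  by apply/mirror_refl; rewrite dotE; field; rewrite gt_eqF// -(pmulr_rgt0 _ (ltr0n R 2)).
move/mirror_refl; rewrite dotE => e.
have : 2 * (t * dot z y) <= t * dot z z.
  by rewrite mulrCA ler_wpM2l// ltW.
rewrite e => h2.
have [t1'|t1'] := eqVneq t 1.
  by move: e h; rewrite t1' mul1r => ->; rewrite ltxx.
have : t * dot z z < dot z z \/ dot z z = 0.
  have [->|dz] := eqVneq (dot z z) 0; first by right.
  by left; rewrite gtr_pMl ?lt_neqAle ?t1'//; rewrite eq_sym dz.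
case=> [|zz]; first by rewrite ltNge h2.
move: h; rewrite zz; have /eqP := zz; rewrite dot_eq0 => /eqP ->.
by rewrite dot0l mulr0 ltxx.
Qed.

Lemma neg_side_refl z y : neg_side (refl z) y <-> dot z z < 2 * dot z y.
Proof.
rewrite /neg_side /setC/=; split => [/not_orP[h1 h2]|h].
  rewrite lt_def; apply/andP; split.
    by apply/eqP => e; apply/h1/mirror_refl.
  by rewrite leNgt; apply/negP => e; apply/h2/pos_side_refl.
by case=> [/mirror_refl|/pos_side_refl]; lra.
Qed.

Lemma polarizeE z E : polarize (refl z) E = pol z E.
Proof.
apply/seteqP; split => y; rewrite /polarize/= /polarize_fun /pol/=.
  case: ifPn => [/set_mem/pos_side_refl zy|].
    move=> e; apply: Or31; split => //; apply: contrapT => /not_orP[h1 h2].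
    move: e; rewrite !indicE !memNset// maxxx => /esym/eqP.
    by rewrite oner_eq0.
  move=> /negP; rewrite inE => /pos_side_refl npos.
  case: ifPn => [/set_mem/neg_side_refl zy|].
    move=> e; apply: Or32; split => //; move: e; rewrite !indicE.
    case: (boolP (y \in E)); case: (boolP (refl z y \in E));
      rewrite ?inE ?minxx/=.
    - by [].
    - by move=> _ _; rewrite minEge ler01 => /esym/eqP; rewrite oner_eq0.
    - by move=> _ _; rewrite minEle ler01 => /esym/eqP; rewrite oner_eq0.
    - by move=> _ _ /esym/eqP; rewrite oner_eq0.
  move=> /negP; rewrite inE => /neg_side_refl nneg.
  rewrite indicE; case: (boolP (y \in E)) => [/set_mem yE _|_ /esym/eqP].
    by apply: Or33; split => //; lra.
  by rewrite oner_eq0.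
case=> [[zy Ey]|[zy [Ey Ezy]]|[zy Ey]].
- rewrite mem_set/=; last exact/pos_side_refl.
  rewrite !indicE; case: Ey => Ey; rewrite (mem_set Ey)/=.
    by case: (_ \in E); rewrite ?maxxx// max_l ?ler01.
  by case: (_ \in E); rewrite ?maxxx// max_r ?ler01.
- rewrite memNset/=; last by move=> /pos_side_refl; lra.
  rewrite mem_set/=; last exact/neg_side_refl.
  by rewrite !indicE !mem_set// minxx.
- rewrite memNset/=; last by move=> /pos_side_refl; lra.
  rewrite memNset/=; last by move=> /neg_side_refl; lra.
  by rewrite indicE mem_set.
Qed.

(** A point gained by polarization lies on the side of 0, hence is nearer to 0 than its reflection,
    which was in [E]. *)
Lemma pol_enorm_le z E L : (forall x, E x -> enorm x <= L) ->
  forall x, pol z E x -> enorm x <= L.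
Proof.
move=> EL x [[zx [|]]|[_ [+ _]]|[_ +]]; try exact: EL.
move=> /EL; apply: le_trans; rewrite ler_enorm sqr_refl; lra.
Qed.

End reflections.

(** * Loss under polarization *)

Section gain.
Context {R : realType} {d : nat}.
Implicit Types (x y z : 'rV[R]_d) (E : set 'rV[R]_d).
Local Notation m := (@lebesgue_rV R d).

Lemma measurable_refl dT (T : measurableType dT) (z y : T -> 'rV[R]_d) :
  measurable_fun setT z -> measurable_fun setT y ->
  measurable_fun setT (fun t => refl (z t) (y t)).
Proof.
move=> mz my; under eq_fun do rewrite reflE.
apply: measurable_rV_add => //; apply: measurable_rV_scale => //.
apply: measurable_funB => //; apply: measurable_funM.
  by apply: measurable_funM => //; exact: measurable_dot.
by apply: measurable_funV; exact: measurable_dot.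
Qed.

(** [A] and [A'] stand for the conditions that y, respectively its reflection, belongs to the set.
    This form serves both a fixed z and a z depending on a parameter. *)
Lemma measurable_pol_gen dS (S : measurableType dS) (z y : S -> 'rV[R]_d)
    (A A' : set S) :
  measurable_fun setT z -> measurable_fun setT y ->
  measurable A -> measurable A' ->
  measurable [set s | [\/ 2 * dot (z s) (y s) < dot (z s) (z s) /\ (A s \/ A' s),
      dot (z s) (z s) < 2 * dot (z s) (y s) /\ A s /\ A' s
    | 2 * dot (z s) (y s) = dot (z s) (z s) /\ A s]].
Proof.
move=> mz my mA mA'.
have mzy : measurable_fun setT (fun s => 2 * dot (z s) (y s)).
  by apply: measurable_funM => //; exact: measurable_dot.
have mzz : measurable_fun setT (fun s => dot (z s) (z s)) by exact: measurable_dot.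
have m1 := measurable_fun_ltr mzy mzz; have m2 := measurable_fun_ltr mzz mzy.
have m3 := measurable_fun_eqr mzy mzz.
rewrite (_ : [set _ | _] =
    ((fun s => 2 * dot (z s) (y s) < dot (z s) (z s)) @^-1` [set true] `&` (A `|` A')) `|`
    ((fun s => dot (z s) (z s) < 2 * dot (z s) (y s)) @^-1` [set true] `&` (A `&` A')) `|`
    ((fun s => 2 * dot (z s) (y s) == dot (z s) (z s)) @^-1` [set true] `&` A)); last first.
  apply/seteqP; split => s /=.
    by case=> [h|h|[/eqP h1 h2]]; [left; left|left; right|right].
  by case=> [[h|h]|[/eqP h1 h2]]; [apply: Or31|apply: Or32|apply: Or33].
have mt f : measurable_fun setT f -> measurable (f @^-1` [set true] : set S).
  by move=> mf; rewrite -[X in measurable X]setTI; exact: mf.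
apply: measurableU; first apply: measurableU.
- by apply: measurableI; [exact: mt|exact: measurableU].
- by apply: measurableI; [exact: mt|exact: measurableI].
- by apply: measurableI => //; exact: mt.
Qed.

Lemma measurable_refl_preimage z E : measurable E -> measurable (refl z @^-1` E).
Proof.
by move=> mE; rewrite -[X in measurable X]setTI; exact: measurable_refl.
Qed.

Lemma measurable_pol z E : measurable E -> measurable (pol z E).
Proof.
move=> mE; apply: (@measurable_pol_gen _ _ (fun=> z) id E (refl z @^-1` E)) => //.
exact: measurable_refl_preimage.
Qed.

Lemma measurable_pol_joint dT (T : measurableType dT) (z : T -> 'rV[R]_d)
    (E : T -> set 'rV[R]_d) :
  measurable_fun setT z -> measurable [set p | E p.1 p.2] ->
  measurable [set p | pol (z p.1) (E p.1) p.2].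
Proof.
move=> mz mE.
have mz1 : measurable_fun setT (fun p : T * 'rV[R]_d => z p.1).
  exact: (measurableT_comp mz).
apply: (@measurable_pol_gen _ (T * 'rV[R]_d)%type (fun p => z p.1) snd [set p | E p.1 p.2]
  [set p | E p.1 (refl (z p.1) p.2)]) => //.
have mr : measurable_fun setT (fun p : T * 'rV[R]_d => (p.1, refl (z p.1) p.2)).
  by apply: measurable_fun_pair => //; exact: measurable_refl.
by have := mr measurableT _ mE; rewrite setTI.
Qed.

Lemma lebesgue_rV_refl z E : measurable E -> m (refl z @^-1` E) = m E.
Proof.
move=> mE; have [->|z0] := eqVneq z 0.
  by congr (m _); apply/seteqP; split => y /=; rewrite reflE scaler0 addr0.
by rewrite /refl /sigma_between lebesgue_rV_hrefl// subr0.
Qed.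

Definition moved s E z : set 'rV[R]_d :=
  [set y | (E `\` oball s) y /\ (oball s `\` E) (refl z y)].

Lemma measurable_moved s E z : measurable E -> measurable (moved s E z).
Proof.
move=> mE; have mB := @measurable_oball R d s.
apply: (@measurableI _ _ (E `\` oball s) (refl z @^-1` (oball s `\` E))).
  exact: measurableD.
by apply: measurable_refl_preimage; exact: measurableD.
Qed.

Let indicP (F : set 'rV[R]_d) v (b : bool) : (F v <-> b) -> \1_F v = b%:R :> R.
Proof. by move=> Fb; rewrite indicE (_ : (v \in F) = b)//; apply/idP/idP; rewrite inE => /Fb. Qed.

(* Summed over the orbit {y, refl z y}, the loss identity holds pointwise. *)
Lemma polarization_orbit s E z y :
  \1_(E `\` oball s) y + \1_(E `\` oball s) (refl z y) =
  (\1_(pol z E `\` oball s) y + \1_(pol z E `\` oball s) (refl z y)) +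
  (\1_(moved s E z) y + \1_(moved s E z) (refl z y)) :> R.
Proof.
have aP v : E v <-> `[< E v >] by split => [/asboolP|/asboolP].
have cP (v : 'rV[R]_d) : oball s v <-> enorm v < s by [].
have dP (F G : set 'rV[R]_d) v (a b : bool) : (F v <-> a) -> (G v <-> b) ->
    ((F `\` G) v <-> a && ~~ b) :> Prop.
  by move=> Fa Gb; split => [[/Fa -> /Gb/negP]|/andP[/Fa ? /negP nb]] //; split => // /Gb.
rewrite (indicP (dP _ _ _ _ _ (aP y) (cP y))) (indicP (dP _ _ _ _ _ (aP (refl z y)) (cP _))).
have mP v w : refl z v = w ->
    (moved s E z v <-> [&& `[< E v >] && ~~ (enorm v < s), enorm w < s & ~~ `[< E w >]]).
  move=> <-; split => [[/(dP _ _ _ _ _ (aP v) (cP v)) -> /(dP _ _ _ _ _ (cP _) (aP _)) ->]//|].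
  by case/andP => h1 h2; split; [apply/(dP _ _ _ _ _ (aP _) (cP _))|apply/(dP _ _ _ _ _ (cP _) (aP _))].
rewrite (indicP (mP y _ erefl)) (indicP (mP _ _ (reflK z y))).
have [zy|zy|zy] := ltgtP (2 * dot z y) (dot z z).
- have p1 : pol z E y <-> `[< E y >] || `[< E (refl z y) >].
    split => [[[_ [/aP ->|/aP ->]]|[]|[]]|/orP h]; rewrite ?orbT//; try lra.
    by apply: Or31; split => //; case: h => /aP; [left|right].
  have p2 : pol z E (refl z y) <-> `[< E y >] && `[< E (refl z y) >].
    rewrite /pol/= dot_refl reflK.
    split => [[[]|[_ [/aP -> /aP ->]]|[]]|/andP[/aP h1 /aP h2]]//; try lra.
    by apply: Or32; split => //; lra.
  rewrite (indicP (dP _ _ _ _ _ p1 (cP _))) (indicP (dP _ _ _ _ _ p2 (cP _))).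
  (* A point on the side of 0 is nearer to 0 than its image; this excludes the truth values for
     which the identity would fail. *)
  have : enorm (refl z y) < s -> enorm y < s.
    by apply: lt_trans; rewrite ltr_enorm sqr_refl; lra.
  by case: `[< E y >]; case: `[< E (refl z y) >]; case: (enorm y < s);
    case: (enorm (refl z y) < s) => //= h; rewrite ?addr0 ?add0r//; have := h isT.
- have p1 : pol z E (refl z y) <-> `[< E y >] || `[< E (refl z y) >].
    rewrite /pol/= dot_refl reflK.
    split => [[[_ [/aP ->|/aP ->]]|[]|[]]|/orP h]; rewrite ?orbT//; try lra.
    by apply: Or31; split => //; [lra|case: h => /aP; [right|left]].
  have p2 : pol z E y <-> `[< E y >] && `[< E (refl z y) >].
    split => [[[]|[_ [/aP -> /aP ->]]|[]]|/andP[/aP h1 /aP h2]]//; try lra.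
    by apply: Or32; split => //; lra.
  rewrite (indicP (dP _ _ _ _ _ p1 (cP _))) (indicP (dP _ _ _ _ _ p2 (cP _))).
  have : enorm y < s -> enorm (refl z y) < s.
    by apply: lt_trans; rewrite ltr_enorm sqr_refl; lra.
  by case: `[< E y >]; case: `[< E (refl z y) >]; case: (enorm y < s);
    case: (enorm (refl z y) < s) => //= h; rewrite ?addr0 ?add0r//; have := h isT.
- rewrite (refl_fix zy).
  have p1 : pol z E y <-> `[< E y >].
    split => [[[]|[]|[_ /aP]]|/aP h]//; try lra.
    by apply: Or33.
  rewrite (indicP (dP _ _ _ _ _ p1 (cP _))).
  by case: `[< E y >]; case: (enorm y < s); rewrite /= ?addr0.
Qed.

(** [polarization_orbit] is integrated in y. By reflection invariance each pair of terms contributes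
    twice a measure, and finiteness of [m E] allows the factor 2 to be cancelled. *)
Lemma polarization_loss s E z : measurable E -> (m E < +oo)%E ->
  (m (E `\` oball s) = m (pol z E `\` oball s) + m (moved s E z))%E.
Proof.
move=> mE Eoo; have mB := @measurable_oball R d s.
have mF : measurable (E `\` oball s) by exact: measurableD.
have mP : measurable (pol z E `\` oball s).
  by apply: measurableD => //; exact: measurable_pol.
have mK := measurable_moved s z mE.
have twice F : measurable F ->
    (\int[m]_y (\1_F y + \1_F (refl z y))%:E = m F + m F)%E.
  move=> mF'; have mrF := measurable_refl_preimage z mF'.
  under eq_integral do rewrite EFinD.
  rewrite ge0_integralD//.
  - rewrite (_ : (fun y => (\1_F (refl z y))%:E) = (fun y => (\1_(refl z @^-1` F) y)%:E))//.
    have I G : measurable G -> (\int[m]_y (\1_G y)%:E = m G)%E.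
      by move=> mG; rewrite integral_indic ?setIT.
    by rewrite (I _ mF') (I _ mrF) lebesgue_rV_refl.
  - exact/measurable_EFinP/measurable_indic.
  - by apply/measurable_EFinP; exact: (@measurable_indic _ _ R setT _ mrF).
have := twice _ mF.
under eq_integral do rewrite polarization_orbit EFinD.
have mi F : measurable F -> measurable_fun setT (fun y => (\1_F y + \1_F (refl z y))%:E : \bar R).
  move=> mF'; have mrF := measurable_refl_preimage z mF'.
  apply/measurable_EFinP; apply: measurable_funD; first exact: measurable_indic.
  exact: (@measurable_indic _ _ R setT _ mrF).
rewrite ge0_integralD//; [|exact: mi|exact: mi].
rewrite !twice//.
have : (m (E `\` oball s) < +oo)%E.
  by apply: le_lt_trans Eoo; apply: le_measure => //; rewrite ?inE//; exact: subDsetl.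
have := measure_ge0 m (E `\` oball s).
have := measure_ge0 m (pol z E `\` oball s); have := measure_ge0 m (moved s E z).
move: (m (E `\` oball s)) (m (pol z E `\` oball s)) (m (moved s E z)) =>
  [a| |] [b| |] [c| |]//= _ _ _ _; rewrite -?EFinD => -[] h.
by congr (_%:E); lra.
Qed.

End gain.

(** * The integrated gain as an integral over pairs of misplaced points *)

Section interaction.
Context {R : realType} {n : nat}.
Local Open Scope ereal_scope.
Local Notation V := 'rV[R]_n.+1.
Local Notation m := (@lebesgue_rV R n.+1).
Implicit Types (x y z : V) (E : set V).

(** After Tonelli, x is fixed and z is replaced by u (x, y), so that the reflected point [refl z x]
    becomes y. The set [Q] and the constant c leave room for a restriction on u (x, y), as needed
    for F and G. *)
Lemma interaction (s c : R) E (h : V -> R) (Q : set (V * V)) :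
  measurable E -> measurable_fun setT h -> (forall z, 0 <= h z)%R -> measurable Q -> (0 <= c)%R ->
  (forall x y, Q (x, y) -> [/\ (E `\` oball s) x, (oball s `\` E) y &
     (c <= h (u (x, y)) * riesz (y - x))%R]) ->
  c%:E * (m \x m) Q <=
  \int[m]_z ((h z)%:E * m (moved s E z) * (riesz z)%:E).
Proof.
move=> mE mh h0 mQ c0 HQ; have mB := @measurable_oball R n.+1 s.
pose A := E `\` oball s; pose B := oball s `\` E.
have mA : measurable A by exact: measurableD.
have mB' : measurable B by exact: measurableD.
pose Phi x z : R := (\1_A x * \1_B (refl z x) * h z)%R.
have mrefl : measurable_fun setT (fun p : V * V => refl p.2 p.1).
  exact: measurable_refl.
have mPhi : measurable_fun setT (fun p : V * V => Phi p.1 p.2).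
  apply: measurable_funM; last exact: (measurableT_comp mh).
  apply: measurable_funM; first exact: (measurableT_comp (measurable_indic mA)).
  exact: (measurableT_comp (measurable_indic mB') mrefl).
have Phi0 x z : (0 <= Phi x z)%R by rewrite mulr_ge0// mulr_ge0.
have mPr : measurable_fun setT (fun p : V * V => (Phi p.1 p.2 * riesz p.2)%:E).
  apply/measurable_EFinP; apply: measurable_funM => //.
  exact: measurable_riesz.
have Pr0 (p : V * V) : 0 <= (Phi p.1 p.2 * riesz p.2)%:E.
  by rewrite lee_fin mulr_ge0// riesz_ge0.
have -> : \int[m]_z ((h z)%:E * m (moved s E z) * (riesz z)%:E) =
    \int[m]_z \int[m]_x (Phi x z * riesz z)%:E.
  apply: eq_integral => z _.
  under [RHS]eq_integral => x _.
    rewrite (_ : (Phi x z * riesz z) = (h z * riesz z) * \1_(moved s E z) x)%R; last first.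
      rewrite /Phi (_ : \1_(moved s E z) x = \1_A x * \1_B (refl z x) :> R)%R; first by ring.
      rewrite !indicE -natrM mulnb; congr (_ %:R); congr nat_of_bool.
      by apply/idP/andP; rewrite !inE.
    rewrite EFinM.
    over.
  rewrite ge0_integralZl_EFin//; last 2 first.
  - by apply/measurable_EFinP; apply: measurable_indic; exact: measurable_moved.
  - by rewrite mulr_ge0// riesz_ge0.
  rewrite integral_indic// ?setIT; last exact: measurable_moved.
  by rewrite EFinM muleAC.
rewrite -(fubini_tonelli (m1 := m) (m2 := m) _ mPr)//.
rewrite -[(m \x m) Q]mul1e.
have -> : c%:E * (1 * (m \x m) Q) = \int[m]_x \int[m]_y (c * \1_Q (x, y))%:E.
  have mcQ : measurable_fun setT (fun p : V * V => (c * \1_Q p)%:E : \bar R).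
    by apply/measurable_EFinP; apply: measurable_funM => //; exact: measurable_indic.
  have cQ0 (p : V * V) : 0 <= (c * \1_Q p)%:E by rewrite lee_fin mulr_ge0.
  rewrite -(fubini_tonelli1 (m1 := m) (m2 := m) _ mcQ)//.
  under eq_integral do rewrite EFinM.
  rewrite ge0_integralZl_EFin//; last by apply/measurable_EFinP; exact: measurable_indic.
  by rewrite integral_indic// setIT mul1e.
apply: ge0_le_integral => //.
- by move=> x _; apply: integral_ge0 => y _; rewrite lee_fin mulr_ge0.
- apply: (measurable_fun_fubini_tonelli_F (m2 := m) (fun p : V * V => (c * \1_Q p)%:E)).
    by apply/measurable_EFinP; apply: measurable_funM => //; exact: measurable_indic.
  by move=> p; rewrite lee_fin mulr_ge0.
- exact: (measurable_fun_fubini_tonelli_F (m2 := m) _ mPr).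
move=> x _ /=.
have mPx : measurable_fun setT (fun z => (Phi x z)%:E).
  apply/measurable_EFinP; apply: (measurableT_comp (g := fun z : V => (x, z)) mPhi).
  exact: measurable_fun_pair.
have Px0 z : 0 <= (Phi x z)%:E by rewrite lee_fin.
under [leRHS]eq_integral do rewrite EFinM.
rewrite -(ge0_integral_u x mPx Px0).
apply: ge0_le_integral => //.
- by move=> y _; rewrite lee_fin mulr_ge0.
- apply/measurable_EFinP; apply: measurable_funM => //.
  apply: (measurableT_comp (g := fun y : V => (x, y)) (measurable_indic mQ)).
  exact: measurable_fun_pair.
- apply: emeasurable_funM.
    apply: (measurableT_comp mPx); apply: (measurableT_comp (@measurable_u _ _)).
    exact: measurable_fun_pair.
  apply/measurable_EFinP; apply: measurable_riesz.
  by under eq_fun do rewrite -scaleN1r; apply: measurable_rV_add.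
move=> y _; rewrite -EFinM lee_fin indicE.
case: (boolP ((x, y) \in Q)) => [|_]; last by rewrite mulr0 mulr_ge0// riesz_ge0.
(* [refl_u] applies because y lies inside [oball s] and x outside it. *)
rewrite inE => /HQ[Ax By cle]; rewrite mulr1 /Phi refl_u; last first.
  case: Ax By => _ /=; rewrite /oball/= => /negP; rewrite -leNgt => sx [ys _].
  by rewrite gt_eqF// (lt_le_trans ys).
by rewrite !indicE !mem_set// !mul1r.
Qed.

End interaction.

Lemma volE (R : realType) d (E : set 'rV[R]_d) : measurable E ->
  vol E = fine (lebesgue_rV d E).
Proof. by move=> mE; rewrite /vol /leb measurable_mu_extE. Qed.

Lemma vol2E (R : realType) d (Q : set ('rV[R]_d * 'rV[R]_d)) : measurable Q ->
  vol2 Q = fine ((lebesgue_rV d \x lebesgue_rV d)%E Q).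
Proof. by move=> mQ; rewrite /vol2 measurable_mu_extE. Qed.

(** * Volumes of a single state outside and inside a ball *)

Section one_step.
Context {R : realType} {n : nat}.
Local Notation V := 'rV[R]_n.+1.
Local Notation m := (@lebesgue_rV R n.+1).
Local Notation mm := ((m \x m)%E : set (V * V) -> \bar R).
Implicit Types (x y z : V).

(** u (x, y) is y - x multiplied by (|y|^2 - |x|^2) / |y - x|^2. Hence, when the norms of x and y
    are close, a lower bound on |u| forces the points themselves to be close. *)
Lemma enorm_uM x y : enorm (u (x, y)) * enorm (y - x) = `|dot y y - dot x x|.
Proof.
rewrite u_spread /spread; set D := dot (y - x) (y - x).
have [D0|D0] := eqVneq D 0.
  have /eqP : enorm (y - x) = 0 by rewrite /enorm -/D D0 sqrtr0.
  rewrite enorm_eq0 subr_eq0 => /eqP ->.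
  by rewrite !subrr scaler0 normr0 /enorm dot0l sqrtr0 mulr0.
have e : enorm (y - x) * enorm (y - x) = D by rewrite -expr2 sqr_enorm.
rewrite enormZ -[LHS]mulrA; rewrite e {e}.
rewrite -[X in _ * X]ger0_norm; last exact: dot_ge0.
rewrite -normrM; congr (`|_|).
have : dot y y = D + 2 * dot x (y - x) + dot x x.
  by rewrite /D !dotE (dotC y x); ring.
move: (dot x (y - x)) D D0 => p D D0 ->; by field.
Qed.

Context {L r : R} {E : set V} (L0 : 0 < L) (r0 : 0 <= r) (mE : measurable E)
  (EL : forall x, E x -> enorm x <= L)
  (mr : m (oball r) = m E).

Let mB s : measurable (oball s : set V) := @measurable_oball R n.+1 s.

Lemma state_ltoo : (m E < +oo)%E.
Proof.
apply: (@lebesgue_rV_ltoo _ _ (L + 1)) => // x /EL xL; rewrite /oball/=.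
by rewrite (le_lt_trans xL)// ltrDl.
Qed.

Lemma sub_state_fin F : measurable F -> F `<=` E -> m F = (fine (m F))%:E.
Proof.
move=> mF FE; rewrite fineK// ge0_fin_numE//; apply: le_lt_trans state_ltoo.
by apply: le_measure => //; rewrite inE.
Qed.

Lemma sub_oball_fin s F : measurable F -> F `<=` oball s -> m F = (fine (m F))%:E.
Proof.
move=> mF Fs; rewrite fineK// ge0_fin_numE//.
exact: lebesgue_rV_ltoo Fs.
Qed.

Definition outer s : R := fine (m (E `\` oball s)).
Definition inner s : R := fine (m (oball s `\` E)).

Lemma outer_ge0 s : 0 <= outer s. Proof. by rewrite fine_ge0. Qed.
Lemma inner_ge0 s : 0 <= inner s. Proof. by rewrite fine_ge0. Qed.

Lemma outerE s : m (E `\` oball s) = (outer s)%:E.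
Proof. by apply: sub_state_fin; [exact: measurableD|exact: subDsetl]. Qed.

Lemma innerE s : m (oball s `\` E) = (inner s)%:E.
Proof. by apply: (@sub_oball_fin s); [exact: measurableD|exact: subDsetl]. Qed.

Lemma excessE : excess r E = outer r.
Proof. by rewrite /excess volE//; exact: measurableD. Qed.

(** Both sides are the measure of the union of [E] and the ball. As polarization preserves [m E],
    the two volumes change by equal amounts. *)
Lemma inner_outer s : inner s + fine (m E) = fine (m (oball s)) + outer s.
Proof.
have cE : m (E `&` oball s) = (fine (m (E `&` oball s)))%:E.
  by apply: sub_state_fin; [exact: measurableI|exact: subIsetl].
have e1 : (m E = m (E `\` oball s) + m (E `&` oball s))%E by exact: measureDI.
have e2 : (m (oball s) = m (oball s `\` E) + m (oball s `&` E))%E by exact: measureDI.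
rewrite e1 e2 setIC innerE outerE setIC cE -!EFinD /=; ring.
Qed.

Lemma inner_r : inner r = outer r.
Proof. by have := inner_outer r; rewrite mr; lra. Qed.

Lemma state_vol : fine (m E) = r ^+ n.+1 * ball_vol (R:=R) n.+1.
Proof. by rewrite -mr lebesgue_rV_oball. Qed.

Lemma outer_le s t : s <= t -> outer t <= outer s.
Proof.
move=> st; rewrite -lee_fin -!outerE; apply: le_measure; rewrite ?inE//; try exact: measurableD.
by move=> x [Ex xt]; split => // xs; apply: xt; rewrite /oball/= (lt_le_trans xs).
Qed.

Lemma inner_le s t : s <= t -> inner s <= inner t.
Proof.
move=> st; rewrite -lee_fin -!innerE; apply: le_measure; rewrite ?inE//; try exact: measurableD.
by move=> x [xs Ex]; split => //; rewrite /oball/= (lt_le_trans xs).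
Qed.

(** [E] has the volume of [oball r], so it leaves free in [oball (r + h)] at least the volume of a
    shell of width h around [oball r]. *)
Lemma inner_ge h : 0 <= h -> ball_vol (R:=R) n.+1 * r ^+ n * h <= inner (r + h).
Proof.
move=> h0; have := inner_outer (r + h); rewrite state_vol lebesgue_rV_oball ?addr_ge0//=.
have k0 := ball_vol_gt0 (R:=R) n.+1; have o0 := outer_ge0 (r + h).
have : r ^+ n * h + r ^+ n.+1 <= (r + h) ^+ n.+1.
  rewrite (exprS (r + h)) exprSr -mulrDr (addrC h) mulrC ler_wpM2l ?addr_ge0//.
  by rewrite lerXn2r ?nnegrE ?addr_ge0 ?lerDl.
by move=> /(ler_wpM2l (ltW k0)) h1 h2; lra.
Qed.

Lemma outer_ge h : 0 <= h -> h <= r -> ball_vol (R:=R) n.+1 * r ^+ n * h <= outer (r - h).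
Proof.
move=> h0 hr; have := inner_outer (r - h); rewrite state_vol lebesgue_rV_oball ?subr_ge0//=.
have k0 := ball_vol_gt0 (R:=R) n.+1; have o0 := inner_ge0 (r - h).
have : (r - h) ^+ n.+1 + r ^+ n * h <= r ^+ n.+1.
  rewrite -lerBrDr (exprSr r) -mulrBr (exprSr (r - h)) ler_wpM2r ?subr_ge0//.
  by rewrite lerXn2r ?nnegrE ?subr_ge0 ?gerBl.
by move=> /(ler_wpM2l (ltW k0)) h1 h2; lra.
Qed.

Lemma moved_fin s z : m (moved s E z) = (fine (m (moved s E z)))%:E.
Proof. by apply: sub_state_fin; [exact: measurable_moved|move=> x [[]]]. Qed.

Lemma gainE z : gain r E z = fine (m (moved r E z)).
Proof.
rewrite /gain -/(refl z) polarizeE excessE volE; last first.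
  by apply: measurableD => //; exact: measurable_pol.
have := polarization_loss r z mE state_ltoo; rewrite outerE moved_fin.
case: (m (pol z E `\` oball r)) => [a| |]//; rewrite -EFinD => -[->] /=.
by rewrite addrAC subrr add0r.
Qed.

Lemma gain_ge0 z : 0 <= gain r E z. Proof. by rewrite gainE fine_ge0. Qed.

Lemma gain_le z : gain r E z <= outer r.
Proof.
rewrite gainE -lee_fin -moved_fin -outerE; apply: le_measure; rewrite ?inE//.
- exact: measurable_moved.
- exact: measurableD.
- by move=> x [].
Qed.

(** As [refl z] exchanges 0 and z, the vector z - refl z y has the length of y. Hence |z|^2 <= 2
    (|y|^2 + |refl z y|^2) < 4 L^2, and cutting the law off at 2 L loses no gain. *)
Lemma moved_dist s z : moved s E z !=set0 -> oball (2 * L) z.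
Proof.
case=> y [[Ey ys] [zs _]]; rewrite /oball/= enorm_lt ?mulr_ge0 1?ltW//.
have yL : dot y y <= L ^+ 2 by rewrite -enorm_le; [exact: EL|exact: ltW].
have : dot (refl z y) (refl z y) < dot y y.
  by rewrite -ltr_enorm (lt_le_trans zs)// leNgt; apply/negP.
have := dotB_le (z - refl z y) (- refl z y); rewrite opprK subrK.
have -> : dot (z - refl z y) (z - refl z y) = dot y y.
  have -> : dot (z - refl z y) (z - refl z y) =
      dot z z - 2 * dot z (refl z y) + dot (refl z y) (refl z y).
    by move: (refl z y) => w; rewrite !dotE (dotC w z); ring.
  by rewrite dot_refl sqr_refl; lra.
rewrite dotNl dotNr opprK exprMn; nra.
Qed.

Lemma moved_far s z : ~ oball (2 * L) z -> m (moved s E z) = 0%E.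
Proof.
move=> z2; rewrite (_ : moved s E z = set0) ?measure0//.
by apply/eqP/negPn/negP => /set0P /moved_dist.
Qed.

Lemma gain_far z : ~ oball (2 * L) z -> gain r E z = 0.
Proof. by move=> z2; rewrite gainE moved_far. Qed.

End one_step.

Section joint_measurability.
Context {R : realType} {d : nat} {dT : measure_display} {T : measurableType dT}.
Local Notation V := 'rV[R]_d.
Local Notation m := (@lebesgue_rV R d).

Lemma measurable_section_measure (dU : measure_display) (U : measurableType dU)
    (mu : {sigma_finite_measure set U -> \bar R}) (F : T -> set U) :
  measurable [set p : T * U | F p.1 p.2] -> measurable_fun setT (fun t => mu (F t)).
Proof.
move=> mF; have := measurable_fun_xsection mu mF; congr (measurable_fun _ _).
apply/funext => t /=; congr (mu _); apply/seteqP; split => y; rewrite /xsection/= inE//.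
Qed.

Lemma measurable_state (E : T -> set V) (f : T * V -> V) :
  measurable [set p : T * V | E p.1 p.2] -> measurable_fun setT f ->
  measurable [set p : T * V | E p.1 (f p)].
Proof.
move=> mE mf.
have mr : measurable_fun setT (fun p : T * V => (p.1, f p)).
  exact: measurable_fun_pair.
by have := mr measurableT _ mE; rewrite setTI.
Qed.

Lemma measurable_moved_joint s (E : T -> set V) (z : T -> V) :
  measurable [set p : T * V | E p.1 p.2] -> measurable_fun setT z ->
  measurable_fun setT (fun t => m (moved s (E t) (z t))).
Proof.
move=> mE mz; apply: measurable_section_measure.
have mr : measurable_fun setT (fun p : T * V => refl (z p.1) p.2).
  by apply: measurable_refl => //; exact: (measurableT_comp mz).
have mB := @measurable_oball R d s.
have pre (f : T * V -> V) : measurable_fun setT f -> measurable (f @^-1` oball s).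
  by move=> mf; rewrite -[X in measurable X]setTI; exact: mf.
rewrite (_ : [set _ | _] = ([set p | E p.1 p.2] `\` (snd @^-1` oball s)) `&`
   (((fun p => refl (z p.1) p.2) @^-1` oball s) `\` [set p | E p.1 (refl (z p.1) p.2)])).
  apply: measurableI; apply: measurableD => //; try exact: pre.
  exact: measurable_state.
by apply/seteqP; split.
Qed.

End joint_measurability.

(** * One-step bounds *)

Section expected_gain.
Context {R : realType} {n : nat}.
Local Notation V := 'rV[R]_n.+1.
Local Notation m := (@lebesgue_rV R n.+1).
Implicit Types (x y z : V).

Lemma riesz_ge (a : R) z : 0 < enorm z -> enorm z <= a -> a ^- n <= riesz z.
Proof.
move=> z0 za; rewrite /riesz lef_pV2 ?posrE ?exprn_gt0//; last exact: lt_le_trans za.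
by rewrite lerXn2r ?nnegrE ?enorm_ge0// (le_trans (enorm_ge0 z)).
Qed.

Context (L r : R) (E : set V) (L0 : 0 < L) (r0 : 0 <= r) (mE : measurable E)
  (EL : forall x, E x -> enorm x <= L)
  (mr : m (oball r) = m E).

Let mB s : measurable (oball s : set V) := @measurable_oball R n.+1 s.

Local Notation outer := (@outer R n E).
Local Notation inner := (@inner R n E).

Lemma pair_dist s x y : (E `\` oball s) x -> (oball s `\` E) y ->
  [/\ 0 < enorm (y - x), enorm (y - x) <= 2 * L, enorm y < enorm x & enorm x <= L].
Proof.
move=> [Ex xs] [ys Ey]; have xL := EL Ex.
have yx : enorm y < enorm x by rewrite (lt_le_trans ys)// leNgt; apply/negP.
have yx0 : 0 < enorm (y - x).
  by rewrite enorm_gt0 subr_eq0; apply/eqP => e; rewrite e ltxx in yx.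
split => //; rewrite enorm_le ?mulr_ge0 1?ltW//.
have := dotB_le y x; have : dot x x <= L ^+ 2 by rewrite -enorm_le ?(ltW L0).
by have := yx; rewrite ltr_enorm exprMn; nra.
Qed.

(** All pairs are at distance at most 2 L, which bounds the kernel from below. *)
Lemma far_interaction s :
  (((2 * L) ^- n * (outer s * inner s))%R%:E <=
  \int[m]_z ((\1_(oball (2 * L)) z)%:E * m (moved s E z) * (riesz z)%:E))%E.
Proof.
have mA : measurable (E `\` oball s) by exact: measurableD.
have mH : measurable (oball s `\` E) by exact: measurableD.
have -> : ((2 * L) ^- n * (outer s * inner s))%:E =
    (((2 * L) ^- n)%:E * (m \x m) ((E `\` oball s) `*` (oball s `\` E)))%E.
  by rewrite product_measure1E//= (outerE mE EL) innerE// -!EFinM.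
apply: interaction => //.
- exact: measurableX.
- by rewrite invr_ge0 exprn_ge0// mulr_ge0 1?ltW.
move=> x y [/= Ax Hy]; split => //.
have [yx0 yx2 yx xL] := pair_dist Ax Hy.
have u2 : oball (2 * L) (u (x, y)).
  apply: (moved_dist L0 EL (s := s)); exists x; split => //.
  by rewrite refl_u// gt_eqF.
by rewrite indicE mem_set// mul1r; exact: riesz_ge.
Qed.

Context (N : nat) (N1 : (1 < N)%N).

Local Notation delta := (@delta R n.+1 L N).
Local Notation lambda := (@lambda R n.+1 L N).
Local Notation Fset := (F_set L r N E).
Local Notation Gset := (G_set L r N E).

Lemma c_d_gt0 : 0 < @c_d R n.+1 L.
Proof.
rewrite /c_d; apply: divr_gt0; last by rewrite exprn_gt0// ltr0n.
apply: mulr_gt0; first by rewrite mulr_gt0// exprn_gt0// mulr_gt0.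
by rewrite subr_gt0 -natrM ltr1n mulnS.
Qed.

Lemma delta_gt0 : 0 < delta.
Proof.
by rewrite mulr_gt0 ?c_d_gt0// divr_gt0 ?ln_gt0 ?ltr1n// ltr0n ltnW.
Qed.

Let K := 2 ^+ n.+2 * @omega R n.+1 * L.

Let K_gt0 : 0 < K.
Proof. by apply: mulr_gt0 => //; apply: mulr_gt0; [exact: exprn_gt0|exact: omega_gt0]. Qed.

Lemma lambda_gt0 : 0 < lambda.
Proof.
apply: mulr_gt0; apply: powR_gt0; last exact: delta_gt0.
exact: K_gt0.
Qed.

(** This relation balances the two weights: it turns the bound (lambda / (4 L delta))^n for the
    kernel on F into K / ((4 L)^n lambda), of the same order 1 / lambda that concentration on a ball
    of radius lambda gives for G. *)
Lemma lambda_pow : lambda ^+ n.+1 = K * delta ^+ n.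
Proof.
have d0 := delta_gt0; have K0 := K_gt0.
have e (a b : R) : (a `^ b) ^+ n.+1 = a `^ (b * n.+1%:R).
  by rewrite -powR_mulrn ?powR_ge0// -powRrM.
rewrite /Defs.lambda -/K exprMn !e mulVf ?pnatr_eq0// powRr1 1?ltW//.
rewrite mulrBl mul1r mulVf ?pnatr_eq0// -[X in _ `^ (X - _)]natr1 addrK.
by rewrite powR_mulrn// ltW.
Qed.

Lemma measurable_near_pairs : measurable (near_pairs L r N E).
Proof.
have me f : measurable_fun setT f -> measurable_fun setT (fun p : V * V => enorm (f p)).
  exact: measurable_enorm.
rewrite (_ : near_pairs _ _ _ _ = ((E `\` oball r) `*` (oball r `\` E)) `&`
   ((fun p : V * V => enorm p.1) @^-1` `]-oo, r + delta]%classic `&`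
    (fun p : V * V => enorm p.2) @^-1` `]r - delta, +oo[%classic)); last first.
  apply/seteqP; split => p; rewrite /near_pairs/= !in_itv/= ?andbT.
    by case=> ? ? ? ?.
  by case=> -[? ?] [? ?].
apply: measurableI; first by apply: measurableX; exact: measurableD.
apply: measurableI; rewrite -[X in measurable X]setTI; exact: me.
Qed.

Lemma measurable_FG : measurable Fset /\ measurable Gset.
Proof.
have mu B : measurable B -> measurable (@u R n.+1 @^-1` B).
  by move=> mB'; rewrite -[X in measurable X]setTI; exact: measurable_u.
by split; apply: measurableI; try exact: measurable_near_pairs; apply: mu => //;
  exact: measurableC.
Qed.

Lemma sub_pairs_fin Q : measurable Q -> Q `<=` (E `\` oball r) `*` (oball r `\` E) ->
  (m \x m)%E Q = (vol2 Q)%:E /\ vol2 Q <= outer r ^+ 2.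
Proof.
move=> mQ QS; have mA : measurable (E `\` oball r) by exact: measurableD.
have mH : measurable (oball r `\` E) by exact: measurableD.
have le : ((m \x m)%E Q <= (outer r ^+ 2)%:E)%E.
  have -> : (outer r ^+ 2)%:E = (m \x m)%E ((E `\` oball r) `*` (oball r `\` E)).
    by rewrite product_measure1E//= (outerE mE EL) innerE// (inner_r mE EL mr) -EFinM.
  by apply: le_measure => //; rewrite inE//; exact: measurableX.
have fin : (m \x m)%E Q \is a fin_num.
  by rewrite ge0_fin_numE// (le_lt_trans le)// ltry.
by rewrite vol2E// fineK// -lee_fin fineK.
Qed.

Lemma near_pairs_sub : near_pairs L r N E `<=` (E `\` oball r) `*` (oball r `\` E).
Proof. by move=> p []. Qed.

Definition wg z : R := weight L r N E z * gain r E z.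

Lemma weight_ge0 z : 0 <= weight L r N E z.
Proof. by rewrite mulr_ge0 ?riesz_ge0//; case: ifPn. Qed.

Lemma wg_ge0 z : 0 <= wg z.
Proof. by rewrite mulr_ge0 ?weight_ge0// (gain_ge0 mE EL). Qed.

Lemma measurable_gain : measurable_fun setT (gain r E).
Proof.
rewrite (_ : gain r E = fun z => fine (m (moved r E z))); last first.
  by apply/funext => z; exact: gainE mE EL _.
apply: measurableT_comp => //.
apply: (@measurable_moved_joint _ _ _ V r (fun=> E) id) => //.
have ms : measurable_fun setT (snd : V * V -> V) by exact: measurable_snd.
by have := ms measurableT _ mE; rewrite setTI.
Qed.

Lemma measurable_weight : measurable_fun setT (weight L r N E).
Proof.
apply: measurable_funM; first exact: measurable_riesz.
by case: (vol2 Gset < vol2 Fset); apply: measurable_indic => //; exact: measurableC.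
Qed.

(** The kernel has mass at most C0 a on a ball of radius a, by [integral_riesz_oball]. *)
Definition C0 : R := 2 * 2 ^+ n.+1 * ball_vol (R:=R) n.+1.

Lemma C0_gt0 : 0 < C0.
Proof. by rewrite !mulr_gt0 ?exprn_gt0 ?ball_vol_gt0. Qed.

Lemma vol2_split : vol2 (Fset `|` Gset) <= vol2 Fset + vol2 Gset.
Proof.
have [mF mG] := measurable_FG.
have sF : Fset `<=` (E `\` oball r) `*` (oball r `\` E).
  by move=> p [/near_pairs_sub].
have sG : Gset `<=` (E `\` oball r) `*` (oball r `\` E).
  by move=> p [/near_pairs_sub].
have mU := measurableU _ _ mF mG.
rewrite -lee_fin EFinD -(sub_pairs_fin mU _).1; last by rewrite subUset.
rewrite -(sub_pairs_fin mF sF).1 -(sub_pairs_fin mG sG).1.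
exact: measureU2.
Qed.

(* Pairs in F have their points at distance at most 4 L delta / lambda. *)
Lemma riesz_F x y : Fset (x, y) -> K / ((4 * L) ^+ n * lambda) <= riesz (y - x).
Proof.
move=> [[/= Ax Hy xd yd]]; rewrite /oball/= => /negP; rewrite -leNgt => lu.
have [yx0 yx2 yx xL] := pair_dist Ax Hy.
have l0 := lambda_gt0; have d0 := delta_gt0.
have xy : enorm (y - x) <= 4 * L * delta / lambda.
  rewrite ler_pdivlMr// mulrC.
  apply: (@le_trans _ _ (enorm (u (x, y)) * enorm (y - x))).
    by rewrite ler_wpM2r// ltW.
  rewrite enorm_uM distrC -!sqr_enorm ger0_norm; last first.
    by rewrite subr_ge0 lerXn2r ?nnegrE ?enorm_ge0 1?ltW.
  rewrite subr_sqr.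
  have h1 : enorm x - enorm y <= 2 * delta by lra.
  have h2 : enorm x + enorm y <= 2 * L by lra.
  have h3 := enorm_ge0 x; have h4 := enorm_ge0 y.
  by rewrite (_ : 4 * L * delta = 2 * delta * (2 * L)) ?ler_pM//; lra || ring.
apply: le_trans (riesz_ge yx0 xy).
have KE : K = lambda ^+ n * lambda / delta ^+ n.
  by rewrite -exprSr lambda_pow mulfK// expf_neq0// gt_eqF.
have a0 : lambda ^+ n != 0 by rewrite expf_neq0// gt_eqF.
have b0 : delta ^+ n != 0 by rewrite expf_neq0// gt_eqF.
have e0 : (4 * L) ^+ n != 0 by rewrite expf_neq0// gt_eqF// mulr_gt0.
rewrite KE expr_div_n (exprMn n (4 * L) delta); move: l0; move: (lambda ^+ n) (delta ^+ n) ((4 * L) ^+ n) lambda a0 b0 e0.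
move=> a b e l a0 b0 e0 l0; rewrite le_eqVlt; apply/orP; left; apply/eqP; field.
by rewrite a0 b0 e0 gt_eqF.
Qed.

(** The smaller of the two values of lambda c / Wb that arise in [weighted_mass]. *)
Definition c1 : R := Num.min (K / (8 * (4 * L) ^+ n * C0 * L)) ((2 * L) ^- n / (4 * C0)).

Lemma c1_gt0 : 0 < c1.
Proof.
have p4 : 0 < (4 * L) ^+ n by rewrite exprn_gt0// mulr_gt0.
have p2 : 0 < (2 * L) ^+ n by rewrite exprn_gt0// mulr_gt0.
have C00 := C0_gt0; rewrite /c1 lt_min; apply/andP; split; apply: divr_gt0.
- exact: K_gt0.
- by apply: mulr_gt0 => //; apply: mulr_gt0 => //; exact: mulr_gt0.
- by rewrite invr_gt0.
- exact: mulr_gt0.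
Qed.

Lemma measurable_wg : measurable_fun setT wg.
Proof. by apply: measurable_funM; [exact: measurable_weight|exact: measurable_gain]. Qed.

Let wgE (h : V -> R) : weight L r N E = (fun z => riesz z * h z) ->
  (\int[m]_z (wg z)%:E)%E = (\int[m]_z ((h z)%:E * m (moved r E z) * (riesz z)%:E))%E.
Proof.
move=> wE; apply: eq_integral => z _; rewrite /wg wE (moved_fin mE EL) -(gainE mE EL).
by rewrite -!EFinM; congr (_%:E); ring.
Qed.

(** The weight of case F has infinite mass at infinity; its part in [oball (2 * L)] is the one that
    matters, the gain being 0 beyond. *)
Let trunc (h : V -> R) (a : R) : (forall z, 0 <= h z) ->
  measurable_fun setT h -> weight L r N E = (fun z => riesz z * h z) ->
  (forall z, h z * \1_(oball (2 * L)) z <= \1_(oball a) z) -> 0 <= a ->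
  (\int[m]_z (weight L r N E z * \1_(oball (2 * L)) z)%:E <= (C0 * a)%:E)%E.
Proof.
move=> h0 mh wE ha a0; apply: le_trans (integral_riesz_oball n a0).
apply: ge0_le_integral => //.
- by move=> z _; rewrite lee_fin mulr_ge0// weight_ge0.
- apply/measurable_EFinP; apply: measurable_funM; first exact: measurable_weight.
  exact: measurable_indic.
- apply/measurable_EFinP; apply: measurable_funM; last exact: measurable_riesz.
  exact: measurable_indic.
- by move=> z _; rewrite wE lee_fin -mulrA mulrC ler_wpM2r ?riesz_ge0.
Qed.

(* Both alternatives give mass of order X^2 / lambda per unit of kernel: for F
   the pairs are close, which makes the kernel large; for G the law is
   concentrated on a small ball. *)
Lemma weighted_mass : weighted_case L r N E ->
  exists Wb c : R, [/\ 0 < Wb, 0 < c,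
    (\int[m]_z (weight L r N E z * \1_(oball (2 * L)) z)%:E <= Wb%:E)%E,
    ((c * outer r ^+ 2)%:E <= \int[m]_z (wg z)%:E)%E &
    c1 / lambda <= c / Wb].
Proof.
case/and3P => _ _; rewrite (excessE mE) => XFG; have := le_trans XFG vol2_split.
have l0 := lambda_gt0; have C00 := C0_gt0; have [mF mG] := measurable_FG.
have sF : Fset `<=` (E `\` oball r) `*` (oball r `\` E).
  by move=> p [/near_pairs_sub].
have sG : Gset `<=` (E `\` oball r) `*` (oball r `\` E).
  by move=> p [/near_pairs_sub].
have p4 : 0 < (4 * L) ^+ n by rewrite exprn_gt0// mulr_gt0.
have p2 : 0 < (2 * L) ^+ n by rewrite exprn_gt0// mulr_gt0.
(* The larger of F and G has volume at least X^2 / 4, which explains the division by 4 in both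
   values of c. *)
have [FG XX|GF XX] := ltP (vol2 Gset) (vol2 Fset).
- pose h z : R := \1_(~` oball lambda) z.
  have mh : measurable_fun setT h by apply: measurable_indic; exact: measurableC.
  have h0 z : 0 <= h z by [].
  have wE : weight L r N E = (fun z => riesz z * h z).
    by apply/funext => z; rewrite /weight FG.
  exists (C0 * (2 * L)), (K / ((4 * L) ^+ n * lambda) / 4); split.
  + by apply: mulr_gt0 => //; exact: mulr_gt0.
  + by apply: divr_gt0 => //; apply: divr_gt0 => //; exact: mulr_gt0.
  + apply: (trunc h0 mh wE); last by rewrite mulr_ge0// ltW.
    by move=> z; rewrite -[leRHS]mul1r ler_wpM2r// /h indicE; case: (_ \in _).
  + rewrite (wgE wE); apply: le_trans (interaction (c := K / ((4 * L) ^+ n * lambda)) mE mh h0 mF _ _).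
    * rewrite (sub_pairs_fin mF sF).1 -EFinM lee_fin -mulrA ler_wpM2l//; last by lra.
      by rewrite divr_ge0// ltW// mulr_gt0.
    * by rewrite divr_ge0// ltW// mulr_gt0.
    * move=> x y xyF; have [[/= Ax Hy _ _] ul] := xyF; split => //.
      by rewrite /h indicE mem_set// mul1r; exact: riesz_F.
  + apply: (@le_trans _ _ (K / (8 * (4 * L) ^+ n * C0 * L) / lambda)).
      by rewrite ler_wpM2r ?invr_ge0 ?(ltW l0)// /c1 ge_min lexx.
    move: p4 C00 l0; move: ((4 * L) ^+ n) C0 lambda => a C l a0 C0' l0.
    rewrite le_eqVlt; apply/orP; left; apply/eqP; field.
    by rewrite !gt_eqF.
- pose h z : R := \1_(oball lambda) z.
  have mh : measurable_fun setT h by apply: measurable_indic.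
  have h0 z : 0 <= h z by [].
  have wE : weight L r N E = (fun z => riesz z * h z).
    by apply/funext => z; rewrite /weight ltNge GF.
  exists (C0 * lambda), ((2 * L) ^- n / 4); split.
  + exact: mulr_gt0.
  + by apply: divr_gt0 => //; rewrite invr_gt0.
  + apply: (trunc h0 mh wE); last exact: ltW.
    by move=> z; rewrite -[leRHS]mulr1 ler_wpM2l// indicE; case: (_ \in _).
  + rewrite (wgE wE); apply: le_trans (interaction (c := (2 * L) ^- n) mE mh h0 mG _ _).
    * rewrite (sub_pairs_fin mG sG).1 -EFinM lee_fin -mulrA ler_wpM2l//; last by lra.
      by rewrite invr_ge0 ltW.
    * by rewrite invr_ge0 ltW.
    * move=> x y xyG; have [[/= Ax Hy _ _] ul] := xyG; split => //.
      have [yx0 yx2 _ _] := pair_dist Ax Hy.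
      by rewrite /h indicE mem_set// mul1r; exact: riesz_ge.
  + apply: (@le_trans _ _ ((2 * L) ^- n / (4 * C0) / lambda)).
      by rewrite ler_wpM2r ?invr_ge0 ?(ltW l0)// /c1 ge_min lexx orbT.
    move: p2 C00 l0; move: ((2 * L) ^+ n) C0 lambda => a C l a0 C0' l0.
    rewrite le_eqVlt; apply/orP; left; apply/eqP; field.
    by rewrite !gt_eqF.
Qed.

End expected_gain.

(** * The one-step law and the expected gain *)

Section one_step_law.
Context {R : realType} {n : nat}.
Local Notation V := 'rV[R]_n.+1.
Local Notation m := (@lebesgue_rV R n.+1).
Implicit Types (x y z : V).

Context (L r : R) (E : set V) (L0 : 0 < L) (r0 : 0 <= r) (mE : measurable E)
  (EL : forall x, E x -> enorm x <= L)
  (mr : m (oball r) = m E) (N : nat).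

Let mB s : measurable (oball s : set V) := @measurable_oball R n.+1 s.

Local Notation outer := (@outer R n E).
Local Notation inner := (@inner R n E).
Local Notation wg := (@wg R n L r E N).

Definition dens z : R :=
  if weighted_case L r N E then wg z / fine (\int[m]_z (wg z)%:E)%E
  else (2 * L * @omega R n.+1)^-1 * (riesz z * \1_(oball (2 * L)) z).

Let cut z := riesz z * \1_(oball (2 * L)) z.

Let mcut : measurable_fun setT cut.
Proof. by apply: measurable_funM; [exact: measurable_riesz|exact: measurable_indic]. Qed.

Let cut_ge0 z : 0 <= cut z. Proof. by rewrite mulr_ge0// riesz_ge0. Qed.

Let integral_cut : (\int[m]_z (cut z)%:E <= (C0 (n:=n) * (2 * L))%:E)%E.
Proof.
have L2 : 0 <= 2 * L by rewrite mulr_ge0// ltW.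
have := integral_riesz_oball n L2.
by under eq_integral do rewrite muleC -EFinM.
Qed.

Lemma wg_le z : wg z <= outer r * cut z.
Proof.
rewrite /wg /cut; have [z2|z2] := pselect (oball (2 * L) z); last first.
  by rewrite (gain_far L0 mE EL z2) mulr0 mulr_ge0 ?outer_ge0//; exact: cut_ge0.
rewrite indicE mem_set// mulr1 mulrC; apply: ler_pM.
- exact: gain_ge0 mE EL _.
- exact: weight_ge0.
- exact: gain_le mE EL _.
- by rewrite /weight -[leRHS]mulr1 ler_wpM2l ?riesz_ge0//; case: ifPn; rewrite indicE; case: (_ \in _).
Qed.

Lemma integral_wg_fin : (\int[m]_z (wg z)%:E < +oo)%E.
Proof.
apply: (@le_lt_trans _ _ ((outer r)%:E * \int[m]_z (cut z)%:E)%E).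
  rewrite -ge0_integralZl_EFin//; last 3 first.
  - by move=> z _; rewrite lee_fin.
  - exact/measurable_EFinP.
  - exact: outer_ge0.
  apply: ge0_le_integral => //.
  - by move=> z _; rewrite lee_fin wg_ge0.
  - apply/measurable_EFinP; exact: measurable_wg.
  - by apply/measurable_EFinP; apply: measurable_funM.
  - by move=> z _; rewrite -EFinM lee_fin wg_le.
apply: (@le_lt_trans _ _ ((outer r)%:E * (C0 (n:=n) * (2 * L))%:E)%E).
  by rewrite lee_wpmul2l// lee_fin outer_ge0.
by rewrite -EFinM ltry.
Qed.

Let I := fine (\int[m]_z (wg z)%:E)%E.

Let I_ge0 : 0 <= I.
Proof. by apply/fine_ge0/integral_ge0 => z _; rewrite lee_fin wg_ge0. Qed.

Let norm_ge0 : 0 <= (2 * L * @omega R n.+1)^-1.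
Proof.
by rewrite invr_ge0 ltW//; apply: mulr_gt0; [exact: mulr_gt0|exact: omega_gt0].
Qed.

Lemma dens_ge0 z : 0 <= dens z.
Proof.
rewrite /dens; case: ifPn => _; first by rewrite divr_ge0// wg_ge0.
by apply: mulr_ge0; [exact: norm_ge0|exact: cut_ge0].
Qed.

(** [step_law] is built from real-valued integrals, which agree with the extended ones only when
    those are finite; [wg_le] and [integral_cut] provide this. *)
Lemma step_lawE B : measurable B ->
  (step_law L r N E B)%:E = (\int[m]_(z in B) (dens z)%:E)%E.
Proof.
move=> mB0; have sub (f : V -> R) : measurable_fun setT f -> (forall z, 0 <= f z) ->
    (\int[m]_z (f z)%:E < +oo)%E -> (\int[m]_(z in B) (f z)%:E)%E \is a fin_num.
  move=> mf f0 foo; rewrite ge0_fin_numE; last by apply: integral_ge0 => z _; rewrite lee_fin.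
  apply: le_lt_trans foo; apply: ge0_subset_integral => //.
  - exact/measurable_EFinP.
  - by move=> z _; rewrite lee_fin.
have mwg := measurable_wg r mE EL N.
rewrite /step_law /dens; case: (weighted_case L r N E).
  rewrite /Rintegral -/(wg) -/I mulrC.
  under [RHS]eq_integral do rewrite mulrC EFinM.
  rewrite ge0_integralZl_EFin//.
  - rewrite EFinM; congr (_ * _)%E; rewrite fineK//.
    by apply: (sub _ mwg) => [z|]; [exact: wg_ge0|exact: integral_wg_fin].
  - by move=> z _; rewrite lee_fin wg_ge0.
  - by apply/measurable_EFinP; exact: measurable_funS mwg.
  - by rewrite invr_ge0.
under [RHS]eq_integral do rewrite EFinM.
rewrite ge0_integralZl_EFin//.
- rewrite EFinM; congr (_ * _)%E; rewrite /Rintegral fineK//.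
  apply: (sub _ mcut cut_ge0); apply: le_lt_trans integral_cut _; exact: ltry.
- by move=> z _; rewrite lee_fin; exact: cut_ge0.
- by apply/measurable_EFinP; exact: measurable_funS mcut.
Qed.

(* Cauchy-Schwarz, in the form w g^2 + t^2 w >= 2 t w g with t = I / Wb. *)
Lemma weighted_gain : (1 < N)%N -> weighted_case L r N E ->
  ((c1 (n:=n) L / lambda (d:=n.+1) L N * outer r ^+ 2)%:E <=
   \int[m]_z (gain r E z * dens z)%:E)%E.
Proof.
move=> N1 W; have [Wb [c [Wb0 c0 wWb cI c1c]]] := weighted_mass L0 mE EL mr N1 W.
have IE : (\int[m]_z (wg z)%:E = I%:E)%E.
  rewrite /I fineK// ge0_fin_numE ?integral_wg_fin//.
  by apply: integral_ge0 => z _; rewrite lee_fin wg_ge0.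
have cI' : c * outer r ^+ 2 <= I by rewrite -lee_fin -IE.
have X0 : 0 < outer r.
  case/and3P : W => _ + _; rewrite (excessE mE) => X0.
  by rewrite lt_def X0 outer_ge0.
have Ip : 0 < I by rewrite (lt_le_trans _ cI')// mulr_gt0// exprn_gt0.
have mg := measurable_gain r mE EL; have mw := measurable_weight L r E N.
have mwg := measurable_wg r mE EL N.
pose t := I / Wb.
pose J := (\int[m]_z (wg z * gain r E z)%:E)%E.
have J_ge : ((2 * t * I)%:E <= J + (t ^+ 2 * Wb)%:E)%E.
  rewrite EFinM -IE -ge0_integralZl_EFin//; last 3 first.
  - by move=> z _; rewrite lee_fin wg_ge0.
  - exact/measurable_EFinP.
  - by rewrite mulr_ge0// divr_ge0// ltW.
  apply: (@le_trans _ _ (J + (t ^+ 2)%:E * \int[m]_z (weight L r N E z * \1_(oball (2 * L)) z)%:E)%E); last first.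
    by rewrite leeD2l// EFinM lee_wpmul2l// lee_fin sqr_ge0.
  have m2 : measurable_fun setT (fun z => weight L r N E z * \1_(oball (2 * L)) z).
    by apply: measurable_funM => //; exact: measurable_indic.
  rewrite -ge0_integralZl_EFin//; last 3 first.
  - by move=> z _; rewrite lee_fin mulr_ge0// weight_ge0.
  - exact/measurable_EFinP.
  - exact: sqr_ge0.
  rewrite /J -ge0_integralD//; last 4 first.
  - by move=> z _; rewrite lee_fin mulr_ge0 ?wg_ge0// (gain_ge0 mE EL).
  - by apply/measurable_EFinP; exact: measurable_funM.
  - by move=> z _; rewrite -EFinM lee_fin mulr_ge0 ?sqr_ge0// mulr_ge0// weight_ge0.
  - by apply/measurable_EFinP; exact: measurable_funM.
  apply: ge0_le_integral => //.
  - by move=> z _; rewrite -EFinM lee_fin mulr_ge0 ?wg_ge0// mulr_ge0// divr_ge0// ltW.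
  - by apply/measurable_EFinP; exact: measurable_funM.
  - by apply/measurable_EFinP; apply: measurable_funD; exact: measurable_funM.
  move=> z _; rewrite -!EFinM -EFinD lee_fin /wg.
  (* Outside [oball (2 * L)] the gain is 0, so the term t^2 w is wanted only inside, where the
     weight has finite mass. *)
  have [z2|z2] := pselect (oball (2 * L) z); last first.
    by rewrite (gain_far L0 mE EL z2) !(mulr0, mul0r) add0r mulr_ge0 ?sqr_ge0// mulr_ge0// weight_ge0.
  rewrite indicE mem_set// mulr1.
  have := mulr_ge0 (weight_ge0 L r E N z) (sqr_ge0 (gain r E z - t)).
  by move: (weight _ _ _ _ _) (gain _ _ _) => w g; lra.
have -> : (\int[m]_z (gain r E z * dens z)%:E = (I^-1)%:E * J)%E.
  rewrite /J -ge0_integralZl_EFin//.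
  - by apply: eq_integral => z _; rewrite /dens W -/I -EFinM; congr (_%:E); ring.
  - by move=> z _; rewrite lee_fin mulr_ge0 ?wg_ge0// (gain_ge0 mE EL).
  - by apply/measurable_EFinP; exact: measurable_funM.
  - by rewrite invr_ge0.
have c1I : c1 (n:=n) L / lambda (d:=n.+1) L N * outer r ^+ 2 <= I / Wb.
  apply: (@le_trans _ _ (c / Wb * outer r ^+ 2)); first by rewrite ler_wpM2r// sqr_ge0.
  by rewrite mulrAC ler_wpM2r// invr_ge0 ltW.
have J0 : (0 <= J)%E.
  apply: integral_ge0 => z _.
  by rewrite lee_fin mulr_ge0 ?wg_ge0// (gain_ge0 mE EL).
move: J_ge J0; case: J => [j| |]//; last by rewrite gt0_muley ?leey// lte_fin invr_gt0.
rewrite -EFinD -EFinM !lee_fin => h _; apply: (le_trans c1I).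
rewrite [leRHS]mulrC ler_pdivlMr//; move: h; rewrite /t.
have -> : 2 * (I / Wb) * I = I / Wb * I + I / Wb * I by ring.
have -> : (I / Wb) ^+ 2 * Wb = I / Wb * I by field; rewrite gt_eqF.
by lra.
Qed.

Definition c2 : R := (2 * L * @omega R n.+1)^-1 * (2 * L) ^- n.

(** In this case the density is the kernel itself, whatever the state, so [far_interaction] applies
    at every radius s and not only at r. *)
Lemma unweighted_gain s : ~~ weighted_case L r N E ->
  ((c2 * (outer s * inner s))%:E <=
   \int[m]_z (fine (m (moved s E z)) * dens z)%:E)%E.
Proof.
move=> W; rewrite /c2 -(mulrA (2 * L * omega)^-1) EFinM.
have n0 : (0 <= ((2 * L * @omega R n.+1)^-1)%:E)%E by rewrite lee_fin.
apply: (le_trans (lee_wpmul2l n0 (far_interaction L0 mE EL s))).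
have mm : measurable_fun setT (fun z => fine (m (moved s E z))).
  apply: measurableT_comp => //.
  apply: (@measurable_moved_joint _ _ _ V s (fun=> E) id) => //.
  have ms : measurable_fun setT (snd : V * V -> V) by exact: measurable_snd.
  by have := ms measurableT _ mE; rewrite setTI.
rewrite -ge0_integralZl_EFin//.
- rewrite le_eqVlt; apply/orP; left; apply/eqP; apply: eq_integral => z _.
  by rewrite /dens (negbTE W) (moved_fin mE EL) -!EFinM; congr (_%:E); ring.
- by move=> z _; rewrite !mule_ge0// lee_fin// riesz_ge0.
- apply: emeasurable_funM; last by apply/measurable_EFinP; exact: measurable_riesz.
  apply: emeasurable_funM; first by apply/measurable_EFinP; exact: measurable_indic.
  apply: (@measurable_moved_joint _ _ _ V s (fun=> E) id) => //.
  have ms : measurable_fun setT (snd : V * V -> V) by exact: measurable_snd.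
  by have := ms measurableT _ mE; rewrite setTI.
Qed.

(** A pair that is not near has its outer point beyond r + h or its inner point within r - h. So X^2
    is at most the volume of the near pairs, here less than X^2 / 2, plus X (outer (r + h) + inner
    (r - h)). *)
Lemma unweighted_excess (h : R) : (1 < N)%N -> ~~ weighted_case L r N E ->
  0 < h -> h < delta (d:=n.+1) L N -> outer r <= 2 * (outer (r + h) + inner (r - h)).
Proof.
move=> N1; rewrite /weighted_case N1 (excessE mE)/= negb_and negbK.
have [X0 _ _ _|X0 /=] := eqVneq (outer r) 0.
  rewrite X0; apply: mulr_ge0 => //.
  by apply: addr_ge0; [exact: outer_ge0|exact: inner_ge0].
rewrite -ltNge => far h0 hd.
have Xp : 0 < outer r by rewrite lt_def X0 outer_ge0.
pose A := E `\` oball r; pose H := oball r `\` E.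
have mA : measurable A by exact: measurableD.
have mH : measurable H by exact: measurableD.
have mA' : measurable (E `\` oball (r + h)) by exact: measurableD.
have mH' : measurable (oball (r - h) `\` E) by exact: measurableD.
have FGE : F_set L r N E `|` G_set L r N E = near_pairs L r N E.
  by rewrite /F_set /G_set -setIUr -preimage_setU setUC setUv preimage_setT setIT.
rewrite FGE in far.
have mN := measurable_near_pairs L r mE N.
have cover : A `*` H `<=` near_pairs L r N E `|`
    (((E `\` oball (r + h)) `*` H) `|` (A `*` (oball (r - h) `\` E))).
  move=> [x y] /= [Ax Hy].
  have [xd|xd] := leP (enorm x) (r + delta (d:=n.+1) L N); last first.
    right; left; split => //=; split; first by case: Ax.
    by rewrite /oball/= => /(lt_trans xd); lra.
  have [yd|yd] := ltP (r - delta (d:=n.+1) L N) (enorm y); first by left.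
  right; right; split => //=; split; last by case: Hy.
  by rewrite /oball/= (le_lt_trans yd)//; lra.
have XX : ((outer r * outer r)%:E <= (vol2 (near_pairs L r N E))%:E +
    ((outer (r + h) * outer r)%:E + (outer r * inner (r - h))%:E))%E.
  have p1 : ((m \x m) (A `*` H) = (outer r * outer r)%:E)%E.
    by rewrite product_measure1E//= (outerE mE EL) innerE// (inner_r mE EL mr).
  have p2 : ((m \x m) ((E `\` oball (r + h)) `*` H) = (outer (r + h) * outer r)%:E)%E.
    by rewrite product_measure1E//= (outerE mE EL) innerE// (inner_r mE EL mr).
  have p3 : ((m \x m) (A `*` (oball (r - h) `\` E)) = (outer r * inner (r - h))%:E)%E.
    by rewrite product_measure1E//= (outerE mE EL) innerE.
  rewrite -p1 -p2 -p3 -(sub_pairs_fin mE EL mr mN (@near_pairs_sub _ _ _ _ _ _)).1.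
  have m2 : measurable ((E `\` oball (r + h)) `*` H) by exact: measurableX.
  have m3 : measurable (A `*` (oball (r - h) `\` E)) by exact: measurableX.
  apply: (@le_trans _ _ ((m \x m)%E (near_pairs L r N E `|`
    (((E `\` oball (r + h)) `*` H) `|` (A `*` (oball (r - h) `\` E)))))).
    apply: le_measure => //; rewrite inE; first exact: measurableX.
    by apply: measurableU => //; exact: measurableU.
  apply: le_trans (measureU2 _ mN (measurableU _ _ m2 m3)) _.
  by rewrite leeD2l// measureU2.
move: XX; rewrite -!EFinD lee_fin => XX.
rewrite -(ler_pM2l Xp); nra.
Qed.

End one_step_law.

(** * Conditioning on the state *)

Section layer_cake.
Context {R : realType} {dS : measure_display} {S : measurableType dS}.
Local Notation leb1 := (@lebesgue_measure R).

Lemma integral_indicE (mu : {measure set S -> \bar R}) (D : set S) (h : S -> R) :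
  (\int[mu]_(s in D) (h s)%:E = \int[mu]_s (h s * \1_D s)%:E)%E.
Proof.
rewrite integral_mkcond; apply: eq_integral => s _.
by rewrite patchE indicE; case: ifPn; rewrite ?mulr1 ?mulr0.
Qed.

(** Tonelli on the region under the graph of g. The purpose is to reduce an identity between
    integrals to level sets, on which the hypothesis [law] can be used. *)
Lemma layer_cake (mu : {sigma_finite_measure set S -> \bar R}) (g h : S -> R) :
  measurable_fun setT g -> measurable_fun setT h ->
  (forall s, 0 <= g s) -> (forall s, 0 <= h s) ->
  (\int[mu]_s (g s * h s)%:E =
   \int[leb1]_t \int[mu]_(s in [set s | (0 <= t < g s)%R]) (h s)%:E)%E.
Proof.
move=> mg mh g0 h0.
pose C : set (S * measurableTypeR R) := [set p | 0 <= p.2 < g p.1].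
have mC : measurable C.
  rewrite (_ : C = (fun p : S * measurableTypeR R => 0 <= p.2) @^-1` [set true] `&`
      (fun p : S * measurableTypeR R => p.2 < g p.1) @^-1` [set true]); last first.
    by apply/seteqP; split => p /=; rewrite /C/=; [move=> /andP[-> ->]|move=> [-> ->]].
  apply: measurableI; rewrite -[X in measurable X]setTI.
    by apply: measurable_fun_ler.
  by apply: measurable_fun_ltr => //; exact: (measurableT_comp mg).
have mF : measurable_fun setT (fun p : S * measurableTypeR R => (h p.1 * \1_C p)%:E).
  apply/measurable_EFinP; apply: measurable_funM; last exact: measurable_indic.
  exact: (measurableT_comp mh).
have F0 p : (0 <= (h p.1 * \1_C p)%:E)%E by rewrite lee_fin mulr_ge0.
transitivity (\int[mu]_s \int[leb1]_t (h s * \1_C (s, t))%:E)%E.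
  apply: eq_integral => s _; under [RHS]eq_integral do rewrite EFinM.
  rewrite ge0_integralZl_EFin//; last first.
    apply/measurable_EFinP.
    apply: (measurableT_comp (g := fun t : measurableTypeR R => (s, t)) (measurable_indic mC)).
    exact: measurable_fun_pair.
  rewrite (_ : (fun t => (\1_C (s, t))%:E) = (fun t => (\1_(`[0, g s[%classic : set R) t)%:E)); last first.
    apply/funext => t; rewrite !indicE.
    have -> : ((s, t) \in C) = (t \in (`[0, g s[%classic : set R)) by apply/idP/idP => /set_mem tC; apply/mem_set; move: tC; rewrite /C/= in_itv/=.
    by [].
  rewrite integral_indic// setIT /= lebesgue_measure_itv/= lte_fin.
  case: ltP => gs; first by rewrite oppr0 addr0 -EFinM mulrC.
  by rewrite (_ : g s = 0) ?mul0r ?mule0//; apply/eqP; rewrite eq_le gs g0.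
apply: (eq_trans (fubini_tonelli (m1 := mu) (m2 := leb1) _ mF F0)).
apply: eq_integral => t _; rewrite [RHS]integral_indicE.
apply: eq_integral => s _ /=; rewrite !indicE.
have -> : ((s, t) \in C) = (s \in [set s | 0 <= t < g s]) by apply/idP/idP; rewrite !inE.
by [].
Qed.

End layer_cake.

Section sigma_finite_product.
Context {d1 d2 : measure_display} {T1 : measurableType d1} {T2 : measurableType d2}
  {R : realType} (m1 : {sigma_finite_measure set T1 -> \bar R})
  (m2 : {sigma_finite_measure set T2 -> \bar R}).
Local Open Scope ereal_scope.

(** The product measure under a name that carries sigma-finiteness, which [layer_cake] and
    [measurable_section_measure] ask of their measure. *)
Definition prodm : set (T1 * T2) -> \bar R := m1 \x m2.

HB.instance Definition _ := Measure.copy prodm (m1 \x m2).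

Let prodm_sigma_finite : sigma_finite setT prodm.
Proof.
have /sigma_finiteP[F [TF ndF Foo]] := sigma_finiteT m1.
have /sigma_finiteP[G [TG ndG Goo]] := sigma_finiteT m2.
exists (fun n => F n `*` G n).
  apply/esym/seteqP; split => // -[x y] _.
  have [i _ Fi] : (\bigcup_i F i) x by rewrite -TF.
  have [j _ Gj] : (\bigcup_i G i) y by rewrite -TG.
  exists (maxn i j) => //; split => /=.
    by move: Fi; apply/subsetPset/ndF/leq_maxl.
  by move: Gj; apply/subsetPset/ndG/leq_maxr.
move=> k; have [mF Fk] := Foo k; have [mG Gk] := Goo k.
split; first exact: measurableX.
by rewrite /prodm product_measure1E// lte_mul_pinfty// ge0_fin_numE.
Qed.

HB.instance Definition _ := Measure_isSigmaFinite.Build _ _ _ prodm prodm_sigma_finite.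

End sigma_finite_product.

(** * From the law on rectangles to functionals of state and reflection *)

Section conditional_law.
Context {R : realType} {d : nat} {dT : measure_display} {T : measurableType dT}
  (P : probability T R).
Local Notation V := 'rV[R]_d.
Local Notation m := (@lebesgue_rV R d).
Local Notation leb1 := (@lebesgue_measure R).

Context (zeta : T -> V) (k f : T * V -> R) (DD : set (set T)) (M : R)
  (mzeta : measurable_fun setT zeta) (zeta0 : forall w, zeta w != 0)
  (mk : measurable_fun setT k) (k0 : forall p, 0 <= k p)
  (k00 : forall w, k (w, 0) = 0)
  (mDD : forall D, DD D -> measurable D)
  (law : forall D B, DD D -> measurable B ->
     (P (D `&` zeta @^-1` B) = \int[P]_(w in D) \int[m]_(x in B) (k (w, x))%:E)%E)
  (mf : measurable_fun setT f) (f0 : forall p, 0 <= f p) (fM : forall p, f p <= M)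
  (fDD : forall x t, DD [set w | t < f (w, x)])
  (cf : forall w (x : V) (xs : nat -> V), x != 0 ->
     (forall i, (fun j => xs j ord0 i) @ \oo --> x ord0 i) ->
     (fun j => f (w, xs j)) @ \oo --> f (w, x)).

Let cell (K : nat) (q : 'rV[int]_d) : set V :=
  [set x | forall i, (q ord0 i)%:~R <= K.+1%:R * x ord0 i < (q ord0 i + 1)%:~R].

Let node (K : nat) (q : 'rV[int]_d) : V := \row_i ((q ord0 i)%:~R / K.+1%:R).

Let idx (K : nat) (x : V) : 'rV[int]_d := \row_i Num.floor (K.+1%:R * x ord0 i).

Let cell_idx K q x : cell K q x <-> idx K x = q.
Proof.
split => [h|<- i]; last by rewrite mxE floor_itv.
by apply/rowP => i; rewrite mxE; apply: floor_def; exact: h.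
Qed.

Let measurable_cell K q : measurable (cell K q).
Proof.
rewrite (_ : cell K q = \bigcap_(i in [set: 'I_d]) ((fun x : V => K.+1%:R * x ord0 i) @^-1`
    `[(q ord0 i)%:~R, (q ord0 i + 1)%:~R[%classic)); last first.
  by apply/seteqP; split => x h i => [_|]; have := h i; rewrite /= in_itv//=; apply.
apply: fin_bigcap_measurable => // i _; rewrite -[X in measurable X]setTI.
have mc : measurable_fun setT (fun x : V => K.+1%:R * x ord0 i).
  by apply: measurable_funM => //; exact: measurable_coord.
by apply: mc => //; exact: measurable_itv.
Qed.

Let fK K (p : T * V) : R := f (p.1, node K (idx K p.2)).

(** A level set of [fK] is a countable disjoint union of rectangles, one for each grid cube;
    [pickle_inv] numbers the cubes, and numbers without a cube give the empty set. *)
Let piece K t (j : nat) : set (T * V) :=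
  if (pickle_inv j : option 'rV[int]_d) is Some q
  then [set w | t < f (w, node K q)] `*` cell K q else set0.

Let pieceE K t : [set p | t < fK K p] = \bigcup_j piece K t j.
Proof.
apply/seteqP; split => [p tp|p [j _]].
  exists (pickle (idx K p.2)) => //; rewrite /piece pickleK_inv; split => //=.
  exact/cell_idx.
rewrite /piece; case: pickle_inv => // q [/= tq /cell_idx qE].
by rewrite /fK qE.
Qed.

Let measurable_piece K t j : measurable (piece K t j).
Proof.
rewrite /piece; case: pickle_inv => // q; apply: measurableX => //; exact: mDD.
Qed.

Let piece_triv K t : trivIset setT (piece K t).
Proof.
move=> i j _ _ [p []]; rewrite /piece.
have := @pickle_invK 'rV[int]_d i; have := @pickle_invK 'rV[int]_d j.
case: pickle_inv => [q|]//; case: pickle_inv => [q'|]// /= <- <-.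
by move=> [_ /cell_idx /= <-] [_ /cell_idx /= <-].
Qed.

Let mzw : measurable_fun setT (fun w => (w, zeta w)).
Proof. exact: measurable_fun_pair. Qed.

(** On each rectangle the identity is the hypothesis [law]: its first factor is a level set of f at
    a fixed grid point and so belongs to [DD]. *)
Let law_level K t : 0 <= t ->
  (P [set w | (t < fK K (w, zeta w))%R] =
   \int[P \x m]_(p in [set p | (t < fK K p)%R]) (k p)%:E)%E.
Proof.
move=> t0; rewrite pieceE ge0_integral_bigcup//; last 2 first.
- by apply/measurable_EFinP; exact: measurable_funTS.
- by move=> p _; rewrite lee_fin.
rewrite (_ : [set w | _] = \bigcup_j ((fun w => (w, zeta w)) @^-1` piece K t j)); last first.
  by rewrite -preimage_bigcup -pieceE.
have mpre j : measurable ((fun w => (w, zeta w)) @^-1` piece K t j).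
  by rewrite -[X in measurable X]setTI; exact: mzw.
rewrite measure_semi_bigcup//; last 2 first.
- by move=> i j _ _ [w [wi wj]]; exact: (piece_triv I I (ex_intro _ (w, zeta w) (conj wi wj))).
- exact: bigcup_measurable.
apply: eq_eseriesr => j _; rewrite integral_indicE.
have mkp : measurable_fun setT (fun p => (k p * \1_(piece K t j) p)%:E).
  by apply/measurable_EFinP; apply: measurable_funM => //; exact: measurable_indic.
have kp0 p : (0 <= (k p * \1_(piece K t j) p)%:E)%E by rewrite lee_fin mulr_ge0.
rewrite (fubini_tonelli1 (m1 := P) (m2 := m) _ mkp kp0) /fubini_F/=.
rewrite /piece; case: pickle_inv => [q|]; last first.
  rewrite preimage_set0 measure0; apply/esym/integral0_eq => w _.
  by apply: integral0_eq => x _; rewrite indic0 mulr0.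
set D := [set w | _].
have -> : (fun w => (w, zeta w)) @^-1` (D `*` cell K q) = D `&` zeta @^-1` cell K q.
  by apply/seteqP; split.
rewrite law; [|exact: fDD|exact: measurable_cell].
rewrite integral_mkcond; apply: eq_integral => w _; rewrite patchE.
case: ifPn => wD.
  rewrite integral_indicE; apply: eq_integral => x _ /=.
  by rewrite !indicE in_setX/= wD.
apply/esym/integral0_eq => x _ /=.
by rewrite indicE in_setX/= (negbTE wD) mulr0.
Qed.

Let measurable_fK K : measurable_fun setT (fK K).
Proof.
apply: (measurability _ (RGenOInfty.measurableE R)) => _ [_ [t ->] <-].
rewrite setTI preimage_itvoy pieceE; apply: bigcup_measurable => j _.
exact: measurable_piece.
Qed.

Let law_fK K :
  (\int[P]_w (fK K (w, zeta w))%:E = \int[P \x m]_p (fK K p * k p)%:E)%E.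
Proof.
have mfz : measurable_fun setT (fun w => fK K (w, zeta w)).
  exact: (measurableT_comp (measurable_fK K) mzw).
have fK0 p : 0 <= fK K p by exact: f0.
rewrite (layer_cake (prodm P m) (measurable_fK K) mk fK0 k0).
(* The left side is put into the form of [layer_cake] with density 1. *)
transitivity (\int[P]_w (fK K (w, zeta w) * 1)%:E)%E.
  by apply: eq_integral => w _; rewrite mulr1.
have m1 : measurable_fun [set: T] (fun=> 1 : R) by [].
rewrite (layer_cake P mfz m1 (fun=> fK0 _) (fun=> ler01)).
apply: eq_integral => t _; have [t0|t0] := leP 0 t; last first.
  rewrite (_ : [set s | _] = set0) ?integral_set0; last first.
    by apply/seteqP; split => // w /= /andP[]; rewrite leNgt t0.
  rewrite (_ : [set s | _] = set0) ?integral_set0//.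
  by apply/seteqP; split => // w /= /andP[]; rewrite leNgt t0.
have e1 : [set s | (0 <= t < fK K (s, zeta s))%R] = [set s | (t < fK K (s, zeta s))%R].
  by apply/seteqP; split => p /=; rewrite t0.
have e2 : [set p | (0 <= t < fK K p)%R] = [set p | (t < fK K p)%R].
  by apply/seteqP; split => p /=; rewrite t0.
transitivity (P [set w | (t < fK K (w, zeta w))%R]).
  transitivity (\int[P]_(w in [set s | (t < fK K (s, zeta s))%R]) 1)%E.
    by congr (integral _ _ _).
  rewrite integral_cst ?mul1e//.
  rewrite -[X in measurable X]setTI -(preimage_itvoy (fun w => fK K (w, zeta w)) t).
  exact: mfz.
by rewrite law_level//; congr (integral _ _ _).
Qed.

Let fK_cvg (w : T) (x : V) : x != 0 -> (fun K => fK K (w, x)) @ \oo --> f (w, x).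
Proof.
move=> x0.
suff h i : (fun j => node j (idx j x) ord0 i) @ \oo --> x ord0 i.
  exact: (@cf w x (fun K => node K (idx K x)) x0 h).
apply/cvgrPdist_le => e e0; near=> K.
rewrite !mxE.
have K0 : 0 < K.+1%:R :> R by rewrite ltr0n.
have /andP[] := floor_itv (K.+1%:R * x ord0 i); rewrite intrD1.
move: (_%:~R) => z h1 h2.
have -> : x ord0 i - z / K.+1%:R = (K.+1%:R * x ord0 i - z) / K.+1%:R.
  by rewrite mulrBl mulrAC divff ?mul1r// gt_eqF.
rewrite normrM ger0_norm ?subr_ge0// gtr0_norm ?invr_gt0//.
apply: (@le_trans _ _ K.+1%:R^-1).
  by rewrite ler_piMl// lerBlDl ltW.
apply: ltW; near: K.
exact: (near_infty_natSinv_lt (PosNum e0)).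
Unshelve. all: by end_near. Qed.

(* The state only determines the law of zeta on events of DD, so f is
   discretised in its second argument before the law can be applied. *)
Lemma conditional_ge :
  (\int[P \x m]_p (f p * k p)%:E <= \int[P]_w (f (w, zeta w))%:E)%E.
Proof.
have fK0 K p : 0 <= fK K p by exact: f0.
have mfz : measurable_fun setT (fun w => f (w, zeta w)).
  exact: (measurableT_comp mf mzw).
have M0 : 0 <= M by apply: le_trans (f0 (point, 0)) (fM _).
have [_ _ L] : [/\ P.-integrable setT (fun w => (f (w, zeta w))%:E),
    [sequence (\int[P]_w `|(fK K (w, zeta w))%:E - (f (w, zeta w))%:E|)%E]_K @ \oo --> 0%E
  & [sequence (\int[P]_w (fK K (w, zeta w))%:E)%E]_K @ \oo --> (\int[P]_w (f (w, zeta w))%:E)%E].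
  apply: (@dominated_convergence _ _ _ P setT measurableT _ _ (fun=> M%:E)).
  - move=> K; apply/measurable_EFinP; exact: (measurableT_comp (measurable_fK K) mzw).
  - exact/measurable_EFinP.
  - by apply: aeW => w _; apply: cvg_EFin; [exact: nearW|exact: fK_cvg].
  - exact: finite_measure_integrable_cst.
  - by apply: aeW => w K _; rewrite lee_fin ger0_norm// fM.
rewrite -(cvg_limn_einf_sup L).1.
(* On the side of the density Fatou's lemma suffices, as only a lower bound for the expectation is
   wanted. *)
have F : (\int[P \x m]_p limn_einf (fun K => (fK K p * k p)%:E) <=
    limn_einf (fun K => \int[P \x m]_p (fK K p * k p)%:E))%E.
  apply: (@fatou _ _ _ (prodm P m) _ measurableT (fun K p => (fK K p * k p)%:E)).
    move=> K; apply/measurable_EFinP; apply: measurable_funM => //; exact: measurable_fK.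
  by move=> K p _; rewrite lee_fin mulr_ge0.
rewrite (_ : [sequence _]_K = (fun K => \int[P \x m]_p (fK K p * k p)%:E)%E); last first.
  by apply/funext => K; rewrite -law_fK.
apply: le_trans F; rewrite le_eqVlt; apply/orP; left; apply/eqP.
apply: eq_integral => -[w x] _; apply/esym; apply: (cvg_limn_einf_sup _).1.
(* At x = 0, where f may be discontinuous, the density vanishes. *)
have [->|x0] := eqVneq x 0.
  by rewrite k00 mulr0; under eq_fun do rewrite mulr0; exact: cvg_cst.
apply: cvg_EFin; first exact: nearW.
by apply: cvgMl; exact: fK_cvg.
Qed.

End conditional_law.

Section orthants.
Context {R : realType} {d : nat}.
Local Notation V := 'rV[R]_d.

(** A generating family closed under intersection, whose members have their boundaries in finitely
    many hyperplanes; the Dynkin argument of [cvg_measure_refl] starts from it. *)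
Definition orthants : set (set V) :=
  [set [set x : V | forall i, x ord0 i < a i] | a in [set: 'I_d -> R]].

Lemma measurable_orthant (a : 'I_d -> R) : measurable [set x : V | forall i, x ord0 i < a i].
Proof.
rewrite (_ : [set _ | _] = \bigcap_(i in [set: 'I_d]) ((fun x : V => x ord0 i) @^-1` `]-oo, a i[%classic)).
  apply: fin_bigcap_measurable => // i _; rewrite -[X in measurable X]setTI.
  by apply: measurable_coord => //; exact: measurable_itv.
by apply/seteqP; split => x h i => [_|]; have := h i; rewrite /= in_itv//=; apply.
Qed.

Lemma measurable_orthantsE : @measurable _ V = <<s orthants >>.
Proof.
apply/seteqP; split => [A mA|]; last first.
  by apply: smallest_sub; [exact: sigma_algebra_measurable|move=> _ [a _ <-]; exact: measurable_orthant].
have mid : measurable_fun setT (id : g_sigma_algebraType orthants -> V).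
  apply: measurable_fun_rV => i.
  apply: (measurability _ (RGenInftyO.measurableE R)) => _ [_ [a ->] <-].
  (* A half-space is the union over k of the orthants whose other bounds are all k. *)
  rewrite setTI (_ : _ @^-1` _ = \bigcup_k
      [set x : V | forall j, x ord0 j < if j == i then a else k%:R]); last first.
    apply/seteqP; split => x /=; rewrite in_itv/=.
      move=> xa; exists (Num.trunc (\sum_j `|x ord0 j|)).+1 => // j /=.
      case: eqP => [->//|_].
      rewrite (le_lt_trans (ler_norm _))//.
      apply: le_lt_trans (truncnS_gt _).
      by rewrite (bigD1 j)//= lerDl sumr_ge0.
    by move=> [k _ /(_ i)]; rewrite eqxx.
  apply: bigcup_measurable => k _; apply: sub_sigma_algebra.
  by eexists.
by have := mid measurableT A mA; rewrite setTI.
Qed.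

Lemma orthants_setI : setI_closed orthants.
Proof.
move=> _ _ [a _ <-] [b _ <-]; exists (fun i => Num.min (a i) (b i)) => //.
apply/seteqP; split => x /=.
  by move=> h; split => i; have := h i; rewrite lt_min => /andP[].
by move=> [h1 h2] i; rewrite lt_min h1 h2.
Qed.

Lemma lebesgue_rV_hyperplane (i : 'I_d) (a : R) :
  lebesgue_rV d [set x : V | x ord0 i = a] = 0%E.
Proof.
pose B j : set R := if j == i then [set a] else setT.
have mB j : measurable (B j) by rewrite /B; case: ifP.
rewrite (_ : [set _ | _] = [set x : V | forall j, B j (x ord0 j)]).
  rewrite (lebesgue_rV_box mB) (bigD1 i)//= {1}/B eqxx lebesgue_measure_set1.
  by rewrite mul0e.
apply/seteqP; split => x /=; last by move/(_ i); rewrite /B eqxx.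
by move=> e j; rewrite /B; case: eqP => [->|].
Qed.

End orthants.

(** * Continuity of the moved volume in the reflection *)

Section continuity.
Context {R : realType} {d : nat}.
Local Notation V := 'rV[R]_d.
Local Notation m := (@lebesgue_rV R d).

Lemma cvg_dot (xs ys : nat -> V) (x y : V) :
  (forall i, (fun j => xs j ord0 i) @ \oo --> x ord0 i) ->
  (forall i, (fun j => ys j ord0 i) @ \oo --> y ord0 i) ->
  (fun j => dot (xs j) (ys j)) @ \oo --> dot x y.
Proof.
move=> hx hy; apply: cvg_big => [|i _]; first exact: add_continuous.
by apply: cvgM; [exact: hx|exact: hy].
Qed.

Lemma cvg_refl (xs : nat -> V) (x y : V) : x != 0 ->
  (forall i, (fun j => xs j ord0 i) @ \oo --> x ord0 i) ->
  forall i, (fun j => refl (xs j) y ord0 i) @ \oo --> refl x y ord0 i.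
Proof.
move=> x0 hx i; rewrite reflE !mxE.
under eq_fun do rewrite reflE !mxE.
apply: cvgD; first exact: cvg_cst.
apply: cvgM; last exact: hx.
apply: cvgB; first exact: cvg_cst.
have hd : (fun j => dot (xs j) (xs j)) @ \oo --> dot x x by exact: cvg_dot.
apply: cvgM; last by apply: cvgV => //; rewrite dot_eq0.
apply: cvgM; first exact: cvg_cst.
by apply: cvg_dot => // k; exact: cvg_cst.
Qed.

Context (C : set V) (rC : R) (mC : measurable C) (CB : forall y, C y -> dot y y <= rC).
Context (x : V) (xs : nat -> V) (x0 : x != 0)
  (hx : forall i, (fun j => xs j ord0 i) @ \oo --> x ord0 i).

Let Q (G : set V) (z : V) : \bar R := m (C `&` refl z @^-1` G).

Let mQ G z : measurable G -> measurable (C `&` refl z @^-1` G).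
Proof. by move=> mG; apply: measurableI => //; exact: measurable_refl_preimage. Qed.

Let sub_fin F : measurable F -> F `<=` C -> (m F < +oo)%E.
Proof.
move=> mF FC; apply: (@lebesgue_rV_ltoo _ _ (`|rC| + 1)) => // y /FC /CB yC.
rewrite /oball/= enorm_lt ?addr_ge0//.
have := ler_norm rC; have : 0 <= `|rC| by []. nra.
Qed.

Let cvgQ (G : set V) : Prop := (fun j => Q G (xs j)) @ \oo --> Q G x.

(** The indicator converges at every y whose image [refl x y] lies on none of the hyperplanes
    bounding the orthant; the other y form a null set by reflection invariance. *)
Let cvgQ_orthant (a : 'I_d -> R) : cvgQ [set y : V | forall i, y ord0 i < a i].
Proof.
set G := [set y | _]; have mG : measurable G by exact: measurable_orthant.
have QE z : Q G z = (\int[m]_y (\1_(C `&` refl z @^-1` G) y)%:E)%E.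
  by rewrite integral_indic ?setIT//; exact: mQ.
rewrite /cvgQ QE; under eq_fun do rewrite QE.
have nullP i : \forall y \ae m, refl x y ord0 i != a i.
  exists (refl x @^-1` [set y | y ord0 i = a i]); split.
  - apply: measurable_refl_preimage; rewrite -[X in measurable X]setTI.
    exact: (measurable_coord i measurableT (measurable_set1 _)).
  - rewrite lebesgue_rV_refl ?lebesgue_rV_hyperplane// -[X in measurable X]setTI.
    exact: (measurable_coord i measurableT (measurable_set1 _)).
  - by move=> y /= /negP; rewrite negbK => /eqP.
have nullA : \forall y \ae m, forall i, refl x y ord0 i != a i.
  have : \forall y \ae m, forall (l : nat) (i : 'I_d), i = l :> nat -> refl x y ord0 i != a i.
    apply: ae_foralln => l; have [ld|ld] := ltnP l d; last first.
      by apply: aeW => y i il; have := ltn_ord i; rewrite il ltnNge ld.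
    apply: filterS (nullP (Ordinal ld)) => y h i il.
    by rewrite (_ : i = Ordinal ld)//; exact: val_inj.
  by apply: filterS => y h i; exact: (h _ i erefl).
have mI z : measurable_fun setT (fun y => (\1_(C `&` refl z @^-1` G) y)%:E : \bar R).
  by apply/measurable_EFinP; apply: measurable_indic; exact: mQ.
have ptw : \forall y \ae m, setT y ->
    (fun j => (\1_(C `&` refl (xs j) @^-1` G) y)%:E : \bar R) @ \oo -->
    (\1_(C `&` refl x @^-1` G) y)%:E.
  apply: filterS nullA => y ya _; apply: cvg_near_cst.
  have rc i := @cvg_refl xs x y x0 hx i.
  have side i : \forall j \near \oo,
      (refl (xs j) y ord0 i < a i) = (refl x y ord0 i < a i).
    have := ya i; rewrite neq_lt => /orP[lt|gt].
      by near=> j; rewrite lt; near: j; exact: (cvgr_lt _ (rc i)).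
    near=> j; rewrite [RHS]ltNge (ltW gt)/=; apply/negbTE; rewrite -leNgt.
    by near: j; exact: (cvgr_ge _ (rc i)).
  have : \forall j \near \oo, forall i,
      (refl (xs j) y ord0 i < a i) = (refl x y ord0 i < a i).
    exact: filter_forall.
  apply: filterS => j h; rewrite !indicE; congr (_%:R%:E); congr nat_of_bool.
  apply/idP/idP; rewrite !inE => -[Cy Gy]; split => // i; have := Gy i => /=;
    by rewrite h.
have iC : m.-integrable setT (fun y => (\1_C y)%:E).
  apply/integrableP; split; first exact/measurable_EFinP/measurable_indic.
  under eq_integral do rewrite gee0_abs ?lee_fin//.
  by rewrite integral_indic ?setIT//; exact: sub_fin.
have dom : \forall y \ae m, forall j, setT y ->
    (`|(\1_(C `&` refl (xs j) @^-1` G) y)%:E| <= (\1_C y)%:E :> \bar R)%E.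
  apply: aeW => y j _; rewrite gee0_abs ?lee_fin// !indicE ler_nat.
  by case: (boolP (y \in _ `&` _)) => //; rewrite inE => -[Cy _]; rewrite mem_set.
have [_ _] := dominated_convergence measurableT (fun j => mI (xs j)) (mI x) ptw iC dom.
exact.
Unshelve. all: by end_near. Qed.

Let xs_bounded : exists b, forall j, dot (xs j) (xs j) <= b.
Proof.
have cv : (fun j => dot (xs j) (xs j)) @ \oo --> dot x x by exact: cvg_dot.
have /cvg_seq_bounded[M [_ HM]] : cvgn (fun j => dot (xs j) (xs j)) by apply/cvg_ex; exists (dot x x).
exists (M + 1) => j; apply: le_trans (ler_norm _) _.
by apply: HM => //; rewrite ltrDl.
Qed.

(** Indicators may fail to converge for a general [G], so the claim is extended from orthants by
    Dynkin induction: complements use that [C] has finite measure, disjoint unions use dominated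
    convergence of series. *)
Lemma cvg_measure_refl (G : set V) : measurable G ->
  (fun j => m (C `&` refl (xs j) @^-1` G)) @ \oo --> m (C `&` refl x @^-1` G).
Proof.
rewrite -/(cvgQ G).
rewrite measurable_orthantsE; apply: dynkin_induction.
- exact: measurable_orthantsE.
- exact: orthants_setI.
- rewrite /cvgQ /Q preimage_setT; under eq_fun do rewrite preimage_setT.
  exact: cvg_cst.
- by move=> _ [a _ <-]; exact: cvgQ_orthant.
- move=> S mS hS.
  have Qf z : Q S z \is a fin_num.
    by rewrite ge0_fin_numE; [apply: sub_fin; [exact: mQ|exact: subIsetl]|exact: measure_ge0].
  have CE z : Q (~` S) z = (m C - Q S z)%E.
    have e : (m C = m (C `\` refl z @^-1` S) + m (C `&` refl z @^-1` S))%E.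
      by apply: measureDI => //; exact: measurable_refl_preimage.
    by rewrite e -/(Q S z) /Q preimage_setC -setDE addeK//; exact: Qf.
  rewrite /cvgQ CE; under eq_fun do rewrite CE.
  apply: cvgeB => //; last exact: cvg_cst.
  by rewrite fin_num_adde_defl// fin_numN.
- move=> F mF tF hF.
  have QE z : Q (\bigcup_k F k) z = (\int[counting]_k Q (F k) z)%E.
    rewrite ge0_integral_count// /Q preimage_bigcup setI_bigcupr measure_semi_bigcup//.
    - by move=> k; exact: mQ.
    - by move=> i j _ _ [y [[_ yi] [_ yj]]]; exact: (tF i j I I (ex_intro _ _ (conj yi yj))).
    - by apply: bigcup_measurable => k _; exact: mQ.
  have [b xb] := xs_bounded.
  (* As |refl z y| = |y - z|, the ball [B] contains the reflections of [C] by all [xs j]; the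
     measures of the sets [F k] inside [B] therefore dominate the terms, and they are summable. *)
  pose S := `|2 * (rC + b)| + 1; pose B : set V := oball S.
  have mB : measurable B by exact: measurable_oball.
  have mg k : measurable (B `&` F k) by exact: measurableI.
  have dom j k : (Q (F k) (xs j) <= m (B `&` F k))%E.
    rewrite -(lebesgue_rV_refl (xs j) (mg k)); apply: le_measure.
    - by rewrite inE; exact: mQ.
    - by rewrite inE; exact: measurable_refl_preimage.
    - move=> y [/CB yC yF]; split => //; rewrite /B /oball/= enorm_lt ?addr_ge0//.
      have h1 : dot (refl (xs j) y) (refl (xs j) y) = dot (y - xs j) (y - xs j).
        by rewrite sqr_refl; move: (xs j) => z; rewrite !dotE (dotC y z); ring.
      have h2 := dotB_le y (xs j); have h3 := xb j.
      have h4 : dot (refl (xs j) y) (refl (xs j) y) <= 2 * (rC + b) by rewrite h1; lra.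
      have h5 := ler_norm (2 * (rC + b)); rewrite /S; have : 0 <= `|2 * (rC + b)| by [].
      by move: (`|_|) (dot _ _) h4 h5 => n D h4 h5 h6; nra.
  have ig : counting.-integrable setT (fun k => m (B `&` F k)).
    apply/integrableP; split => //.
    rewrite (eq_integral (fun k => m (B `&` F k))); last first.
      by move=> k _; apply: gee0_abs; exact: measure_ge0.
    rewrite ge0_integral_count// -measure_semi_bigcup//.
    - rewrite -setI_bigcupr; apply: (@lebesgue_rV_ltoo _ _ S).
        by apply: measurableI => //; exact: bigcup_measurable.
      exact: subIsetl.
    - by move=> i j _ _ [y [[_ yi] [_ yj]]]; exact: (tF i j I I (ex_intro _ _ (conj yi yj))).
    - exact: bigcup_measurable.
  rewrite /cvgQ QE; under eq_fun do rewrite QE.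
  have ptw : \forall k \ae @counting nat R, setT k -> (fun j => Q (F k) (xs j)) @ \oo --> Q (F k) x.
    by apply: aeW => k _; exact: hF.
  have dom' : \forall k \ae @counting nat R, forall j, setT k -> (`|Q (F k) (xs j)| <= m (B `&` F k))%E.
    apply: aeW => k j _; have -> : (`|Q (F k) (xs j)| = Q (F k) (xs j))%E.
      by apply: gee0_abs; exact: measure_ge0.
    exact: dom.
  have mQn z : measurable_fun setT (fun k => Q (F k) z) by [].
  by have [_ _] := dominated_convergence measurableT (fun j => mQn (xs j)) (mQn x) ptw ig dom'.
Qed.

End continuity.

Lemma moved_continuous (R : realType) (d : nat) (s rC : R) (E : set 'rV[R]_d)
    (x : 'rV[R]_d) (xs : nat -> 'rV[R]_d) :
  measurable E -> (forall y, E y -> dot y y <= rC) -> x != 0 ->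
  (forall i, (fun j => xs j ord0 i) @ \oo --> x ord0 i) ->
  (fun j => lebesgue_rV d (moved s E (xs j))) @ \oo --> lebesgue_rV d (moved s E x).
Proof.
move=> mE EB x0 hx; have mB := @measurable_oball R d s.
have mC : measurable (E `\` oball s) by exact: measurableD.
have CB y : (E `\` oball s) y -> dot y y <= rC by case=> /EB.
have mH : measurable (oball s `\` E) by exact: measurableD.
exact: (cvg_measure_refl mC CB x0 hx mH).
Qed.

Arguments outer {R n} E s.
Arguments inner {R n} E s.

(** * Measurability of the density and of the moved volume in state and reflection *)

Section joint_density.
Context {R : realType} {n : nat} {dT : measure_display} {T : measurableType dT}.
Local Notation V := 'rV[R]_n.+1.
Local Notation m := (@lebesgue_rV R n.+1).
Context (L r : R) (E : T -> set V) (L0 : 0 < L)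
  (mE : measurable [set p : T * V | E p.1 p.2])
  (EL : forall w x, E w x -> enorm x <= L)
  (mr : forall w, m (oball r) = m (E w)) (N : nat).

Let mB s : measurable (oball s : set V) := @measurable_oball R n.+1 s.

Lemma measurable_section w : measurable (E w).
Proof.
have mp : measurable_fun setT (fun x : V => (w, x)) by exact: measurable_fun_pair.
by have := mp measurableT _ mE; rewrite setTI.
Qed.

Lemma measurable_outer s : measurable_fun setT (fun w => outer (E w) s).
Proof.
apply: measurableT_comp => //; apply: measurable_section_measure.
apply: (@measurableD _ _ [set p | E p.1 p.2] (snd @^-1` oball s)) => //.
by rewrite -[X in measurable X]setTI; exact: measurable_snd.
Qed.

Let mFG (B : set V) : measurable B ->
  measurable_fun setT (fun w => vol2 (near_pairs L r N (E w) `&` u @^-1` B)).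
Proof.
move=> mB'; pose Q w := near_pairs L r N (E w) `&` u @^-1` B.
have mQ w : measurable (Q w).
  apply: measurableI; first exact: (measurable_near_pairs L r (measurable_section w) N).
  by rewrite -[X in measurable X]setTI; exact: measurable_u.
rewrite (_ : (fun w => _) = (fun w => fine (prodm m m (Q w)))); last first.
  by apply/funext => w; rewrite vol2E//; exact: mQ.
apply: measurableT_comp => //; apply: measurable_section_measure.
have st (g : V * V -> V) : measurable_fun setT g ->
    measurable [set p : T * (V * V) | E p.1 (g p.2)].
  move=> mg; have mp : measurable_fun setT (fun p : T * (V * V) => (p.1, g p.2)).
    by apply: measurable_fun_pair => //; exact: (measurableT_comp mg).
  by have := mp measurableT _ mE; rewrite setTI.
have pre (A : set (V * V)) : measurable A -> measurable [set p : T * (V * V) | A p.2].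
  by move=> mA; have := @measurable_snd _ _ T (V * V)%type measurableT A mA; rewrite setTI.
pose A : set (V * V) := [set p | ~ oball r p.1 /\ oball r p.2] `&` near_pairs L r N set0.
have -> : [set p : T * (V * V) | Q p.1 p.2] =
   ([set p | E p.1 p.2.1] `\` [set p | E p.1 p.2.2]) `&`
   [set p | ([set q : V * V | [/\ ~ oball r q.1, oball r q.2,
       enorm q.1 <= r + delta (d:=n.+1) L N & enorm q.2 > r - delta (d:=n.+1) L N]] `&` u @^-1` B) p.2].
  apply/seteqP; split => [[w [x y]]|[w [x y]]] /=.
    by case=> -[[Ex rx] [ry Ey] h1 h2] uB.
  by case=> -[Ex Ey] [[rx ry h1 h2] uB].
apply: measurableI; first by apply: measurableD; exact: st.
apply: pre; apply: measurableI; last by rewrite -[X in measurable X]setTI; exact: measurable_u.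
have -> : [set q : V * V | [/\ ~ oball r q.1, oball r q.2,
       enorm q.1 <= r + delta (d:=n.+1) L N & enorm q.2 > r - delta (d:=n.+1) L N]] =
   ((~` oball r) `*` oball r) `&`
   ((fun p : V * V => enorm p.1) @^-1` `]-oo, r + delta (d:=n.+1) L N]%classic `&`
    (fun p : V * V => enorm p.2) @^-1` `]r - delta (d:=n.+1) L N, +oo[%classic).
  apply/seteqP; split => p; rewrite /= !in_itv/= ?andbT.
    by case=> ? ? ? ?.
  by case=> -[? ?] [? ?].
apply: measurableI; first by apply: measurableX => //; exact: measurableC.
have me (f : V * V -> V) : measurable_fun setT f -> measurable_fun setT (fun p : V * V => enorm (f p)).
  exact: measurable_enorm.
apply: measurableI; rewrite -[X in measurable X]setTI; exact: me.
Qed.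

Lemma measurable_weighted_case : measurable_fun setT (fun w => weighted_case L r N (E w)).
Proof.
have UE w : F_set L r N (E w) `|` G_set L r N (E w) = near_pairs L r N (E w) `&` u @^-1` setT.
  by rewrite /F_set /G_set -setIUr -preimage_setU setUC setUv.
rewrite /weighted_case; apply: measurable_and => //.
rewrite (_ : (fun w => _) = (fun w => (outer (E w) r != 0) && (outer (E w) r ^+ 2 / 2 <=
    vol2 (near_pairs L r N (E w) `&` u @^-1` setT)))); last first.
  by apply/funext => w; rewrite (excessE (measurable_section w)) UE.
apply: measurable_and.
  apply: measurable_neg; apply: measurable_fun_eqr => //; exact: measurable_outer.
apply: measurable_fun_ler; last exact: mFG.
by apply: measurable_funM => //; apply: measurable_funX; exact: measurable_outer.
Qed.

Lemma measurable_moved_prod s :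
  measurable_fun setT (fun p : T * V => m (moved s (E p.1) p.2)).
Proof.
apply: (@measurable_moved_joint _ _ _ (T * V)%type s (fun p => E p.1) snd) => //.
have mp : measurable_fun setT (fun q : (T * V) * V => (q.1.1, q.2)).
  by apply: measurable_fun_pair => //; exact: (measurableT_comp measurable_fst measurable_fst).
by have := mp measurableT _ mE; rewrite setTI.
Qed.

Lemma measurable_wg_prod : measurable_fun setT (fun p : T * V => wg L r (E p.1) N p.2).
Proof.
rewrite /wg; apply: measurable_funM; last first.
  rewrite (_ : (fun p => _) = fun p : T * V => fine (m (moved r (E p.1) p.2))).
    by apply: measurableT_comp => //; exact: measurable_moved_prod.
  by apply/funext => p; exact: gainE (measurable_section p.1) (@EL p.1) _.
rewrite /weight; apply: measurable_funM; first exact: measurable_riesz.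
have mb : measurable_fun setT (fun w => vol2 (G_set L r N (E w)) < vol2 (F_set L r N (E w))).
  by apply: measurable_fun_ltr; apply: mFG => //; exact: measurableC.
apply: measurable_fun_ifT.
- exact: (measurableT_comp mb measurable_fst).
- by apply: (measurableT_comp (measurable_indic _)) => //; exact: measurableC.
- exact: (measurableT_comp (measurable_indic _)).
Qed.

Lemma measurable_dens_prod : measurable_fun setT (fun p : T * V => dens L r (E p.1) N p.2).
Proof.
rewrite /dens; apply: measurable_fun_ifT.
- exact: (measurableT_comp measurable_weighted_case measurable_fst).
- apply: measurable_funM; first exact: measurable_wg_prod.
  apply: measurable_funV.
  have mI : measurable_fun setT (fun w => fine (\int[m]_z (wg L r (E w) N z)%:E)%E).
    apply: measurableT_comp => //.
    apply: (measurable_fun_fubini_tonelli_F (m2 := m) (fun p : T * V => (wg L r (E p.1) N p.2)%:E)).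
      by apply/measurable_EFinP; exact: measurable_wg_prod.
    by move=> p; rewrite lee_fin; exact: wg_ge0 (measurable_section p.1) (@EL p.1) _ _.
  exact: (measurableT_comp mI measurable_fst).
- apply: measurable_funM => //; apply: measurable_funM; first exact: measurable_riesz.
  exact: (measurableT_comp (measurable_indic (mB _)) measurable_snd).
Qed.

End joint_density.

(** * Expectations, and the bound for one random step *)

Section expectation.
Context {R : realType} {dT : measure_display} {T : measurableType dT} (P : probability T R).

Definition Ex (g : T -> R) : R := fine (\int[P]_w (g w)%:E)%E.

Lemma ExE (g : T -> R) (M : R) : measurable_fun setT g -> (forall w, 0 <= g w <= M) ->
  (\int[P]_w (g w)%:E = (Ex g)%:E)%E.
Proof.
move=> mg gM; rewrite fineK// ge0_fin_numE; last first.
  by apply: integral_ge0 => w _; rewrite lee_fin; have /andP[] := gM w.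
have M0 : 0 <= M by have /andP[/le_trans h /h] := gM point.
apply: (@le_lt_trans _ _ (\int[P]_w M%:E)%E).
  apply: ge0_le_integral => //.
  - by move=> w _; rewrite lee_fin; have /andP[] := gM w.
  - exact/measurable_EFinP.
  - by move=> w _; rewrite lee_fin; have /andP[] := gM w.
by rewrite integral_cst//= probability_setT mule1 ltry.
Qed.

Lemma Ex_ge0 (g : T -> R) : (forall w, 0 <= g w) -> 0 <= Ex g.
Proof. by move=> g0; apply/fine_ge0/integral_ge0 => w _; rewrite lee_fin. Qed.

Lemma le_Ex (g h : T -> R) (M : R) : measurable_fun setT g -> measurable_fun setT h ->
  (forall w, 0 <= g w) -> (forall w, g w <= h w) -> (forall w, h w <= M) -> Ex g <= Ex h.
Proof.
move=> mg mh g0 gh hM; rewrite -lee_fin -(@ExE g M)//; last first.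
  by move=> w; rewrite g0/= (le_trans (gh w)).
rewrite -(@ExE h M)//; last by move=> w; rewrite hM (le_trans (g0 w)).
apply: ge0_le_integral => //.
- by move=> w _; rewrite lee_fin.
- exact/measurable_EFinP.
- exact/measurable_EFinP.
- by move=> w _; rewrite lee_fin.
Qed.

Lemma integral_loss (g h l : T -> R) (M : R) : measurable_fun setT g -> measurable_fun setT h ->
  measurable_fun setT l ->
  (forall w, 0 <= h w) -> (forall w, 0 <= l w) -> (forall w, g w = h w + l w) ->
  (forall w, g w <= M) -> (\int[P]_w (l w)%:E = (Ex g - Ex h)%:E)%E.
Proof.
move=> mg mh ml h0 l0 ghl gM.
have g0 w : 0 <= g w by rewrite ghl addr_ge0.
have gE := @ExE g M mg (fun w => ltac:(by rewrite g0 gM)).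
have hE := @ExE h M mh (fun w => ltac:(by rewrite h0/= (le_trans _ (gM w))// ghl lerDl)).
have lE := @ExE l M ml (fun w => ltac:(by rewrite l0/= (le_trans _ (gM w))// ghl lerDr)).
have : (\int[P]_w (g w)%:E = \int[P]_w (h w)%:E + \int[P]_w (l w)%:E)%E.
  transitivity (\int[P]_w ((h w)%:E + (l w)%:E))%E.
    by apply: eq_integral => w _; rewrite ghl EFinD.
  by apply: ge0_integralD => //; first [exact/measurable_EFinP | by move=> ? _; rewrite lee_fin].
rewrite gE hE lE -EFinD => -[->].
by rewrite addrAC subrr add0r.
Qed.

End expectation.

(** X <= s / 2 + X^2 / (2 s), where l, the value of lambda at one step, is then replaced by a bound
    [Lam] valid over a whole window. *)
Lemma young_step (R : realType) (X s c l Lam : R) : 0 < s -> 0 < c -> 0 < l -> l <= Lam ->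
  X <= s / 2 + Lam / (2 * s * c) * (c / l * X ^+ 2).
Proof.
move=> s0 c0 l0 lL.
have -> : Lam / (2 * s * c) * (c / l * X ^+ 2) = Lam / l * (X ^+ 2 / (2 * s)).
  by field; rewrite !gt_eqF.
have h1 : 1 <= Lam / l by rewrite ler_pdivlMr// mul1r.
have h2 : 0 <= X ^+ 2 / (2 * s) by rewrite divr_ge0 ?sqr_ge0// mulr_ge0// ltW.
apply: (@le_trans _ _ (s / 2 + X ^+ 2 / (2 * s))); last first.
  by rewrite lerD2l -[leLHS]mul1r ler_wpM2r.
rewrite -subr_ge0 (_ : _ - _ = (X - s) ^+ 2 / (2 * s)); last by field; rewrite !gt_eqF.
by rewrite divr_ge0 ?sqr_ge0// mulr_ge0// ltW.
Qed.

Lemma combine_bounds (R : realType) (s A B x y z : R) (a b c : \bar R) : 0 <= A -> 0 <= B ->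
  (a <= x%:E -> b <= y%:E -> c <= z%:E ->
    s%:E + (A%:E * a + B%:E * (b + c)) <= (s + A * x + B * (y + z))%:E)%E.
Proof.
move=> A0 B0 ha hb hc; rewrite -addrA 2!EFinD !EFinM EFinD; apply: leeD2l.
by apply: leeD; apply: lee_wpmul2l; rewrite ?lee_fin//; exact: leeD.
Qed.

Lemma integral_combine (R : realType) (dT : measure_display) (T : measurableType dT)
    (P : probability T R) (g1 g2 g3 : T -> \bar R) (s A B : R) :
  measurable_fun setT g1 -> measurable_fun setT g2 -> measurable_fun setT g3 ->
  (forall w, 0 <= g1 w)%E -> (forall w, 0 <= g2 w)%E -> (forall w, 0 <= g3 w)%E ->
  0 <= s -> 0 <= A -> 0 <= B ->
  (\int[P]_w (s%:E + (A%:E * g1 w + B%:E * (g2 w + g3 w))) =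
   s%:E + (A%:E * \int[P]_w g1 w + B%:E * (\int[P]_w g2 w + \int[P]_w g3 w)))%E.
Proof.
move=> m1 m2 m3 p1 p2 p3 s0 A0 B0.
have p23 w : (0 <= g2 w + g3 w)%E by exact: adde_ge0.
have m23 : measurable_fun setT (fun w => g2 w + g3 w)%E by exact: emeasurable_funD.
have pA w : (0 <= A%:E * g1 w)%E by exact: mule_ge0.
have pB w : (0 <= B%:E * (g2 w + g3 w))%E by exact: mule_ge0.
have mA : measurable_fun setT (fun w => A%:E * g1 w)%E by exact: emeasurable_funM.
have mB : measurable_fun setT (fun w => B%:E * (g2 w + g3 w))%E by exact: emeasurable_funM.
rewrite ge0_integralD//; last 2 first.
- by move=> w _; exact: adde_ge0.
- exact: emeasurable_funD.
rewrite integral_cst// [X in (_ * X)%E]probability_setT mule1 ge0_integralD//.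
by rewrite ge0_integralZl_EFin// ge0_integralZl_EFin// ge0_integralD.
Qed.

Section step.
Context {R : realType} {n : nat} (n0 : (0 < n)%N)
  {dT : measure_display} {T : measurableType dT} (P : probability T R).
Local Notation V := 'rV[R]_n.+1.
Local Notation m := (@lebesgue_rV R n.+1).
Context (L r : R) (E : T -> set V) (L0 : 0 < L) (r0 : 0 < r)
  (mE : measurable [set p : T * V | E p.1 p.2])
  (EL : forall w x, E w x -> enorm x <= L)
  (mr : forall w, m (oball r) = m (E w)) (N : nat) (N1 : (1 < N)%N)
  (zeta : T -> V) (mzeta : measurable_fun setT zeta) (zeta0 : forall w, zeta w != 0)
  (DD : set (set T)) (mDD : forall D, DD D -> measurable D)
  (law : forall D B, DD D -> measurable B ->
     (P (D `&` zeta @^-1` B) = \int[P]_(w in D) (step_law L r N (E w) B)%:E)%E)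
  (DDm : forall s x t, DD [set w | t < fine (m (moved s (E w) x))]).

Let E' w := pol (zeta w) (E w).
Let mEw := measurable_section mE.
Let k (p : T * V) : R := dens L r (E p.1) N p.2.
Let f s (p : T * V) : R := fine (m (moved s (E p.1) p.2)).

Let mf s : measurable_fun setT (f s).
Proof. by apply: measurableT_comp => //; exact: measurable_moved_prod. Qed.

Let mk : measurable_fun setT k.
Proof. exact: measurable_dens_prod. Qed.

Let k0 p : 0 <= k p.
Proof. exact: dens_ge0 (mEw p.1) (@EL p.1) _ _. Qed.

Lemma moved_law s :
  (\int[P]_w \int[m]_z (fine (m (moved s (E w) z)) * dens L r (E w) N z)%:E <=
   \int[P]_w (fine (m (moved s (E w) (zeta w))))%:E)%E.
Proof.
have mfk : measurable_fun setT (fun p => (f s p * k p)%:E).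
  by apply/measurable_EFinP; exact: measurable_funM.
have fk0 p : (0 <= (f s p * k p)%:E)%E by rewrite lee_fin mulr_ge0// fine_ge0.
have := fubini_tonelli1 (m1 := P) (m2 := m) _ mfk fk0; rewrite /fubini_F/= => <-.
apply: (@conditional_ge _ _ _ _ P zeta k (f s) DD (fine (m (oball r)))) => //.
- move=> w; rewrite /k /dens /= /wg /weight /riesz.
  (* Here d > 1 matters: for n > 0 the kernel is 0 at the origin. *)
  have rz : enorm (0 : V) ^- n = 0.
    by rewrite /enorm dot0l sqrtr0 expr0n (gtn_eqF n0) invr0.
  by case: (weighted_case _ _ _ _) => /=; rewrite rz !mul0r ?mulr0.
- by move=> D B DDD mB'; rewrite law//; apply: eq_integral => w _; exact: (step_lawE r L0 (mEw w) (@EL w)).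
- by move=> p; exact: fine_ge0.
- move=> p; rewrite /f (mr p.1).
  have e := moved_fin (mEw p.1) (@EL p.1) s p.2.
  have e' := sub_state_fin (mEw p.1) (@EL p.1) (mEw p.1) (@subset_refl _ _).
  rewrite -lee_fin -e -e'; apply: le_measure; rewrite ?inE.
  + exact: measurable_moved.
  + exact: mEw.
  + by move=> x [[]].
- by move=> x t; exact: DDm.
- move=> w x xs x0 hx; apply: fine_cvg.
  rewrite /f/= -(moved_fin (mEw w) (@EL w)).
  apply: (@moved_continuous _ _ s (L ^+ 2)) => // y /EL.
  by rewrite enorm_le// ltW.
Qed.

Let outer_bd s w : 0 <= outer (E w) s <= fine (m (oball r)).
Proof.
rewrite outer_ge0/= (mr w) -lee_fin -(outerE (mEw w) (@EL w)).
rewrite -(sub_state_fin (mEw w) (@EL w) (mEw w) (@subset_refl _ _)).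
apply: le_measure; rewrite ?inE; last exact: subDsetl; last exact: mEw.
by apply: measurableD; [exact: mEw|exact: measurable_oball].
Qed.

Let mE' : measurable [set p : T * V | E' p.1 p.2].
Proof. exact: measurable_pol_joint. Qed.

Let moved_loss s w : outer (E w) s = outer (E' w) s + f s (w, zeta w).
Proof.
have mE'w := measurable_section mE' w.
have EL' x : E' w x -> enorm x <= L by apply: (@pol_enorm_le _ _ (zeta w) (E w)); exact: EL.
apply: EFin_inj; rewrite EFinD -(outerE (mEw w) (@EL w)) -(outerE mE'w EL').
rewrite /f -(moved_fin (mEw w) (@EL w)).
exact: polarization_loss (mEw w) (state_ltoo (mEw w) (@EL w)).
Qed.

(** The expected loss at any radius is a difference of successive expectations, so it telescopes
    over a window. *)
Lemma integral_moved s :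
  (\int[P]_w \int[m]_z (fine (m (moved s (E w) z)) * dens L r (E w) N z)%:E <=
   (Ex P (fun w => outer (E w) s) - Ex P (fun w => outer (E' w) s))%:E)%E.
Proof.
have mfz : measurable_fun setT (fun w => f s (w, zeta w)).
  by apply: (measurableT_comp (mf s) (g := fun w => (w, zeta w))); exact: measurable_fun_pair.
apply: le_trans (moved_law s) _; rewrite le_eqVlt; apply/orP; left; apply/eqP.
apply: (@integral_loss _ _ _ P _ _ _ (fine (m (oball r)))).
- exact: measurable_outer.
- exact: measurable_outer.
- exact: mfz.
- by move=> w; exact: outer_ge0.
- by move=> w; exact: fine_ge0.
- exact: moved_loss.
- by move=> w; have /andP[] := outer_bd s w.
Qed.

Let kappa := ball_vol (R:=R) n.+1 * r ^+ n.

(** Which case occurs depends on the state. The terms of both cases are nonnegative, so every state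
    satisfies the sum of the two bounds, and expectations can be taken. *)
Lemma one_step_bound (h Lam s : R) : 0 < h -> h < delta (d:=n.+1) L N -> h <= r ->
  lambda (d:=n.+1) L N <= Lam -> 0 < s ->
  let A := Lam / (2 * s * c1 (n:=n) L) in let B := 2 / (c2 (n:=n) L * (kappa * h)) in
  Ex P (fun w => outer (E w) r) <= s / 2 +
   A * (Ex P (fun w => outer (E w) r) - Ex P (fun w => outer (E' w) r)) +
   B * ((Ex P (fun w => outer (E w) (r + h)) - Ex P (fun w => outer (E' w) (r + h))) +
        (Ex P (fun w => outer (E w) (r - h)) - Ex P (fun w => outer (E' w) (r - h)))).
Proof.
move=> h0 hd hr lL s0; cbv zeta; set A := Lam / _; set B := 2 / _.
pose g t w := (\int[m]_z (fine (m (moved t (E w) z)) * dens L r (E w) N z)%:E)%E.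
have g0 t w : (0 <= g t w)%E.
  by apply: integral_ge0 => z _; rewrite lee_fin mulr_ge0 ?fine_ge0//; exact: (k0 (w, z)).
have mg t : measurable_fun setT (g t).
  apply: (measurable_fun_fubini_tonelli_F (m2 := m) (fun p : T * V => (f t p * k p)%:E)).
    by apply/measurable_EFinP; exact: measurable_funM.
  by move=> p; rewrite lee_fin mulr_ge0// fine_ge0.
have l0 := lambda_gt0 L0 N1; have c10 := c1_gt0 (n := n) L0.
have Lam0 : 0 < Lam by exact: lt_le_trans lL.
have kap0 : 0 < kappa by rewrite mulr_gt0 ?ball_vol_gt0 ?exprn_gt0.
have c20 : 0 < c2 (n:=n) L.
  apply: mulr_gt0; rewrite invr_gt0; last by rewrite exprn_gt0// mulr_gt0.
  by apply: mulr_gt0; [exact: mulr_gt0|exact: omega_gt0].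
have A0 : 0 < A by rewrite divr_gt0// !mulr_gt0.
have kh : 0 < c2 (n:=n) L * (kappa * h) by apply: mulr_gt0 => //; exact: mulr_gt0.
have B0 : 0 < B by rewrite divr_gt0.
have ptw w : ((outer (E w) r)%:E <=
    (s / 2)%:E + (A%:E * g r w + B%:E * (g (r + h)%R w + g (r - h)%R w)))%E.
  have s20 : (0 <= (s / 2)%:E)%E by rewrite lee_fin divr_ge0// ltW.
  have B1 : (0 <= B%:E * (g (r + h)%R w + g (r - h)%R w))%E.
    by apply: mule_ge0; [rewrite lee_fin ltW|exact: adde_ge0].
  have A1 : (0 <= A%:E * g r w)%E by apply: mule_ge0; [rewrite lee_fin ltW|].
  have [W|W] := boolP (weighted_case L r N (E w)).
    have gg : ((c1 (n:=n) L / lambda (d:=n.+1) L N * outer (E w) r ^+ 2)%:E <= g r w)%E.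
      apply: le_trans (weighted_gain L0 (mEw w) (@EL w) (mr w) N1 W) _.
      rewrite le_eqVlt; apply/orP; left; apply/eqP.
      by apply: eq_integral => z _; rewrite (gainE (mEw w) (@EL w)).
    apply: (@le_trans _ _ ((s / 2)%:E + A%:E * g r w)%E); last first.
      by rewrite leeD2l// leeDl.
    apply: (@le_trans _ _ ((s / 2)%:E +
        A%:E * (c1 (n:=n) L / lambda (d:=n.+1) L N * outer (E w) r ^+ 2)%:E)%E); last first.
      by rewrite leeD2l// lee_wpmul2l// lee_fin ltW.
    by rewrite -EFinM -EFinD lee_fin; exact: young_step.
  apply: (@le_trans _ _ (B%:E * (g (r + h)%R w + g (r - h)%R w))%E); last first.
    by apply: (@le_trans _ _ (A%:E * g r w + B%:E * (g (r + h)%R w + g (r - h)%R w))%E);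
       [rewrite leeDr|rewrite leeDr].
  have Xle := unweighted_excess (mEw w) (@EL w) (mr w) N1 W h0 hd.
  have gp : ((c2 (n:=n) L * (outer (E w) (r + h) * inner (E w) (r + h)))%:E <= g (r + h)%R w)%E := unweighted_gain L0 (mEw w) (@EL w) (r + h) W.
  have gm : ((c2 (n:=n) L * (outer (E w) (r - h) * inner (E w) (r - h)))%:E <= g (r - h)%R w)%E := unweighted_gain L0 (mEw w) (@EL w) (r - h) W.
  have ip := inner_ge (ltW r0) (mEw w) (@EL w) (mr w) (ltW h0).
  have om := outer_ge (ltW r0) (mEw w) (@EL w) (mr w) (ltW h0) hr.
  have o1 := outer_ge0 (E := E w) (r + h); have i1 := inner_ge0 (E := E w) (r - h).
  apply: (@le_trans _ _ (B%:E * ((c2 (n:=n) L * (outer (E w) (r + h) * inner (E w) (r + h)))%:E +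
     (c2 (n:=n) L * (outer (E w) (r - h) * inner (E w) (r - h)))%:E))%E); last first.
    by apply: lee_wpmul2l; [rewrite lee_fin ltW|exact: (leeD gp gm)].
  rewrite -EFinD -EFinM lee_fin; apply: (le_trans Xle).
  (* At radius r + h the volume inside is at least kappa h, at radius r - h the volume outside; the
     remaining factor is the one to be bounded. *)
  have kp : outer (E w) (r + h) * (kappa * h) <= outer (E w) (r + h) * inner (E w) (r + h).
    exact: ler_wpM2l.
  have km : kappa * h * inner (E w) (r - h) <= outer (E w) (r - h) * inner (E w) (r - h).
    exact: ler_wpM2r.
  have -> : 2 * (outer (E w) (r + h) + inner (E w) (r - h)) =
     B * (c2 (n:=n) L * (outer (E w) (r + h) * (kappa * h)) +
          c2 (n:=n) L * (kappa * h * inner (E w) (r - h))).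
    by rewrite /B; field; rewrite (gt_eqF c20) (gt_eqF kap0) (gt_eqF h0).
  by apply: ler_wpM2l; [exact: ltW|apply: lerD; apply: ler_wpM2l => //; exact: ltW].
have iX := @ExE _ _ _ P (fun w => outer (E w) r) (fine (m (oball r))) (measurable_outer mE r) (outer_bd r).
rewrite -lee_fin -iX.
apply: (@le_trans _ _ (\int[P]_w ((s / 2)%:E + (A%:E * g r w + B%:E * (g (r + h)%R w + g (r - h)%R w))))%E).
  apply: ge0_le_integral => //.
  - by move=> w _; rewrite lee_fin outer_ge0.
  - by apply/measurable_EFinP; exact: measurable_outer.
  - apply: emeasurable_funD => //; apply: emeasurable_funD; apply: emeasurable_funM => //.
    exact: emeasurable_funD.
have s20 : 0 <= s / 2 by rewrite divr_ge0// ltW.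
rewrite (integral_combine P (mg r) (mg (r + h)) (mg (r - h)) (g0 r) (g0 (r + h)) (g0 (r - h)) s20 (ltW A0) (ltW B0)).
apply: (combine_bounds (s / 2) (ltW A0) (ltW B0)).
- exact: (integral_moved r).
- exact: (integral_moved (r + h)).
- exact: (integral_moved (r - h)).
Qed.

End step.

(** * Null sets *)

Section almost_equal_sets.
Context {R : realType} {d : measure_display} {S : measurableType d}.
Implicit Types (mu : {measure set S -> \bar R}) (A B : set S).

(** [A] and [B] themselves may be nonmeasurable: the initial set is Lebesgue measurable, perhaps not
    Borel. *)
Definition aeq mu A B :=
  exists Z, [/\ measurable Z, mu Z = 0%E & forall x, ~ Z x -> (A x <-> B x)].

Lemma aeq_sym mu A B : aeq mu A B -> aeq mu B A.
Proof. by case=> Z [mZ Z0 h]; exists Z; split => // x Zx; rewrite h. Qed.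

Lemma aeqI mu A B A' B' : aeq mu A B -> aeq mu A' B' -> aeq mu (A `&` A') (B `&` B').
Proof.
move=> [Y [mY Y0 h]] [Z [mZ Z0 h']]; exists (Y `|` Z); split.
- exact: measurableU.
- by rewrite measureU0.
- by move=> x /not_orP[Yx Zx]; have := h x Yx; have := h' x Zx; rewrite /setI/=; tauto.
Qed.

Lemma aeqC mu A B : aeq mu A B -> aeq mu (~` A) (~` B).
Proof.
by move=> [Z [mZ Z0 h]]; exists Z; split => // x Zx; have := h x Zx; rewrite /setC/=; tauto.
Qed.

Lemma aeq_refl mu A : aeq mu A A.
Proof. by exists set0; split. Qed.

Lemma aeq_ext mu A B : aeq mu A B -> (mu^* A = mu^* B)%mu.
Proof.
have le A' B' : aeq mu A' B' -> (mu^* A' <= mu^* B')%mu%E.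
  move=> [Z [mZ Z0 h]]; rewrite -[leRHS]adde0 -[in leRHS]Z0 -(measurable_mu_extE mu mZ).
  apply: le_trans (outer_measureU2 _ B' Z); apply: le_mu_ext => x A'x.
  by have [Zx|Zx] := pselect (Z x); [right|left; exact/h].
by move=> AB; apply/eqP; rewrite eq_le !le//; exact: aeq_sym.
Qed.

End almost_equal_sets.

Section null_invariance.
Context {R : realType} {d : nat}.
Local Notation V := 'rV[R]_d.
Local Notation m := (@lebesgue_rV R d).
Implicit Types (E F : set V) (L r s : R) (z : V).

Lemma aeq_preimage_refl E F z : aeq m E F -> aeq m (refl z @^-1` E) (refl z @^-1` F).
Proof.
move=> [Z [mZ Z0 h]]; exists (refl z @^-1` Z); split.
- exact: measurable_refl_preimage.
- exact: (eq_trans (lebesgue_rV_refl z mZ)).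

- by move=> x; exact: h.
Qed.

Lemma aeq_pol E F z : aeq m E F -> aeq m (pol z E) (pol z F).
Proof.
move=> EF; have [Y [mY Y0 h]] := EF; have [Z [mZ Z0 h']] := aeq_preimage_refl z EF.
exists (Y `|` Z); split.
- exact: measurableU.
- by rewrite measureU0.
- move=> x /not_orP[Yx Zx]; rewrite /pol/=.
  have -> : E x = F x by apply/propext; exact: h.
  by have -> : E (refl z x) = F (refl z x) by apply/propext; exact: h'.
Qed.

Lemma aeq_moved E F s z : aeq m E F -> aeq m (moved s E z) (moved s F z).
Proof.
move=> EF; apply: aeqI; first by apply: aeqI => //; exact: aeq_refl.
apply: (@aeq_preimage_refl (oball s `\` E) (oball s `\` F)).
by apply: aeqI; [exact: aeq_refl|exact: aeqC].
Qed.

Lemma aeq_leb E F : aeq m E F -> leb E = leb F.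
Proof. exact: aeq_ext. Qed.

Lemma aeq_excess E F r : aeq m E F -> excess r E = excess r F.
Proof. by move=> EF; congr fine; apply: aeq_leb; apply: aeqI => //; exact: aeq_refl. Qed.

Lemma aeq_gain E F r : aeq m E F -> gain r E = gain r F.
Proof.
move=> EF; apply/funext => z; rewrite /gain (aeq_excess r EF); congr (_ - fine _).
rewrite -/(refl z) !polarizeE; apply: aeq_leb.
by apply: aeqI; [exact: aeq_pol|exact: aeq_refl].
Qed.

Let pm : {measure set (V * V) -> \bar R} := prodm m m.

Lemma aeq_near E F L r N : aeq m E F -> aeq pm (near_pairs L r N E) (near_pairs L r N F).
Proof.
(* Both strips are null even when the space has infinite measure, as 0 times +oo is 0. *)
move=> [Z [mZ Z0 h]]; exists ((Z `*` setT) `|` (setT `*` Z)); split.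
- by apply: measurableU; exact: measurableX.
- rewrite measureU0; [|exact: measurableX|exact: measurableX|].
    by rewrite /pm/= /prodm product_measure1E// [X in (X * _)%E]Z0 mul0e.
  by rewrite /pm/= /prodm product_measure1E// [X in (_ * X)%E]Z0 mule0.
- move=> [x y] /not_orP[/= hx hy].
  have {}hx : E x <-> F x by apply: h => Zx; exact: hx.
  have {}hy : E y <-> F y by apply: h => Zy; exact: hy.
  by rewrite /near_pairs/=; split => -[[a b] [a' b'] c c']; split => //; split => //; tauto.
Qed.

Lemma aeq_near_vol2 E F L r N Q : aeq m E F ->
  vol2 (near_pairs L r N E `&` Q) = vol2 (near_pairs L r N F `&` Q).
Proof.
move=> EF; congr fine; apply: (@aeq_ext _ _ _ pm).
by apply: aeqI; [exact: aeq_near|exact: aeq_refl].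
Qed.

(** The law is assumed for the states of the Lebesgue measurable set A; this transfers it to the
    states of a Borel set equal to A up to a null set, for which the one-step bounds are proved. *)
Lemma aeq_step_law E F L r N B : aeq m E F -> step_law L r N E B = step_law L r N F B.
Proof.
move=> EF; have X := aeq_excess r EF; have G := aeq_gain r EF.
have near Q := aeq_near_vol2 L r N Q EF.
have W : weight L r N E = weight L r N F.
  by apply/funext => z; rewrite /weight /F_set /G_set !near.
have C : weighted_case L r N E = weighted_case L r N F.
  by rewrite /weighted_case X /F_set /G_set -!setIUr near.
by rewrite /step_law C W G.
Qed.

End null_invariance.

Section polarization_measure.
Context {R : realType} {d : nat}.
Local Notation m := (@lebesgue_rV R d).

(** The loss identity at radius 0: the ball is empty, hence nothing is moved. *)
Lemma lebesgue_rV_pol z (E : set 'rV[R]_d) : measurable E -> (m E < +oo)%E ->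
  m (pol z E) = m E.
Proof.
move=> mE Eoo; have := polarization_loss 0 z mE Eoo.
have B0 : oball 0 = set0 :> set 'rV[R]_d.
  by apply/seteqP; split => // x; rewrite /oball/= ltNge enorm_ge0.
have -> : moved 0 E z = set0.
  by rewrite /moved B0; apply/seteqP; split => // x [_ []].
by rewrite B0 !setD0 measure0 adde0.
Qed.

End polarization_measure.

(** * The process of states and its sigma-algebras *)

Section polarization_process.
Context {R : realType} {d : nat} {S : Type} (sigma : nat -> S -> 'rV[R]_d -> 'rV[R]_d)
  (sO : forall k w, Omega (sigma k.+1 w)).
Local Notation m := (@lebesgue_rV R d).
Local Notation V := 'rV[R]_d.

Lemma polarize_seqS (E : set V) k w :
  polarize_seq sigma E k.+1 w = pol (sigma k.+1 w 0) (polarize_seq sigma E k w).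
Proof. by rewrite /= [in LHS](refl_Omega (sO k w)) polarizeE. Qed.

Lemma polarize_seq_le (E : set V) L k w : (forall x, E x -> enorm x <= L) ->
  forall x, polarize_seq sigma E k w x -> enorm x <= L.
Proof.
by move=> EL; elim: k => // k IH x; rewrite polarize_seqS; apply: pol_enorm_le.
Qed.

Lemma aeq_polarize_seq (E F : set V) k w : aeq m E F ->
  aeq m (polarize_seq sigma E k w) (polarize_seq sigma F k w).
Proof. by move=> EF; elim: k => // k IH; rewrite !polarize_seqS; exact: aeq_pol. Qed.

(** The map h allows different sigma-algebras on the probability space: the given one, and in
    [state_events_moved] the one generated by the first reflections. *)
Lemma measurable_polarize_seq {dT} {T : measurableType dT} (h : T -> S) (E : set V) k :
  measurable E ->
  (forall j, (j < k)%N -> measurable_fun setT (fun t => sigma j.+1 (h t) 0)) ->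
  measurable [set p : T * V | polarize_seq sigma E k (h p.1) p.2].
Proof.
move=> mE; elim: k => [_|k IH ms].
  have mp : measurable_fun setT (snd : T * V -> V) by exact: measurable_snd.
  by have := mp measurableT _ mE; rewrite setTI.
rewrite (_ : [set _ | _] =
    [set p : T * V | pol (sigma k.+1 (h p.1) 0) (polarize_seq sigma E k (h p.1)) p.2]); last first.
  by apply/seteqP; split => p /=; rewrite -polarize_seqS.
apply: (measurable_pol_joint (z := fun t => sigma k.+1 (h t) 0) (E := fun t => polarize_seq sigma E k (h t))).
  exact: ms.
by apply: IH => j jk; apply: ms; exact: ltnW.
Qed.

Lemma lebesgue_rV_polarize_seq (E : set V) k w : measurable E -> (m E < +oo)%E ->
  measurable (polarize_seq sigma E k w) /\ m (polarize_seq sigma E k w) = m E.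
Proof.
move=> mE Eoo; elim: k => // k [mF FE]; rewrite polarize_seqS; split.
  exact: measurable_pol.
by rewrite lebesgue_rV_pol// FE.
Qed.

End polarization_process.

Section state_sigma_algebra.
Context {R : realType} {d : nat} {dT : measure_display} {T : measurableType dT}
  (sigma : nat -> T -> 'rV[R]_d -> 'rV[R]_d) (sO : forall k w, Omega (sigma k.+1 w))
  (ms : forall k, measurable_fun setT (fun w => sigma k.+1 w 0)).
Local Notation m := (@lebesgue_rV R d).
Local Notation V := 'rV[R]_d.

Lemma measurable_state_events (A : set V) N D : state_events sigma A N D -> measurable D.
Proof.
case=> + _; apply: smallest_sub; first exact: sigma_algebra_measurable.
rewrite -bigcup_seq => B [i /= _ [C mC <-]].
by exact: ms.
Qed.

(** The event is a function of the state of A through the outer measure [leb], which does not see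
    the null set between A and [B0]. It is generated by the first N reflections because
    [measurable_polarize_seq] holds over that sigma-algebra. *)
Lemma state_events_moved (A B0 : set V) N s x t : measurable B0 -> aeq m A B0 ->
  state_events sigma A N [set w | t < fine (m (moved s (polarize_seq sigma B0 N w) x))].
Proof.
move=> mB AB; split; last first.
  have e w : fine (leb (moved s (polarize_seq sigma A N w) x)) =
      fine (m (moved s (polarize_seq sigma B0 N w) x)).
    rewrite (aeq_leb (aeq_moved s x (aeq_polarize_seq sO N w AB))) -volE//.
    apply: measurable_moved.
    by elim: N => // N IH; rewrite polarize_seqS//; exact: measurable_pol.
  by exists [set F | t < fine (leb (moved s F x))]; apply/seteqP; split => w /=; rewrite e.
pose G := \big[setU/set0]_(i < N) preimage_set_system setT (fun w : T => sigma i.+1 w 0) measurable.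
pose U := g_sigma_algebraType G.
have mU j : (j < N)%N -> measurable_fun setT (fun w : U => sigma j.+1 w 0).
  move=> jN _ C mC; apply: sub_sigma_algebra; rewrite /G -bigcup_seq.
  by exists (Ordinal jN) => /=; [rewrite mem_index_enum|exists C].
have mS := @measurable_polarize_seq _ _ _ sigma sO _ U id B0 N mB mU.
have mM : measurable_fun setT (fun w : U => fine (m (moved s (polarize_seq sigma B0 N w) x))).
  apply: measurableT_comp => //.
  by apply: (@measurable_moved_joint _ _ _ U s _ (fun=> x)).
have := mM measurableT _ (measurable_itv `]t, +oo[%R).
rewrite setTI; congr (_ _); apply/seteqP; split => w /=; by rewrite in_itv/= andbT.
Qed.

End state_sigma_algebra.

(** * Rate of decay *)

Section recursion.
Context {R : realType}.

(** Sum over the j steps of the window; as x is nonincreasing, each left side is at least x (N +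
    j). *)
Lemma telescope_bound (x y z : nat -> R) (s A B : R) N j :
  (forall k, x k.+1 <= x k) ->
  (forall k, (N <= k < N + j)%N ->
     x k <= s + A * (x k - x k.+1) + B * ((y k - y k.+1) + (z k - z k.+1))) ->
  j%:R * x (N + j)%N <= j%:R * s + A * (x N - x (N + j)%N) +
    B * ((y N - y (N + j)%N) + (z N - z (N + j)%N)).
Proof.
move=> xn; elim: j => [_|j IH h]; first by rewrite addn0 !subrr addr0 !(mul0r, mulr0) !addr0.
have {}IH := IH (fun k hk => h k ltac:(lia)).
have := h (N + j)%N ltac:(lia); have /(ler_wpM2l (ler0n R j.+1)) := xn (N + j)%N.
by rewrite addnS -!natr1; lra.
Qed.

(** Y - Y2 and Z - Z2 are each at most X, whence b * 2. The 36 is 4 * 9: since the rate changes at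
    most by a factor 9 when N doubles, the last term will be at most a quarter of the target. *)
Lemma averaged_bound (N s a b c X X2 Y Y2 Z Z2 : R) : 0 < N -> 0 <= a -> 0 <= b ->
  0 <= X -> 0 <= X2 -> 0 <= Y2 -> Y <= X -> Z <= Z2 + X ->
  a = N * c -> b * 2 <= N / 36 ->
  N * X2 <= N * s + a * (X - X2) + b * ((Y - Y2) + (Z - Z2)) ->
  X2 <= s + c * X + X / 36.
Proof.
move=> N0 a0 b0 X0 X20 Y20 YX ZX ac bN h; rewrite -(ler_pM2l N0); apply: (le_trans h).
have h1 : a * (X - X2) <= a * X by apply: ler_wpM2l => //; lra.
have h2 : b * ((Y - Y2) + (Z - Z2)) <= b * (2 * X) by apply: ler_wpM2l => //; lra.
have := ler_wpM2r X0 bN; move: h1 h2; rewrite ac; lra.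
Qed.

(* The choice s = M t_n makes the three terms of the hypothesis at most
   M t_n / 2, M t_n / 4 and M t_n / 4. *)
Lemma doubling_decay (x t : nat -> R) (a : R) N1 : 0 <= a ->
  (forall n, 0 <= x n) -> (forall n, x n.+1 <= x n) ->
  (forall n, (1 < n)%N -> 0 < t n) ->
  (forall N n, (1 < N)%N -> (2 * N <= n <= 2 * N + 1)%N -> t N <= 9 * t n) ->
  (1 < N1)%N ->
  (forall N s, (N1 <= N)%N -> 0 < s ->
     x (2 * N)%N <= s / 2 + a * t N * x N / s + x N / 36) ->
  exists M, forall n, (N1 <= n)%N -> x n <= M * t n.
Proof.
move=> a0 x0 xn t0 tt N11 rec.
have xle i j : (i <= j)%N -> x j <= x i.
  move=> ij; rewrite -(subnKC ij); elim: (j - i)%N => [|k IH]; first by rewrite addn0.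
  by rewrite addnS (le_trans (xn _)).
(* 324 = 4 * 81, where 81 comes from using t N <= 9 * t n once for t N and once for x N. The sum
   takes care of n < 2 N1; it starts at 2, from where t is known to be positive. *)
pose M := 324 * a + 1 + \sum_(2 <= i < 2 * N1) x i / t i.
have S0 i : (1 < i)%N -> 0 <= x i / t i by move=> i1; rewrite divr_ge0// ltW// t0.
have S1 : 0 <= \sum_(2 <= i < 2 * N1) x i / t i.
  by rewrite big_nat_cond; apply: sumr_ge0 => i /andP[/andP[i1 _] _]; exact: S0.
have M0 : 0 < M by rewrite /M; lra.
exists M => n; elim/ltn_ind: n => n IH nN1.
have n1 : (1 < n)%N by lia.
have [nN|nN] := ltnP n (2 * N1).
  rewrite -ler_pdivrMr ?t0//; apply: (@le_trans _ _ (\sum_(2 <= i < 2 * N1) x i / t i)).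
    rewrite (bigD1_seq n) ?iota_uniq ?mem_index_iota ?n1//= lerDl big_seq_cond.
    by apply: sumr_ge0 => i /andP[]; rewrite mem_index_iota => /andP[i1 _] _; exact: S0.
  by rewrite /M; lra.
pose N := n./2.
have Nn : (2 * N <= n <= 2 * N + 1)%N by rewrite /N; have := odd_double_half n; lia.
have NN1 : (N1 <= N)%N by lia.
have xN := IH N ltac:(lia) NN1.
have tN : t N <= 9 * t n by apply: tt => //; lia.
have tN0 : 0 < t N by apply: t0; lia.
have tn0 := t0 n n1.
have := rec N (M * t n) NN1 (mulr_gt0 M0 tn0).
have /xle : (2 * N <= n)%N by lia.
move=> h1 /(le_trans h1); move/le_trans; apply.
have h2 : a * t N * x N / (M * t n) <= 81 * a * t n.
  rewrite ler_pdivrMr ?mulr_gt0//.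
  apply: (@le_trans _ _ (a * (9 * t n) * (M * (9 * t n)))); last by rewrite le_eqVlt; apply/orP; left; apply/eqP; ring.
  apply: ler_pM => //.
  - by rewrite mulr_ge0// ltW.
  - by rewrite ler_wpM2l.
  - by apply: (le_trans xN); rewrite ler_wpM2l// ltW.
have h3 : x N <= M * (9 * t n) by apply: (le_trans xN); rewrite ler_wpM2l// ltW.
have h4 : 324 * a * t n <= M * t n by rewrite ler_wpM2r ?(ltW tn0)// /M; lra.
by lra.
Qed.

End recursion.

Section rates.
Context {R : realType} (d : nat) (d1 : (1 < d)%N).
Local Notation p := (1 - (d%:R : R)^-1).

Definition rate (n : nat) : R := n%:R `^ (- (2 - d%:R^-1)) * ln n%:R `^ p.

Let p0 : 0 <= p.
Proof. by rewrite subr_ge0 invf_le1 ?ler1n ?ltr0n// ltnW. Qed.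

Let p1 : p <= 1.
Proof. by rewrite lerBlDr lerDl invr_ge0. Qed.

Let ln0 n : (1 < n)%N -> 0 < ln (n%:R : R).
Proof. by move=> n1; rewrite ln_gt0// ltr1n. Qed.

Lemma rate_gt0 n : (1 < n)%N -> 0 < rate n.
Proof. by move=> n1; rewrite mulr_gt0// powR_gt0 ?ln0// ltr0n ltnW. Qed.

(** The order of lambda_n divided by the length n of the window: this is where the exponent 2 - 1/d
    arises. *)
Lemma rateE n : (1 < n)%N -> (ln n%:R / n%:R) `^ p / n%:R = rate n.
Proof.
move=> n1; have n0 : 0 < n%:R :> R by rewrite ltr0n ltnW.
have e : - (2 - d%:R^-1) = - p + - 1 :> R by lra.
rewrite /rate e (powRD (r := - p)); last by apply/implyP => _; exact: lt0r_neq0.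
rewrite powRM; [|exact: ltW (ln0 n1)|by rewrite invr_ge0 ltW].
have -> : n%:R^-1 `^ p = n%:R `^ (- p) :> R.
  by rewrite -powR_inv1 ?(ltW n0)// -powRrM mulN1r.
by rewrite powR_inv1 ?(ltW n0)//; ring.
Qed.

(** n <= 3 N and the exponent 2 - 1/d is at most 2, whence 9 = 3^2; the logarithm only increases. *)
Lemma rate_double N n : (1 < N)%N -> (2 * N <= n <= 2 * N + 1)%N -> rate N <= 9 * rate n.
Proof.
move=> N1 /andP[h1 h2]; have n1 : (1 < n)%N by lia.
have N0 : 0 < N%:R :> R by rewrite ltr0n ltnW.
have n0 : 0 < n%:R :> R by rewrite ltr0n ltnW.
have lN : ln (N%:R : R) `^ p <= ln (n%:R : R) `^ p.
  by apply: ge0_ler_powR; rewrite ?nnegrE ?(ltW (ln0 _))// ler_ln ?posrE// ler_nat; lia.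
rewrite /rate mulrA; apply: ler_pM => //; rewrite ?powR_ge0//.
rewrite !powRN -ler_pdivrMr ?invr_gt0 ?powR_gt0// invrK mulrC -ler_pdivlMr ?invr_gt0 ?powR_gt0//.
rewrite invrK; apply: (@le_trans _ _ ((3 * N%:R) `^ (2 - d%:R^-1))).
  apply: ge0_ler_powR; rewrite ?nnegrE ?mulr_ge0 ?(ltW N0) ?(ltW n0)//; first by have := p0; lra.
  by rewrite -natrM ler_nat; lia.
rewrite powRM// ?(ltW N0)// ler_wpM2r ?powR_ge0//.
apply: (@le_trans _ _ (3 `^ 2%:R)); first by rewrite ler_powR ?ler1n//; have := p1; lra.
by rewrite powR_mulrn//; lra.
Qed.

Lemma ln_nat_ge (c : R) : exists N0 : nat, forall n, (N0 <= n)%N -> c <= ln (n%:R : R).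
Proof.
exists (Num.truncn (expR c)).+1 => n hn.
have h : expR c <= n%:R.
  apply: ltW; apply: (lt_le_trans (truncnS_gt (expR c))).
  by rewrite ler_nat.
by rewrite -(expRK c) ler_ln// posrE (expR_gt0, lt_le_trans (expR_gt0 c)).
Qed.

(** ln n = 2 ln (sqrt n) < 2 sqrt n, so the quotient is at most 2 / sqrt n. *)
Lemma ln_natV_le (c : R) : 0 < c -> exists N0 : nat, forall n, (N0 <= n)%N -> (1 < n)%N ->
  ln (n%:R : R) / n%:R <= c.
Proof.
move=> c0; exists (Num.truncn ((2 / c) ^+ 2)).+1 => n hn n1.
have h : (2 / c) ^+ 2 <= n%:R.
  apply: ltW; apply: (lt_le_trans (truncnS_gt ((2 / c) ^+ 2))).
  by rewrite ler_nat.
have n0 : 0 < n%:R :> R by rewrite ltr0n ltnW.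
pose q := Num.sqrt (n%:R : R); have q0 : 0 < q by rewrite sqrtr_gt0.
have nq : n%:R = q ^+ 2 by rewrite sqr_sqrtr// ltW.
have cq : 2 / c <= q.
  by rewrite -(ler_pXn2r (n := 2)) ?nnegrE ?(ltW q0) ?divr_ge0 ?(ltW c0)// -nq.
have lq := ltW (ln_sublinear q0).
rewrite ler_pdivrMr// nq lnXn// -mulr_natl.
apply: (@le_trans _ _ (2 * q)); first by rewrite ler_wpM2l.
rewrite expr2 mulrA ler_wpM2r ?(ltW q0)// mulrC -ler_pdivrMr//.
Qed.

End rates.

(** k < 2 N <= N^2 gives ln k <= 2 ln N. *)
Lemma log_ratio_bounds (R : realType) N k : (1 < N)%N -> (N <= k < N + N)%N ->
  ln (N%:R : R) / (2 * N%:R) <= ln (k%:R : R) / k%:R <= 2 * (ln (N%:R : R) / N%:R).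
Proof.
move=> N1 /andP[Nk kN]; have N0 : 0 < N%:R :> R by rewrite ltr0n ltnW.
have k0 : 0 < k%:R :> R by rewrite ltr0n; lia.
have lN : 0 < ln (N%:R : R) by rewrite ln_gt0// ltr1n.
have Nk' : N%:R <= k%:R :> R by rewrite ler_nat.
have lk : ln (N%:R : R) <= ln k%:R by rewrite ler_ln ?posrE.
have lk2 : ln (k%:R : R) <= 2 * ln N%:R.
  rewrite mulr_natl -lnXn// ler_ln ?posrE ?exprn_gt0// -natrX ler_nat; nia.
have Nk2 : k%:R <= 2 * N%:R :> R by rewrite -natrM ler_nat mul2n -addnn ltnW.
apply/andP; split.
  apply: ler_pM; rewrite ?invr_ge0 ?mulr_ge0 ?(ltW lN) ?(ltW N0)//.
  by rewrite lef_pV2 ?posrE ?mulr_gt0.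
rewrite mulrA; apply: ler_pM; rewrite ?invr_ge0 ?(ltW k0) ?(le_trans (ltW lN) lk)//.
by rewrite lef_pV2 ?posrE.
Qed.

Lemma Ex_add {R : realType} {dT : measure_display} {T : measurableType dT} (P : probability T R)
    (g h : T -> R) M : measurable_fun setT g -> measurable_fun setT h ->
  (forall w, 0 <= g w <= M) -> (forall w, 0 <= h w <= M) ->
  Ex P (fun w => g w + h w) = Ex P g + Ex P h.
Proof.
move=> mg mh gM hM; have h0 w : 0 <= h w by have /andP[] := hM w.
have g0 w : 0 <= g w by have /andP[] := gM w.
have gh w : g w + h w <= M + M.
  by apply: lerD; [have /andP[] := gM w|have /andP[] := hM w].
have := @integral_loss _ _ _ P (fun w => g w + h w) h g (M + M) (measurable_funD mg mh) mh mg
  h0 g0 (fun w => addrC _ _) gh.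
by rewrite (ExE P mg gM) => -[->]; rewrite subrK.
Qed.

(** * The expected excess along the process *)

Section expected_process.
Context {R : realType} {n : nat} (n0 : (0 < n)%N)
  {dT : measure_display} {T : measurableType dT} (P : probability T R).
Local Notation V := 'rV[R]_n.+1.
Local Notation m := (@lebesgue_rV R n.+1).
Context (L r : R) (A B0 : set V) (L0 : 0 < L) (r0 : 0 < r) (mB : measurable B0)
  (BL : forall x, B0 x -> enorm x <= L) (mr : m (oball r) = m B0) (AB : aeq m A B0)
  (sigma : nat -> T -> V -> V)
  (sO : forall k w, Omega (sigma k.+1 w))
  (ms : forall k, measurable_fun setT (fun w => sigma k.+1 w 0))
  (law : forall N D B, state_events sigma A N D -> measurable B ->
     P (D `&` [set w | B (sigma N.+1 w 0)]) =
     (\int[P]_(w in D) (step_law L r N (polarize_seq sigma A N w) B)%:E)%E).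

Local Notation E k w := (polarize_seq sigma B0 k w).

Definition mean_outer t k := Ex P (fun w => outer (E k w) t).

Let mE k : measurable [set p : T * V | E k p.1 p.2].
Proof. exact: (@measurable_polarize_seq _ _ _ sigma sO _ T id B0 k mB (fun j _ => ms j)). Qed.

Let EL k w x : E k w x -> enorm x <= L.
Proof. exact: (@polarize_seq_le _ _ _ sigma sO B0 L k w BL). Qed.

Let Boo : (m B0 < +oo)%E := state_ltoo mB BL.

Let mEw k w : measurable (E k w).
Proof. by have [] := lebesgue_rV_polarize_seq sO k w mB Boo. Qed.

Let mrE k w : m (oball r) = m (E k w).
Proof. by have [_ ->] := lebesgue_rV_polarize_seq sO k w mB Boo. Qed.

Let bd k t w : 0 <= outer (E k w) t <= fine (m B0).
Proof.
rewrite outer_ge0/= -mr (mrE k w) -lee_fin -(outerE (mEw k w) (@EL k w)).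
rewrite -(sub_state_fin (mEw k w) (@EL k w) (mEw k w) (@subset_refl _ _)).
apply: le_measure; rewrite ?inE; last exact: subDsetl; last exact: mEw.
by apply: measurableD; [exact: mEw|exact: measurable_oball].
Qed.

Let mo k t : measurable_fun setT (fun w => outer (E k w) t) := measurable_outer (mE k) t.

Lemma mean_outer_ge0 t k : 0 <= mean_outer t k.
Proof. by apply: Ex_ge0 => w; exact: outer_ge0. Qed.

Lemma mean_outer_le s t k : s <= t -> mean_outer t k <= mean_outer s k.
Proof.
move=> st; apply: (@le_Ex _ _ _ P _ _ (fine (m B0))) => // w.
- exact: outer_ge0.
- exact: (outer_le (mEw k w) (@EL k w) st).
- by have /andP[] := bd k s w.
Qed.

Lemma mean_outer_decr t k : mean_outer t k.+1 <= mean_outer t k.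
Proof.
apply: (@le_Ex _ _ _ P _ _ (fine (m B0))) => // w.
- exact: outer_ge0.
- rewrite -lee_fin -(outerE (mEw k.+1 w) (@EL k.+1 w)) -(outerE (mEw k w) (@EL k w)).
  rewrite (polarize_seqS sO) (polarization_loss t (sigma k.+1 w 0) (mEw k w) (state_ltoo (mEw k w) (@EL k w))).
  by rewrite leeDl.
- by have /andP[] := bd k t w.
Qed.

(** By [inner_outer] the value of [outer t] at time j exceeds the one at time k by at most [inner t]
    at time j, hence by at most X. This serves for t = r - h, where [outer t] itself stays bounded
    away from 0. *)
Lemma mean_outer_inner t j k : t <= r -> mean_outer t j <= mean_outer t k + mean_outer r j.
Proof.
move=> tr; rewrite -(@Ex_add _ _ _ P _ _ (fine (m B0)))//.
apply: (@le_Ex _ _ _ P _ _ (fine (m B0) + fine (m B0))) => //.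
- exact: measurable_funD.
- by move=> w; exact: outer_ge0.
- move=> w; have h1 := inner_outer (mEw j w) (@EL j w) t.
  have h2 := inner_outer (mEw k w) (@EL k w) t.
  have h3 := inner_le (mEw j w) tr; have h4 := inner_r (mEw j w) (@EL j w) (mrE j w).
  have h5 := inner_ge0 (E := E k w) t.
  move: h1 h2; rewrite -(mrE j w) -(mrE k w); move: h3; rewrite h4; lra.
- by move=> w; apply: lerD; [have /andP[] := bd k t w|have /andP[] := bd j r w].
Qed.

Let kappa := ball_vol (R:=R) n.+1 * r ^+ n.

Lemma mean_outer_step N (h Lam s : R) : (1 < N)%N ->
  0 < h -> h < delta (d:=n.+1) L N -> h <= r ->
  lambda (d:=n.+1) L N <= Lam -> 0 < s ->
  mean_outer r N <= s / 2 +
   Lam / (2 * s * c1 (n:=n) L) * (mean_outer r N - mean_outer r N.+1) +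
   2 / (c2 (n:=n) L * (kappa * h)) *
     ((mean_outer (r + h) N - mean_outer (r + h) N.+1) +
      (mean_outer (r - h) N - mean_outer (r - h) N.+1)).
Proof.
move=> N1 h0 hd hr lL s0.
have z0 w : sigma N.+1 w 0 != 0 by have [] := sO N w.
have step t : mean_outer t N.+1 = Ex P (fun w => outer (pol (sigma N.+1 w 0) (E N w)) t).
  by congr Ex; apply/funext => w; rewrite -(polarize_seqS sO).
rewrite !step.
apply: (@one_step_bound R n n0 _ T P L r (fun w => E N w) L0 r0 (mE N) (@EL N) (mrE N) N N1
  (fun w => sigma N.+1 w 0) (ms N) z0 (state_events sigma A N)) => //.
- by move=> D; exact: measurable_state_events.
- move=> D B DD mB'; apply: (eq_trans (law DD mB')).
  apply: eq_integral => w _.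
  apply: (congr1 EFin).
  by apply: aeq_step_law; exact: aeq_polarize_seq.
- by move=> s' x t; exact: state_events_moved.
Qed.

Let cd0 : 0 < @c_d R n.+1 L .
Proof. exact: c_d_gt0. Qed.
Let kappa0 : 0 < kappa. Proof. by rewrite mulr_gt0 ?ball_vol_gt0 ?exprn_gt0. Qed.
Let c20 : 0 < c2 (n:=n) L.
Proof.
apply: mulr_gt0; rewrite invr_gt0; last by rewrite exprn_gt0// mulr_gt0.
by apply: mulr_gt0; [exact: mulr_gt0|exact: omega_gt0].
Qed.

(** The constant of [lambda_window]; the factor 2 before c_d is that of [log_ratio_bounds]. *)
Let Cl : R := (2 ^+ n.+2 * @omega R n.+1 * L) `^ n.+1%:R^-1 * (2 * @c_d R n.+1 L) `^ (1 - n.+1%:R^-1).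

Let lambda_window N k : (1 < N)%N -> (N <= k < N + N)%N ->
  lambda (d:=n.+1) L k <= Cl * (ln N%:R / N%:R) `^ (1 - n.+1%:R^-1).
Proof.
move=> N1 Nk; have /andP[h1 h2] := log_ratio_bounds R N1 Nk.
have N0 : 0 < N%:R :> R by rewrite ltr0n ltnW.
have lN : 0 <= ln (N%:R : R) / N%:R by rewrite divr_ge0 ?(ltW N0)// ln_ge0// ler1n ltnW.
rewrite /lambda /Cl -[leRHS]mulrA; apply: ler_wpM2l; first exact: powR_ge0.
rewrite -powRM//; last by rewrite mulr_ge0// ltW.
have e : 0 <= ln k%:R / k%:R :> R.
  by apply: le_trans h1; rewrite divr_ge0 ?mulr_ge0 ?(ltW N0)// ln_ge0// ler1n ltnW.
apply: ge0_ler_powR; rewrite ?nnegrE.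
- by rewrite subr_ge0 invf_le1 ?ler1n ?ltr0n.
- by rewrite mulr_ge0// ltW.
- by rewrite mulr_ge0// mulr_ge0// ltW.
- by rewrite -mulrA mulrCA ler_wpM2l// ltW.
Qed.

Lemma mean_outer_double N s : (1 < N)%N -> 0 < s ->
  @c_d R n.+1 L * ln N%:R / (4 * N%:R) <= r ->
  576 <= c2 (n:=n) L * kappa * @c_d R n.+1 L * ln N%:R ->
  mean_outer r (N + N) <= s / 2 +
    Cl / (2 * c1 (n:=n) L) * rate n.+1 N / s * mean_outer r N + mean_outer r N / 36.
Proof.
move=> N1 s0 hr hl.
have N0 : 0 < N%:R :> R by rewrite ltr0n ltnW.
have lN : 0 < ln (N%:R : R) by rewrite ln_gt0// ltr1n.
(* delta_k is at least c_d ln N / (2 N) over the window; half of that leaves the strict inequality h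
   < delta_k. *)
pose h := @c_d R n.+1 L * ln N%:R / (4 * N%:R).
have h0 : 0 < h := divr_gt0 (mulr_gt0 cd0 lN) (mulr_gt0 (ltr0n R 4) N0).
pose Lam := Cl * (ln N%:R / N%:R) `^ (1 - n.+1%:R^-1).
have Cl0 : 0 < Cl.
  apply: mulr_gt0; apply: powR_gt0; last exact: mulr_gt0.
  by apply: mulr_gt0 => //; apply: mulr_gt0; [exact: exprn_gt0|exact: omega_gt0].
have c10 := c1_gt0 (n := n) L0.
have x0 t k := mean_outer_ge0 t k.
pose a := Lam / (2 * s * c1 (n:=n) L).
pose b := 2 / (c2 (n:=n) L * (kappa * h)).
have a0 : 0 <= a.
  rewrite /a; apply: divr_ge0; first by rewrite mulr_ge0 ?powR_ge0// ltW.
  by rewrite ltW// !mulr_gt0.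
have b0 : 0 <= b by rewrite divr_ge0// ltW// mulr_gt0// mulr_gt0.
have aN : a = N%:R * (Cl / (2 * c1 (n:=n) L) * rate n.+1 N / s).
  rewrite /a /Lam -(rateE n.+1 N1); move: (_ `^ _) => q; field.
  by rewrite (gt_eqF s0) (gt_eqF c10) (gt_eqF N0).
(* b * 2 equals 16 N / (c2 kappa c_d ln N), and 576 = 16 * 36. *)
have bN : b * 2 <= N%:R / 36.
  rewrite /b mulrAC ler_pdivrMr; last by rewrite mulr_gt0// mulr_gt0.
  have -> : N%:R / 36 * (c2 (n:=n) L * (kappa * h)) =
      (c2 (n:=n) L * kappa * @c_d R n.+1 L * ln N%:R) / 144.
    by rewrite /h; field; rewrite gt_eqF.
  by lra.
have := @telescope_bound _ (mean_outer r) (mean_outer (r + h)) (mean_outer (r - h)) (s / 2) a b N N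
  (mean_outer_decr r).
have step k : (N <= k < N + N)%N -> mean_outer r k <= s / 2 +
    a * (mean_outer r k - mean_outer r k.+1) +
    b * ((mean_outer (r + h) k - mean_outer (r + h) k.+1) +
         (mean_outer (r - h) k - mean_outer (r - h) k.+1)).
  move=> Nk; apply: mean_outer_step => //.
  - by move/andP: Nk => [/(leq_trans N1)].
  - have /andP[+ _] := log_ratio_bounds R N1 Nk.
    move/(ler_wpM2l (ltW cd0)); apply: lt_le_trans.
    rewrite /h -mulrA ltr_pM2l// ltr_pM2l// ltf_pV2 ?posrE ?mulr_gt0// ltr_pM2r//.
    by rewrite ltr_nat.
  - exact: lambda_window.
move=> /(_ step) {step}.
have xl : mean_outer (r + h) N <= mean_outer r N by apply: mean_outer_le; rewrite lerDl ltW.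
have xi : mean_outer (r - h) N <= mean_outer (r - h) (N + N) + mean_outer r N.
  by apply: mean_outer_inner; rewrite gerBl ltW.
move=> tele; apply: (averaged_bound N0 a0 b0 (x0 r N) (x0 r (N + N)%N)
  (x0 (r + h) (N + N)%N) xl xi aN bN tele).
Qed.

Lemma mean_outer_decay : exists M N1, forall N, (N1 <= N)%N ->
  mean_outer r N <= M * rate n.+1 N.
Proof.
pose c := c2 (n:=n) L * kappa * @c_d R n.+1 L.
have c0 : 0 < c := mulr_gt0 (mulr_gt0 c20 kappa0) cd0.
have [Na Ha] := ln_nat_ge (576 / c).
have [Nb Hb] := @ln_natV_le R (4 * r / @c_d R n.+1 L) (divr_gt0 (mulr_gt0 (ltr0n R 4) r0) cd0).
pose N1 := maxn 2 (maxn Na Nb).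
have d1 : (1 < n.+1)%N by [].
have Cl0 : 0 <= Cl / (2 * c1 (n:=n) L).
  have c10 := c1_gt0 (n := n) L0.
  apply: divr_ge0; last by rewrite ltW// mulr_gt0.
  by apply: mulr_ge0; exact: powR_ge0.
have dbl N s : (N1 <= N)%N -> 0 < s -> mean_outer r (2 * N)%N <= s / 2 +
    Cl / (2 * c1 (n:=n) L) * rate n.+1 N * mean_outer r N / s + mean_outer r N / 36.
  rewrite !geq_max => /and3P[N2 Na' Nb'] s0; rewrite mul2n -addnn (mulrAC _ _ s^-1); apply: mean_outer_double => //.
    have N0 : 0 < N%:R :> R by rewrite ltr0n ltnW.
    have -> : @c_d R n.+1 L * ln N%:R / (4 * N%:R) = ln N%:R / N%:R * (@c_d R n.+1 L / 4).
      by field; rewrite gt_eqF.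
    have -> : r = 4 * r / @c_d R n.+1 L * (@c_d R n.+1 L / 4) by field; rewrite gt_eqF.
    by rewrite ler_wpM2r ?Hb// divr_ge0// ltW.
  by have := Ha N Na'; rewrite ler_pdivrMr// mulrC.
have [M HM] := @doubling_decay R (mean_outer r) (rate n.+1) _ N1 Cl0 (mean_outer_ge0 r)
  (mean_outer_decr r) (@rate_gt0 R n.+1) (@rate_double R n.+1 d1) (leq_maxl _ _) dbl.
by exists M, N1.
Qed.

End expected_process.

Theorem theorem4 (R : realType) (d : nat) (L : R) (A : set 'rV[R]_d) (r : R)
    (dT : measure_display) (T : measurableType dT) (P : probability T R)
    (sigma : nat -> T -> 'rV[R]_d -> 'rV[R]_d) :
  (1 < d)%N -> 0 < L ->
  lebesgue_measurable A -> (forall x, A x -> enorm x <= L) ->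
  0 <= r -> leb (oball r : set 'rV[R]_d) = leb A ->
  (forall n w, Omega (sigma n.+1 w)) ->
  (forall n, measurable_fun [set: T] (fun w => sigma n.+1 w 0)) ->
  (forall n (D : set T) (B : set 'rV[R]_d),
     state_events sigma A n D -> measurable B ->
     P (D `&` [set w | B (sigma n.+1 w 0)]) =
     (\int[P]_(w in D) (step_law L r n (polarize_seq sigma A n w) B)%:E)%E) ->
  (fun n => fine ('E_P[fun w => excess r (polarize_seq sigma A n w)])%E) =O_\oo
  (fun n => n%:R `^ (- (2 - d%:R^-1)) * ln n%:R `^ (1 - d%:R^-1)).
Proof.
case: d A sigma => [//|n] A sigma n1 L0 [B0 [Nul [mB [Z [mZ Z0 NZ]] AE]]] AL r0 rA sO ms law.
have AB : aeq (@lebesgue_rV R n.+1) A B0.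
  exists Z; split => // x Zx; rewrite AE; split => [[//|/NZ//]|]; by left.
have BL x : B0 x -> enorm x <= L by move=> Bx; apply: AL; rewrite AE; left.
have mr : lebesgue_rV n.+1 (oball r) = lebesgue_rV n.+1 B0.
  have := rA; rewrite (aeq_leb AB) /leb !measurable_mu_extE//.
  exact: measurable_oball.
have Boo := state_ltoo mB BL.
have excE N w : excess r (polarize_seq sigma A N w) = outer (polarize_seq sigma B0 N w) r.
  rewrite (aeq_excess r (aeq_polarize_seq sO N w AB)) excessE//.
  by have [] := lebesgue_rV_polarize_seq sO N w mB Boo.
have meanE N : fine ('E_P[fun w => excess r (polarize_seq sigma A N w)])%E = mean_outer P B0 sigma r N.
  rewrite /mean_outer /Ex unlock; congr fine; apply: eq_integral => w _.
  by rewrite excE.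
have [M [N1 HM]] : exists M N1, forall N, (N1 <= N)%N ->
    mean_outer P B0 sigma r N <= M * rate n.+1 N.
  have [r0'|r0'] := ltP 0 r.
    exact: (@mean_outer_decay _ _ n1 _ _ _ _ _ _ _ L0 r0' mB BL mr AB _ sO ms law).
  (* For r = 0 the constant kappa of the one-step bounds vanishes, but then every state is a null
     set. *)
  have B00 : lebesgue_rV n.+1 B0 = 0%E.
    rewrite -mr (_ : oball r = set0) ?measure0//; apply/seteqP; split => // x.
    by rewrite /oball/= ltNge (le_trans r0' (enorm_ge0 x)).
  exists 0, 0%N => N _; rewrite mul0r /mean_outer /Ex integral0_eq// => w _.
  have [mE E0] := lebesgue_rV_polarize_seq sO N w mB Boo.
  rewrite /outer (_ : lebesgue_rV _ _ = 0%E)//; apply/eqP.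
  rewrite eq_le measure_ge0 andbT -[leRHS]B00 -E0; apply: le_measure; rewrite ?inE//.
  by apply: measurableD => //; exact: measurable_oball.
(* The constant of [eqO_exP] has to be positive. *)
apply/eqO_exP; exists (Num.max M 1); first by rewrite lt_max ltr01 orbT.
near=> N; rewrite meanE ger0_norm ?mean_outer_ge0// -/(rate n.+1 N).
have N2 : (1 < N)%N by near: N; exact: nbhs_infty_gt.
have t0 := rate_gt0 (R := R) n.+1 N2.
rewrite (gtr0_norm t0); apply: (@le_trans _ _ (M * rate n.+1 N)).
  by apply: HM; near: N; exact: nbhs_infty_ge.
by apply: ler_wpM2r; [exact: ltW|rewrite le_max lexx].
Unshelve. all: by end_near. Qed.
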